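(* Let $h>0$, $N\ge2$, $a\in\mathcal{A}_N$, and $\phi:\mathbb{R}\to[0,\infty)$ with $M^<(2h)<\infty$ and $\lim_{l\to\infty}M^>(l)=+\infty$. Let $(M^>)^{-1}(l)=\inf\{r\ge0: M^>(r)\ge l\}$. Let $(U^N_t)$ be the $N$-actor system in the representation described in the context. For $0\le s<t$ let $E=E_s=\inf\{r>0:\mathbf{N}^a([s,t]\times[0,r])\ge1\}$ and let $t-Z\in[s,t]$ be the time coordinate of the atom of $\mathbf{N}^a$ at height $E$. Then there exists a Poisson process $(P_r(NM^<(2h)))_{r\ge0}$ of rate $NM^<(2h)$, independent of $\mathbf{N}^a$, such that: 1. $|U_t^N(a)|\le (M^>)^{-1}(E)+h+\frac{2h}{N}P_Z(NM^<(2h))$ in the usual stochastic order; 2. $\mathbb{E}|U_t^N(a)|\le \inf_{s\in(0,t]}\big(\mathbb{E}((M^>)^{-1}(E_s))+h+h(t-s)M^<(2h)\big)$.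
   Context: $\mathcal{A}_N=\{1,\dots,N\}$. $\Phi(r)=\phi(r)+\phi(-r)$, $M^<(l)=\sup\{\Phi(r):r\in[0,l]\}$, $M^>(l)=\inf\{\Phi(r): r>l\}$. Let $(\mathbf{N}^a: a\in\mathcal{A}_N)$ be an i.i.d. family of Poisson random measures on $\mathbb{R}^+\times\mathbb{R}^+$ with intensity $ds\,dz$, and let the system (with arbitrary real initial values $U_0^N(b)$) solve, for each $a$, $$U_t^{N}(a)=U_0^{N}(a)-\int_0^t \int_0^{\infty} U_{s-}^{N}(a)\mathbf{1}\{z \leq \Phi(U_{s-}^{N}(a))\}\mathbf{N}^{a}(ds,dz)+ \frac{h}{N}\sum_{b\neq a}\int_0^t \int_0^{\infty}\big(\mathbf{1}\{z \leq \phi(U_{s-}^{N}(b))\}-\mathbf{1}\{\phi(U_{s-}^{N}(b))<z \leq \Phi(U_{s-}^{N}(b))\}\big)\mathbf{N}^{b}(ds,dz).$$ For nonnegative random variables, $X\le Y$ in the usual stochastic order means $\mathbb{P}(X>r)\le\mathbb{P}(Y>r)$ for all $r\ge0$. *)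

(* Defs.v *)
From HB Require Import structures.
From mathcomp Require Import all_boot all_order all_algebra.
From mathcomp Require Import all_classical all_reals all_analysis measurable_realfun.
Set Implicit Arguments. Unset Strict Implicit. Unset Printing Implicit Defensive.
Import Order.TTheory GRing.Theory Num.Theory.
Import numFieldNormedType.Exports.
Local Open Scope classical_set_scope.
Local Open Scope ring_scope.

Section phi_defs.
Context {R : realType}.
Variable phi : R -> R.

Definition Phi (r : R) : R := phi r + phi (- r).

Definition Mlt (l : R) : \bar R :=
  ereal_sup [set (Phi r)%:E | r in `[0, l]%classic].

(* M^>(l) = inf { Phi r : r > l } (finite since Phi >= 0 when phi >= 0) *)
Definition Mgt (l : R) : R := inf [set Phi r | r in `]l, +oo[%classic].

Definition Mgt_inv (l : \bar R) : \bar R :=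
  ereal_inf [set r%:E | r in [set r : R | 0 <= r /\ (l <= (Mgt r)%:E)%E]].
End phi_defs.

Section paths.
Context {R : realType}.

Definition leftlim (f : R -> R) (s : R) : R :=
  if s <= 0 then f 0 else lim (f x @[x --> s^'-]).

Definition cadlag (f : R -> R) : Prop :=
  (forall t, 0 <= t -> f x @[x --> t^'+] --> f t) /\
  (forall t, 0 < t -> cvg (f x @[x --> t^'-])).
End paths.

Definition poisson_w {R : realType} (m : R) (k : nat) : R :=
  m ^+ k / (k`!)%:R * expR (- m).

Section proba.
Context {R : realType} {d : measure_display} {T : measurableType d}.
Variable P : probability T R.
Local Open Scope ereal_scope.

Definition fam_events {I : Type} (J : set I) {dV : measure_display}
    {V : measurableType dV} (X : I -> T -> V) : set (set T) :=
  [set E | exists (n : nat) (ix : 'I_n -> I) (B : 'I_n -> set V),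
      (forall k, J (ix k) /\ measurable (B k)) /\
      E = \bigcap_k (X (ix k) @^-1` B k)].

(* independence of two families (of their generated sigma-algebras),
   expressed on the generating pi-systems *)
Definition indep_pi (F G : set (set T)) : Prop :=
  forall A B, F A -> G B -> P (A `&` B) = P A * P B.

(* mutual independence of finitely many families (each pi-system
   contains setT, so this covers all subfamilies) *)
Definition mutual_indep_pi (I : finType) (F : I -> set (set T)) : Prop :=
  forall E : I -> set T, (forall i, F i (E i)) ->
    P (\bigcap_i E i) = \prod_(i : I) P (E i).

Definition mutual_indep_rv (n : nat) {dV : measure_display}
    {V : measurableType dV} (X : 'I_n -> T -> V) : Prop :=
  forall B : 'I_n -> set V, (forall i, measurable (B i)) ->
    P (\bigcap_i (X i @^-1` B i)) = \prod_(i < n) P (X i @^-1` B i).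

Definition rm_events (Nm : T -> {measure set (R * R) -> \bar R}) :=
  fam_events (V := \bar R) measurable (fun (A : set (R * R)) (w : T) => Nm w A).

Definition intensity (A : set (R * R)) : \bar R :=
  (lebesgue_measure \x lebesgue_measure)
    (A `&` (`[0%R, +oo[%classic `*` `[0%R, +oo[%classic)).

Definition is_PRM (Nm : T -> {measure set (R * R) -> \bar R}) : Prop :=
  (forall A, measurable A -> measurable_fun setT (fun w => Nm w A)) /\
  (forall A, measurable A -> intensity A < +oo -> forall k : nat,
      P [set w | Nm w A = k%:R%:E] = (poisson_w (fine (intensity A)) k)%:E) /\
  (forall (n : nat) (A : 'I_n -> set (R * R)),
      (forall i, measurable (A i)) ->
      (forall i j, i != j -> A i `&` A j = set0) ->
      mutual_indep_rv (fun i w => Nm w (A i))).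

Definition is_poisson_process (Pp : R -> T -> R) (lam : R) : Prop :=
  (forall r, measurable_fun setT (Pp r)) /\
  (forall w, Pp 0%R w = 0%R) /\
  (forall w r, (0 <= r)%R -> exists k : nat, Pp r w = k%:R) /\
  (forall w r1 r2, (0 <= r1)%R -> (r1 <= r2)%R -> (Pp r1 w <= Pp r2 w)%R) /\
  (forall w r, (0 <= r)%R -> (fun x => Pp x w) x @[x --> r^'+] --> Pp r w) /\
  (forall r1 r2, (0 <= r1)%R -> (r1 <= r2)%R -> forall k : nat,
      P [set w | (Pp r2 w - Pp r1 w)%R = k%:R] =
      (poisson_w (lam * (r2 - r1)) k)%:E) /\
  (forall (n : nat) (tt : nat -> R), (0 <= tt 0%N)%R ->
      (forall i, (tt i <= tt i.+1)%R) ->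
      mutual_indep_rv (fun (i : 'I_n) w => (Pp (tt i.+1) w - Pp (tt i) w)%R)).
End proba.

Section system.
Context {R : realType} {d : measure_display} {T : measurableType d}.
Variable P : probability T R.
Local Open Scope ereal_scope.

Definition dom0t (t : R) : set (R * R) :=
  `[0%R, t]%classic `*` `[0%R, +oo[%classic.

Definition self_integrand (phi : R -> R) (f : R -> R) (x : R * R) : R :=
  (leftlim f x.1 * (if x.2 <= Phi phi (leftlim f x.1) then 1 else 0))%R.

Definition inter_integrand (phi : R -> R) (f : R -> R) (x : R * R) : R :=
  ((if x.2 <= phi (leftlim f x.1) then 1 else 0) -
   (if (phi (leftlim f x.1) < x.2) && (x.2 <= Phi phi (leftlim f x.1))
    then 1 else 0))%R.

Definition is_solution (phi : R -> R) (h : R) (N : nat)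
    (Nm : 'I_N -> T -> {measure set (R * R) -> \bar R})
    (u0 : 'I_N -> R) (U : R -> 'I_N -> T -> R) : Prop :=
  (forall t b, (0 <= t)%R -> measurable_fun setT (U t b)) /\
  {ae P, forall w,
     (forall b, cadlag (fun t => U t b w)) /\
     (forall b, U 0%R b w = u0 b) /\
     (forall t, (0 <= t)%R -> forall a : 'I_N,
        (forall b, (Nm b w).-integrable (dom0t t)
            (fun x => (self_integrand phi (fun s => U s b w) x)%:E)) /\
        (forall b, (Nm b w).-integrable (dom0t t)
            (fun x => (inter_integrand phi (fun s => U s b w) x)%:E)) /\
        (U t a w)%:E =
          (u0 a)%:E
          - \int[Nm a w]_(x in dom0t t)
               (self_integrand phi (fun s => U s a w) x)%:E
          + (h / N%:R)%:E *
            \sum_(b < N | b != a)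
               \int[Nm b w]_(x in dom0t t)
                  (inter_integrand phi (fun s => U s b w) x)%:E)}.

Definition Ehit (Nm : T -> {measure set (R * R) -> \bar R}) (s t : R) (w : T)
  : \bar R :=
  ereal_inf [set r%:E | r in [set r : R | (0 < r)%R /\
     1 <= Nm w (`[s, t]%classic `*` `[0%R, r]%classic)]].

Definition Ztime (Nm : T -> {measure set (R * R) -> \bar R}) (s t : R) (w : T)
  : R :=
  (t - xget t [set u : R | (s <= u <= t)%R /\
                 (1%:E <= Nm w [set (u, fine (Ehit Nm s t w))])%E])%R.
End system.

(* Main.v *)
Require Import Defs.
From HB Require Import structures.
From mathcomp Require Import all_boot all_order all_algebra.
From mathcomp Require Import all_classical all_reals all_analysis measurable_realfun.
From mathcomp Require Import zify ring lra.
Import Order.TTheory GRing.Theory Num.Theory.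
Import numFieldNormedType.Exports.
Local Open Scope classical_set_scope.
Local Open Scope ring_scope.

(** Let [tau] be the time of the lowest atom of [N^a] over [[s, t]] and [E] its height.
    If the atom makes [a] spike then [U_tau(a) = 0], otherwise [Phi(U_tau-(a)) < E]; in
    both cases [|U_tau(a)| <= (M^>)^-1(E)].  After the last spike of [a] in [(tau, t]] the
    potential of [a] moves by [h/N] per spike of the other actors, so it remains to bound
    the number [K] of these.  Call a spike small if it is fired from a potential of absolute
    value at most [2h].  As an actor is reset to [0] when it spikes, among [2N] consecutive
    spikes of the others each actor has at most one large spike.  Hence a full block of [2N]
    spikes has at least as many small spikes as large ones, the last incomplete block has at
    most [N - 1] large ones, and [K <= N - 1 + 2S], with [S] the number of small spikes.
    A small spike is an atom of height at most [M^<(2h)], so [S] is dominated by the number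
    of atoms of the other actors in [[tau, t] x [0, c]] as soon as [c >= M^<(2h)].  With
    [c = M^<(2h) N/(N - 1)] this number, read backwards from [t], is a Poisson process of
    rate [N M^<(2h)], independent of [N^a].

    For the mean, [c = M^<(2h)] is used instead: the total rate is then only
    [(N - 1) M^<(2h)], and the gain [(N - 1)/N] pays for replacing [tau] by a
    discretisation, in time and height, whose law is explicit. *)

(** * Step functions and spike counting *)

(** A Poisson random measure is known through its values on one fixed set at a time, whereas the
    spikes of a path form a set that depends on the outcome. Hence a null set is discarded, outside
    of which each measure is natural-valued on all Borel subsets of bounded boxes, no two atoms are
    simultaneous and no two atoms of [N^a] have the same height; what remains is a statement on one
    deterministic path. The block length [2N] is dictated by the threshold: [2N] moves of size [h/N]
    cannot carry a potential from [0] beyond [2h]. Small spikes are counted from [tau] on, not from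
    the last spike of [a], because [tau] is a function of [N^a] alone: this is what lets an
    independent process be evaluated at [Z = t - tau]. In the mean the factor [2] of [2h/N]
    disappears because [tau] is uniform on [[s, t]], so that [t - tau] has mean [(t - s)/2]; the
    discretisation bounds the resulting mean without computing the law of [tau]. *)

Section step_functions.
Context {R : realType}.

(** Together with monotonicity: [c] is constant on some [[x, y]], which is right continuity for a
    natural-valued function. *)
Definition right_step (c : R -> nat) :=
  forall x, exists2 y, x < y & c y = c x.

(** The jump time is the infimum of the level set [m <= c x]; [right_step] puts the infimum itself
    into the set. *)
Lemma first_hit (c : R -> nat) (u v : R) (m : nat) :
  {homo c : x y / x <= y >-> (x <= y)%N} -> right_step c ->
  (c u < m)%N -> (m <= c v)%N ->
  exists q, [/\ u < q, q <= v, (m <= c q)%N & forall x, x < q -> (c x < m)%N].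
Proof.
move=> cmono cright cu cv.
pose D := [set x | (m <= c x)%N].
have Dlb x : D x -> u < x.
  by rewrite /D /= ltNge => mx; apply/negP => /cmono; lia.
have infD : has_inf D.
  by split; [exists v|exists u => x /Dlb /ltW].
exists (inf D).
have Dinf : D (inf D).
  have [y xy cyx] := cright (inf D).
  have [z Dz zy] : exists2 z, D z & z < y.
    by have := inf_adherent (eps := y - inf D); rewrite subr_gt0 => /(_ _ xy infD)[z Dz];
      rewrite subrKC; exists z.
  by rewrite /D /= -cyx (leq_trans Dz)//; apply/cmono/ltW.
split => //.
- exact: Dlb.
- by apply: ge_inf => //; exact: infD.2.
- move=> x; rewrite ltNge ltnNge; apply: contra => mx.
  by apply: ge_inf => //; exact: infD.2.
Qed.

(** As long as [c] still changes on [[u, q[], the point [u] is moved to a point of change; each move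
    lowers [c q - c u], so there are finitely many. *)
Lemma left_step (c : R -> nat) (u q : R) : u < q ->
  {homo c : x y / x <= y >-> (x <= y)%N} ->
  exists x, [/\ u <= x, x < q & forall y, x <= y -> y < q -> c y = c x].
Proof.
move=> uq cmono.
have [n] := ubnP (c q - c u)%N; elim: n u uq => // n IH u uq le.
have [h|/existsNP[y /not_implyP[uy /not_implyP[yq cy]]]] := pselect (forall y, u <= y -> y < q -> c y = c u).
  by exists u.
have [] := IH y yq.
  have := cmono _ _ uy; have := cmono _ _ (ltW yq); lia.
by move=> x [yx xq cx]; exists x; split => //; exact: le_trans yx.
Qed.

End step_functions.

(* [c b x] counts the spikes of [b] up to time [x], [l b x] those among them that
   are large, i.e. fired from a potential of absolute value [> 2h]; [V b] is the
   potential of [b]. *)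
Section spike_counting.
Context {R : realType}.
Variables (h : R) (N : nat) (a : 'I_N) (t : R) (V : 'I_N -> R -> R).
Variables (c l : 'I_N -> R -> nat).
Hypothesis h_gt0 : 0 < h.
(** The dynamics enter the counting only through the following hypotheses, which the section [path]
    proves for the actual system. *)
Hypothesis cmono : forall b, {homo c b : x y / x <= y >-> (x <= y)%N}.
Hypothesis cright : forall b, right_step (c b).
Hypothesis lmono : forall b, {homo l b : x y / x <= y >-> (x <= y)%N}.
Hypothesis lright : forall b, right_step (l b).
Hypothesis lec : forall b (u v : R), u <= v -> (l b v - l b u <= c b v - c b u)%N.
Hypothesis csimple : forall q : R, 0 < q -> q <= t -> exists x : R, [/\ 0 <= x, x < q,
  (forall b (y : R), x <= y -> y < q -> c b y = c b x) &
  (\sum_b (c b q - c b x) <= 1)%N].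
Hypothesis drift : forall b (u v : R), 0 <= u -> u <= v -> v <= t -> c b u = c b v ->
  `|V b v - V b u| <= h / N%:R * (\sum_(e | e != b) (c e v - c e u)%N)%:R.
Hypothesis reset : forall b (x q : R), 0 <= x -> x < q -> q <= t ->
  (forall b (y : R), x <= y -> y < q -> c b y = c b x) ->
  (\sum_b (c b q - c b x) <= 1)%N -> (c b x < c b q)%N -> V b q = 0.
Hypothesis large : forall b (x q : R), 0 <= x -> x < q -> q <= t ->
  (forall b (y : R), x <= y -> y < q -> c b y = c b x) ->
  (l b x < l b q)%N -> 2 * h < `|V b x|.

Lemma cright_sum (Q : pred 'I_N) (c' : 'I_N -> R -> nat) :
  (forall b, {homo c' b : x y / x <= y >-> (x <= y)%N}) ->
  (forall b, right_step (c' b)) ->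
  right_step (fun x => \sum_(b | Q b) c' b x)%N.
Proof.
move=> hm hr x.
suff [y xy yE] : exists2 y, x < y & forall b, c' b y = c' b x.
  by exists y => //; apply: eq_bigr => b _; exact: yE.
have : forall s : seq 'I_N, exists2 y, x < y & {in s, forall b, c' b y = c' b x}.
  elim=> [|b s [y xy yE]]; first by exists (x + 1); rewrite ?ltrDl.
  have [z xz zE] := hr b x.
  exists (Num.min y z); first by rewrite lt_min xy.
  move=> e; rewrite inE => /predU1P[->|es]; apply/eqP; rewrite eqn_leq.
    by rewrite -{1}zE !hm// ?ge_min ?lexx ?orbT// le_min !ltW.
  by rewrite -{1}(yE _ es) !hm// ?ge_min ?lexx ?orbT// le_min !ltW.
by move=> /(_ (enum 'I_N))[y xy yE]; exists y => // b; rewrite yE ?mem_enum.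
Qed.

Lemma sum_homo (Q : pred 'I_N) (c' : 'I_N -> R -> nat) :
  (forall b, {homo c' b : x y / x <= y >-> (x <= y)%N}) ->
  {homo (fun x => \sum_(b | Q b) c' b x)%N : x y / x <= y >-> (x <= y)%N}.
Proof. by move=> hm x y xy; apply: leq_sum => b _; exact: hm. Qed.

Lemma sum_subn (Q : pred 'I_N) (u v : R) : u <= v ->
  (\sum_(b | Q b) (c b v - c b u))%N =
  (\sum_(b | Q b) c b v - \sum_(b | Q b) c b u)%N.
Proof. by move=> uv; rewrite sumnB// => b _; exact: cmono. Qed.

Lemma leq_sum1 (Q : pred 'I_N) (F : 'I_N -> nat) b : Q b ->
  (F b <= \sum_(e | Q e) F e)%N.
Proof. by move=> Qb; rewrite (bigD1 b)//= leq_addr. Qed.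

(* Between two spikes of [b] the potential of [b] starts at [0] and moves by at
   most [h / N] per spike of the other actors, so that a second large spike in
   the window would require more than [2N] spikes of the others. *)
Lemma one_large_spike_per_window b (u v : R) : b != a -> 0 <= u -> u <= v -> v <= t ->
  c a u = c a v ->
  (\sum_(e | e != a) (c e v - c e u) <= 2 * N)%N -> (l b v - l b u <= 1)%N.
Proof.
move=> ba u0 uv vt cauv K.
have mc e : forall x y, x <= y -> (c e x <= c e y)%N by move=> x y; exact: cmono.
rewrite leqNgt; apply/negP => lb2.
(* [q] is the time of the second large spike of [b] after [u]. *)
have [q [uq qv lq ltq]] := @first_hit R (l b) u v (l b u).+2 (@lmono b) (@lright b)
  (leqnSn _) ltac:(lia).
have [x0 [x00 x0q x0c x0s]] := csimple _ (le_lt_trans u0 uq) (le_trans qv vt).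
pose x1 := Num.max u x0.
have ux1 : u <= x1 by rewrite le_max lexx.
have x01 : x0 <= x1 by rewrite le_max lexx orbT.
have x1q : x1 < q by rewrite gt_max uq.
have x1c e y : x1 <= y -> y < q -> c e y = c e x1.
  by move=> xy yq; rewrite x0c ?(le_trans x01)// [RHS]x0c.
have x1s : (\sum_b (c b q - c b x1) <= 1)%N.
  by rewrite (eq_bigr (fun b => c b q - c b x0)%N)// => e _; rewrite (x0c e x1).
have x1t : x1 <= t by rewrite (le_trans (ltW x1q))// (le_trans qv).
have lx1 : (l b x1 < l b q)%N := leq_trans (ltq _ x1q) lq.
have := large b x1 q (le_trans u0 ux1) x1q (le_trans qv vt) x1c lx1.
have cbq := lec b _ _ (ltW x1q).
have cbq1 : (c b q - c b x1 <= 1)%N := leq_trans (leq_sum1 xpredT (fun b => c b q - c b x1)%N b isT) x1s.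
have cbu := lec b _ _ ux1.
have cux : (c b u < c b x1)%N by move: cbu lx1 cbq cbq1 lq lb2; clear; lia.
(* As at most one spike occurs at [q], an earlier large spike of [b] lies in []u, x1]]; [p] is the
   time of the last spike of [b] before [q], so its potential is [0] at [p]. *)
have [p [up px1 cp ltp]] := @first_hit R (c b) u x1 (c b x1) (@cmono b) (@cright b)
  cux (leqnn _).
have cpE : c b p = c b x1 by have := mc b _ _ px1; move: cp; clear; lia.
have [y [y0 yp yc ys]] := csimple _ (le_lt_trans u0 up) (le_trans px1 x1t).
have Vp : V b p = 0 by apply: (reset b y p) => //; [exact: le_trans px1 x1t|rewrite cpE; exact: ltp].
have := drift b p x1 (le_trans u0 (ltW up)) px1 x1t cpE.
rewrite Vp subr0 => Vle; rewrite ltNge => /negP; apply; apply: (le_trans Vle).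
have N0 : (0 < N)%N by case: N a => [[]|].
have -> : 2 * h = h / N%:R * (2 * N)%:R.
  by rewrite natrM mulrCA divfK ?pnatr_eq0 -?lt0n// mulrC.
rewrite ler_pM2l ?divr_gt0 ?ltr0n// ler_nat.
apply: leq_trans K.
(* The drift of [b] counts the spikes of all actors but [b], the window those of all actors but [a];
   [a] is silent on the window. *)
rewrite [leqRHS](bigD1 b)//= (bigD1 a)//= 1?eq_sym//.
have -> : (c a x1 - c a p = 0)%N.
  by have := mc a _ _ (ltW up); have := mc a _ _ px1;
     have := mc a _ _ (le_trans (ltW x1q) qv); move: cauv; clear; lia.
rewrite add0n; apply: (leq_trans _ (leq_addl _ _)).
rewrite (eq_bigl (fun e => (e != a) && (e != b))); last by move=> e; rewrite andbC.
apply: leq_sum => e _; have := mc e _ _ (ltW up); have := mc e _ _ px1.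
have := mc e _ _ (le_trans (ltW x1q) qv); clear; lia.
Qed.

Lemma window_count (u v : R) : 0 <= u -> u <= v -> v <= t -> c a u = c a v ->
  (\sum_(e | e != a) (c e v - c e u) <= 2 * N)%N ->
  (\sum_(e | e != a) (c e v - c e u) <=
    N.-1 + \sum_(e | e != a) ((c e v - c e u) - (l e v - l e u)))%N.
Proof.
move=> u0 uv vt cauv K.
have -> : N.-1 = (\sum_(e < N | e != a) 1)%N.
  by rewrite sum1_card cardC1 card_ord.
rewrite -big_split/=; apply: leq_sum => e ea.
have := one_large_spike_per_window e u v ea u0 uv vt cauv K; clear; lia.
Qed.

(** Induction on the number of spikes left. If it exceeds [2N], the first [2N] form a window; by
    [window_count] at least [N + 1] of them are small, so twice their number pays for the block. *)
Lemma spike_count_le (u : R) : 0 <= u -> u <= t -> c a u = c a t ->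
  (\sum_(e | e != a) (c e t - c e u) <=
    N.-1 + 2 * \sum_(e | e != a) ((c e t - c e u) - (l e t - l e u)))%N.
Proof.
have [n] := ubnP (\sum_(e | e != a) (c e t - c e u))%N.
elim: n u => // n IH u lt_n u0 ut caut.
have [K|K] := leqP (\sum_(e | e != a) (c e t - c e u))%N (2 * N)%N.
  by have := window_count u t u0 ut (lexx t) caut K; clear; lia.
pose C x := (\sum_(e | e != a) c e x)%N.
have Cm : {homo C : x y / x <= y >-> (x <= y)%N} := sum_homo _ c cmono.
have N0 : (0 < N)%N by case: N a => [[]|].
move: (K); rewrite sum_subn// -/(C t) -/(C u) => K'.
have [q [uq qt Cq ltq]] := @first_hit R C u t (C u + 2 * N)%N Cm
  (cright_sum _ c cmono cright) ltac:(move: N0; clear; lia) ltac:(move: K' K; clear; lia).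
have [x [x0 xq xc xs]] := csimple _ (le_lt_trans u0 uq) qt.
(* No two spikes occur at [q], so the block []u, q]] has exactly [2 * N] spikes and meets the
   hypothesis of [window_count]. *)
have Cq1 : (C q - C x <= 1)%N.
  rewrite -sum_subn ?ltW//; apply: leq_trans xs.
  by rewrite [leqRHS](bigD1 a)//= leq_addl.
have := ltq _ xq => Cx.
have caq : c a u = c a q.
  by have := cmono a _ _ (ltW uq); have := cmono a _ _ qt; move: caut; clear; lia.
have uq' := ltW uq.
have Wq := window_count u q u0 uq' qt caq.
rewrite sum_subn// -/(C q) -/(C u) in Wq.
have {}Wq := Wq ltac:(move: Cq Cx Cq1; clear; lia).
have := IH q; rewrite !sum_subn// -/(C t) -/(C q) -/(C u).
move=> /(_ _ (le_trans u0 uq') qt) Hq.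
have {}Hq := Hq ltac:(rewrite sum_subn// -/(C t) -/(C u) in lt_n; move: lt_n Cq Cx Cq1 K' N0; clear; lia)
  ltac:(by rewrite -caq).
have : (\sum_(e < N | e != a) (c e t - c e u - (l e t - l e u)) =
  \sum_(e < N | e != a) (c e t - c e q - (l e t - l e q)) +
  \sum_(e < N | e != a) (c e q - c e u - (l e q - l e u)))%N.
  rewrite -big_split/=; apply: eq_bigr => e ea.
  have := cmono e _ _ uq'; have := cmono e _ _ qt.
  have := lmono e _ _ uq'; have := lmono e _ _ qt.
  have := lec e _ _ uq'; have := lec e _ _ qt; clear; lia.
set A := (X in (_ <= N.-1 + 2 * X)%N) in Hq; set B := (X in (_ <= N.-1 + X)%N) in Wq.
move=> ->; rewrite -/A -/B.
move: Hq Wq Cq Cx Cq1 K' N0; move: (C t) (C q) (C u) (C x) A B; clear; lia.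
Qed.

Lemma potential_bound (r : R) : 0 <= r -> r <= t ->
  exists2 u, r <= u <= t & `|V a t| <= `|V a r| + h + 2 * h / N%:R *
     (\sum_(e | e != a) ((c e t - c e u) - (l e t - l e u)))%:R.
Proof.
move=> r0 rt.
(* [u] is the time of the last spike of [a] after [r], where its potential is [0], or [r] itself if
   there is none. *)
suff [u [ru ut cau Vu]] : exists u, [/\ r <= u, u <= t, c a u = c a t & `|V a u| <= `|V a r|].
  exists u; first by rewrite ru.
  have := drift a u t (le_trans r0 ru) ut (lexx t) cau.
  set K := (X in _ * X%:R); set S := (X in _ + _ * X%:R) => dr.
  have KS : (K <= N.-1 + 2 * S)%N.
    by apply: spike_count_le => //; exact: le_trans ru.
  have N0 : (0 < N)%N by case: N a => [[]|].
  have hN : 0 <= h / N%:R by rewrite divr_ge0 ?ler0n ?(ltW h_gt0).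
  rewrite -(subrK (V a u) (V a t)) (le_trans (ler_normD _ _))//.
  rewrite addrC -addrA lerD//.
  (* The displacement [(h/N) (N - 1 + 2S)] is rounded up to [h + (2h/N) S]: this is the origin of
     the constants of the theorem. *)
  rewrite (le_trans dr)// (@le_trans _ _ (h / N%:R * (N%:R + 2 * S%:R)))//.
    by rewrite ler_wpM2l// -natrM -natrD ler_nat; move: KS N0; clear; lia.
  rewrite mulrDr divfK ?pnatr_eq0 -?lt0n// lerD2l.
  by rewrite [leLHS]mulrA (mulrC _ 2) [2 * (h / _)]mulrA.
have [cE|] := eqVneq (c a r) (c a t); first by exists r.
move=> cE; have ltc : (c a r < c a t)%N by rewrite ltn_neqAle cE cmono.
have [p [rp pt cp ltp]] := @first_hit R (c a) r t (c a t) (@cmono a) (@cright a)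
  ltc (leqnn _).
have cpE : c a p = c a t by have := cmono a _ _ pt; move: cp; clear; lia.
exists p; split => //; first exact: ltW.
have [y [y0 yp yc ys]] := csimple _ (le_lt_trans r0 rp) pt.
by rewrite (reset a y p)// ?normr0// cpE; exact: ltp.
Qed.

End spike_counting.

(** * Natural-valued measures *)

Section natural_valued.
Context {R : realType}.

Definition isnat (x : \bar R) := exists k : nat, x = k%:R%:E.

Definition box (n : nat) : set (R * R) := `[0, n%:R]%classic `*` `[0, n%:R]%classic.

Lemma isnat_fin_num x : isnat x -> x \is a fin_num.
Proof. by move=> [k ->]. Qed.

(** Convergent sequences of integers are eventually constant. This turns continuity of measures into
    exact statements: a finite limit of natural masses is natural, and natural masses tending to [0]
    vanish from some index on. *)
Lemma isnat_stationary (u : nat -> \bar R) (l : \bar R) :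
  (forall n, isnat (u n)) -> l \is a fin_num -> u @ \oo --> l ->
  exists n0, forall n, (n0 <= n)%N -> u n = l.
Proof.
move=> /choice[k uk]; case: l => // l _.
have -> : u = EFin \o (fun n => (k n)%:R) by apply/funext => n; rewrite uk.
move=> /fine_cvgP[_] /= kl.
have [n0 _ hn0] := iffLR (cvgrPdist_lt _ _) kl (1 / 2) ltac:(by rewrite divr_gt0).
have kE n : (n0 <= n)%N -> k n = k n0.
  move=> n0n; have := hn0 _ n0n; have := hn0 _ (leqnn n0).
  rewrite /= !ltr_distl => /andP[h1 h2] /andP[h3 h4].
  by apply/eqP; rewrite eqn_leq; apply/andP; split; rewrite leqNgt; apply/negP;
    rewrite -(ler_nat R) -natr1 => h5; lra.
exists n0 => n n0n; rewrite /= (kE _ n0n); congr EFin.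
apply: (cvg_unique _ _ kl) => //.
by apply: cvg_near_cst; exists n0 => // p /= n0p; rewrite kE.
Qed.

Lemma measurable_box n : measurable (box n).
Proof. by apply: measurableX; exact: measurable_itv. Qed.

End natural_valued.

Section counting.
Context {R : realType}.
Variables (m : {measure set (R * R) -> \bar R}) (S : set (R * R)).
Hypothesis mS : measurable S.
Hypothesis natS : forall A, measurable A -> isnat (m (S `&` A)).

Definition upto (x : R) : set (R * R) := [set y | y.1 <= x].
Definition strip (u v : R) : set (R * R) := [set y | u < y.1 <= v].

Lemma measurable_upto x : measurable (upto x).
Proof.
rewrite (_ : upto x = fst @^-1` `]-oo, x]%classic).
  by rewrite -[X in measurable X]setTI; exact: measurable_fst.
by apply/seteqP; split => y; rewrite /upto /= in_itv.
Qed.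

Lemma measurable_strip u v : measurable (strip u v).
Proof.
rewrite (_ : strip u v = fst @^-1` `]u, v]%classic).
  by rewrite -[X in measurable X]setTI; exact: measurable_fst.
by apply/seteqP; split => y; rewrite /strip /= in_itv.
Qed.

Definition cnt (x : R) : nat := Num.truncn (fine (m (S `&` upto x))).

Lemma cntE x : (cnt x)%:R%:E = m (S `&` upto x).
Proof.
have [k kE] := natS _ (measurable_upto x).
by rewrite /cnt kE /= natrK.
Qed.

Lemma cnt_strip u v : u <= v -> (cnt v - cnt u)%:R%:E = m (S `&` strip u v).
Proof.
move=> uv.
have [k kE] := natS _ (measurable_strip u v).
have : m (S `&` upto v) = (m (S `&` upto u) + m (S `&` strip u v))%E.
  rewrite -measureU; first last.
  - rewrite -subset0 => y [[_ /= yu] [_ /=]]; rewrite /strip/= ltNge.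
    by rewrite yu.
  - by apply: measurableI => //; exact: measurable_strip.
  - by apply: measurableI => //; exact: measurable_upto.
  congr (m _); rewrite -setIUr; congr (_ `&` _).
  apply/seteqP; split => y; rewrite /upto /strip /=.
    by move=> yv; have [|] := leP y.1 u; [left|right; apply/andP].
  by move=> [yu|/andP[]//]; exact: le_trans uv.
rewrite -!cntE kE -EFinD -natrD => -[/eqP]; rewrite eqr_nat => /eqP ->.
by rewrite addKn.
Qed.

Lemma cnt_homo : {homo cnt : x y / x <= y >-> (x <= y)%N}.
Proof.
move=> x y xy; rewrite -(ler_nat R) -lee_fin !cntE.
apply: le_measure; rewrite ?inE.
- by apply: measurableI => //; exact: measurable_upto.
- by apply: measurableI => //; exact: measurable_upto.
- by apply: setIS => z /= zx; exact: le_trans xy.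
Qed.

(** The strips []x, x + 1/(n+1)]] decrease to the empty set, so their natural masses are eventually
    [0]. *)
Lemma cnt_right_step : right_step cnt.
Proof.
move=> x.
pose F n := S `&` strip x (x + n.+1%:R^-1).
have mF n : measurable (F n) by apply: measurableI => //; exact: measurable_strip.
have F0 : \bigcap_n F n = set0.
  rewrite -subset0 => y Fy.
  have /andP[xy _] := (Fy 0%N I).2.
  have := near_infty_natSinv_lt (PosNum (ltac:(by rewrite subr_gt0) : 0 < y.1 - x)).
  move=> [n _ /(_ n (leqnn _))/=].
  have /andP[_ +] := (Fy n I).2.
  by rewrite -lerBlDl leNgt => /negP.
have : (m \o F) n @[n --> \oo] --> m (\bigcap_n F n).
  apply: nonincreasing_cvg_mu => //.
  - have [k ->] := natS _ (measurable_strip x (x + 1%:R^-1)).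
    by rewrite ltry.
  - by rewrite F0.
  - apply/nonincreasing_seqP => n; apply/subsetPset; apply: setIS => y /=.
    move=> /andP[xy yn]; apply/andP; split => //; apply: (le_trans yn).
    by rewrite lerD2l lef_pV2 ?posrE// ler_nat.
rewrite F0 measure0 => Fcvg.
have [n0 n0P] := isnat_stationary _ 0%E (fun n => natS _ (measurable_strip _ _)) isT Fcvg.
have xn : x < x + n0.+1%:R^-1 by rewrite ltrDl invr_gt0 ltr0n.
exists (x + n0.+1%:R^-1) => //.
have := n0P _ (leqnn _); rewrite /= /F -cnt_strip ?ltW// => -[/eqP].
rewrite pnatr_eq0 subn_eq0 => le; apply/eqP; rewrite eqn_leq le.
by apply/cnt_homo/ltW.
Qed.

End counting.

(** * Paths of the system *)

Lemma leftlim_const {R : realType} (f : R -> R) (x s : R) : 0 <= x -> x < s ->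
  (forall y, x <= y -> y < s -> f y = f x) -> leftlim f s = f x.
Proof.
move=> x0 xs fx; rewrite /leftlim leNgt (le_lt_trans x0 xs)/=.
apply: cvg_lim => //; apply: cvg_near_cst; near=> y; apply: fx.
- by near: y; apply: filterS (nbhs_left_gt xs) => y; exact: ltW.
- by near: y; exact: nbhs_left_lt.
Unshelve. all: by end_near. Qed.

Section path.
Context {R : realType}.
Variables (phi : R -> R) (h : R) (N : nat) (t : R).
Variables (nu : 'I_N -> {measure set (R * R) -> \bar R}).
Variables (u0 : 'I_N -> R) (V : R -> 'I_N -> R).
Hypothesis h_gt0 : 0 < h.
Hypothesis phi_ge0 : forall r, 0 <= phi r.
(** [nu] is the family of measures at one outcome outside a null set. All measurable subsets of a
    box are covered, since the sets [spikes] depend on the path itself. *)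
Hypothesis nu_nat : forall b n A, measurable A -> A `<=` box n -> isnat (nu b A).
Hypothesis nu_simple : forall q : R, 0 < q ->
  (\sum_b nu b ([set q] `*` `[0%R, +oo[%classic) <= 1)%E.

Let self b := self_integrand phi (fun s => V s b).
Let inter b := inter_integrand phi (fun s => V s b).

Hypothesis sol : forall s, 0 <= s -> forall a : 'I_N,
  (forall b, (nu b).-integrable (dom0t s) (fun x => (self b x)%:E)) /\
  (forall b, (nu b).-integrable (dom0t s) (fun x => (inter b x)%:E)) /\
  ((V s a)%:E = (u0 a)%:E - \int[nu a]_(x in dom0t s) (self a x)%:E
     + (h / N%:R)%:E * \sum_(b < N | b != a) \int[nu b]_(x in dom0t s) (inter b x)%:E)%E.

Definition spikes b : set (R * R) :=
  dom0t t `&` [set x | x.2 <= Phi phi (leftlim (fun s => V s b) x.1)].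
Definition large_spikes b : set (R * R) :=
  spikes b `&` [set x | 2 * h < `|leftlim (fun s => V s b) x.1|].
Definition slab (u v : R) : set (R * R) := strip u v `&` [set x | 0 <= x.2].

Hypothesis t_ge0 : 0 <= t.

Lemma measurable_dom0t s : measurable (@dom0t R s).
Proof. by apply: measurableX; exact: measurable_itv. Qed.

Lemma dom0tE s : @dom0t R s = [set x | 0 <= x.1 <= s /\ 0 <= x.2].
Proof.
by apply/seteqP; split => -[x z]; rewrite /dom0t /= !in_itv/= ?andbT.
Qed.

(** The two indicators of the interaction have disjoint supports whose union is [z <= Phi], so
    spikes are the points where the integrand is [1] or [-1]. *)
Lemma inter_abs b x : `|inter b x| = (x.2 <= Phi phi (leftlim (fun s => V s b) x.1))%R%:R.
Proof.
rewrite /inter /inter_integrand; set f := leftlim _ _.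
have le : phi f <= Phi phi f by rewrite lerDl.
case: (leP x.2 (phi f)) => [xf|fx] /=.
  by rewrite (le_trans xf le) subr0 normr1.
by case: ifP => _; rewrite ?subrr ?sub0r ?normrN ?normr1 ?normr0 ?oppr0 ?subr0 ?normr0.
Qed.

(** Since [phi] is arbitrary, measurability comes from the integrability of [inter] that the
    equation contains: inside [dom0t t] the spikes are the points where [inter] does not vanish. *)
Lemma measurable_spikes b : measurable (spikes b).
Proof.
have [_ [/(_ b) int _]] := sol _ t_ge0 b.
have := measurable_int _ int (measurable_dom0t t) _ (measurableC (emeasurable_set1 0%E)).
congr (measurable _); rewrite /spikes; congr (_ `&` _).
apply/seteqP; split => x /=; have := inter_abs b x.
  by move=> + i0; case: leP => // _ /eqP; rewrite normr_eq0 => /eqP i0'; case: i0; rewrite i0'.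
by move=> + xP => /[swap]; rewrite xP => -[->]; rewrite normr0 => /esym/eqP; rewrite oner_eq0.
Qed.

Lemma measurable_large_spikes b : measurable (large_spikes b).
Proof.
have [/(_ b) int _] := sol _ t_ge0 b.
have mself := measurable_int _ int.
have mabs : measurable_fun (dom0t t) (abse \o (fun x => (self b x)%:E)).
  exact: measurableT_comp.
have := mabs (measurable_dom0t t) _ (emeasurable_itv `](2 * h)%:E, +oo[).
move=> /(measurableI _ _ (measurable_spikes b)).
congr (measurable _); rewrite /large_spikes; apply/seteqP; split => x /=.
  move=> [[tx sx] [_]]; rewrite in_itv/= andbT lte_fin /self /self_integrand.
  by rewrite sx mulr1 => ?; split.
move=> [[tx sx] l]; split => //; split => //; rewrite in_itv/= andbT lte_fin.
by rewrite /self /self_integrand sx mulr1.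
Qed.

(** The integral of [|inter|] is the mass of [spikes b], so integrability says that there are
    finitely many spikes. *)
Lemma spikes_fin b : (nu b (spikes b) < +oo)%E.
Proof.
have [_ [/(_ b) int _]] := sol _ t_ge0 b.
have /integrableP[_] := int.
rewrite (eq_integral (fun x => (\1_(spikes b) x)%:E)).
  rewrite integral_indic ?(setIidl _)//.
  - by move=> x [].
  - exact: measurable_dom0t.
  - exact: measurable_spikes.
move=> x; rewrite inE => tx; rewrite abse_EFin inter_abs indicE; congr (_%:R%:E).
rewrite /spikes in_setI mem_set//=.
by congr (nat_of_bool _); apply/idP/idP; rewrite inE.
Qed.

(** [A] may have unbounded height. Its traces on the boxes have natural masses that increase to a
    finite limit, hence are eventually equal to it. *)
Lemma isnat_spikes b A : measurable A -> A `<=` spikes b -> isnat (nu b A).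
Proof.
move=> mA AS.
have finA : nu b A \is a fin_num.
  rewrite ge0_fin_numE//; apply: le_lt_trans (spikes_fin b).
  by apply: le_measure => //; rewrite inE//; exact: measurable_spikes.
have mF n : measurable (A `&` box n).
  by apply: measurableI => //; exact: measurable_box.
have AE : \bigcup_n (A `&` box n) = A.
  rewrite -setI_bigcupr; apply/setIidl => x /AS[]; rewrite dom0tE => -[x1 x2] _.
  exists (maxn (Num.truncn x.1) (Num.truncn x.2)).+1 => //.
  rewrite /box /= !in_itv/=; case/andP: x1 => -> _; rewrite x2 /=.
  by split; apply: (le_trans (ltW (truncnS_gt _))); rewrite ler_nat ltnS ?leq_maxl ?leq_maxr.
have cv : (nu b \o (fun n => A `&` box n)) n @[n --> \oo] --> nu b A.
  rewrite -[X in nu b X]AE; apply: nondecreasing_cvg_mu => //.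
    by rewrite AE.
  apply/nondecreasing_seqP => n; apply/subsetPset; apply: setIS.
  move=> x; rewrite /box /= !in_itv/= => -[/andP[-> x1] /andP[-> x2]] /=.
  by split; [apply: le_trans x1 _|apply: le_trans x2 _]; rewrite ler_nat.
have nat_n n : isnat (nu b (A `&` box n)).
  by apply: (@nu_nat b n) => //; exact: subIsetr.
have [n0 /(_ _ (leqnn _)) <-] := isnat_stationary _ _ nat_n finA cv.
exact: nat_n.
Qed.

Lemma isnat_spikesI b S A : measurable S -> S `<=` spikes b -> measurable A ->
  isnat (nu b (S `&` A)).
Proof.
move=> mS Ss mA; apply: isnat_spikes; first exact: measurableI.
by move=> x [/Ss].
Qed.

Let c b := cnt (nu b) (spikes b).
Let l b := cnt (nu b) (large_spikes b).

Let nat_c b A (mA : measurable A) : isnat (nu b (spikes b `&` A)) :=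
  isnat_spikesI b _ _ (measurable_spikes b) (@subset_refl _ _) mA.
Let nat_l b A (mA : measurable A) : isnat (nu b (large_spikes b `&` A)) :=
  isnat_spikesI b _ _ (measurable_large_spikes b) (@subIsetl _ _ _) mA.

Lemma measurable_slab u v : measurable (slab u v).
Proof.
apply: measurableI; first exact: measurable_strip.
rewrite (_ : [set x | _] = snd @^-1` `[0%R, +oo[%classic).
  by rewrite -[X in measurable X]setTI; exact: measurable_snd.
by apply/seteqP; split => y; rewrite /= in_itv/= andbT.
Qed.

Lemma dom0t_slab u v : 0 <= u -> u <= v -> @dom0t R v = dom0t u `|` slab u v.
Proof.
move=> u0' uv; rewrite !dom0tE; apply/seteqP; split => -[x z]; rewrite /slab /strip /=.
  move=> [/andP[x0 xv] z0]; have [xu|ux] := leP x u; first by left; rewrite x0.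
  by right; split => //; rewrite xv.
move=> [[/andP[-> xu] ->]|[/andP[ux ->] ->]]; split => //=.
- exact: le_trans uv.
- by rewrite andbT (le_trans u0')// ltW.
Qed.

Lemma slab_sub u v : 0 <= u -> slab u v `<=` dom0t v.
Proof.
move=> u0'; rewrite dom0tE => -[x z] [/andP[/= ux ->] ->]; split => //.
by rewrite andbT (le_trans u0')// ltW.
Qed.

Lemma integral_slab b u v (f : R * R -> R) : 0 <= u -> u <= v ->
  (nu b).-integrable (dom0t v) (EFin \o f) ->
  fine (\int[nu b]_(x in dom0t v) (f x)%:E) =
  fine (\int[nu b]_(x in dom0t u) (f x)%:E) + fine (\int[nu b]_(x in slab u v) (f x)%:E).
Proof.
move=> u0' uv int.
have mu := measurable_dom0t u; have ms := measurable_slab u v.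
have mv := measurable_dom0t v.
have su := slab_sub u v u0'.
have du : dom0t u `<=` dom0t v by rewrite (dom0t_slab _ _ u0' uv) => x; left.
rewrite -fineD; first last.
- by apply: integrable_fin_num => //; exact: integrableS int.
- by apply: integrable_fin_num => //; exact: integrableS int.
rewrite [in LHS](dom0t_slab _ _ u0' uv) integral_setU//.
- by rewrite -(dom0t_slab _ _ u0' uv); exact: measurable_int int.
- apply/disj_set2P; rewrite -subset0 => -[x z]; rewrite dom0tE => -[] [/= /andP[_ xu] _].
  by move=> [/andP[/=]]; rewrite ltNge xu.
Qed.

Lemma increment b u v : 0 <= u -> u <= v ->
  V v b - V u b = - fine (\int[nu b]_(x in slab u v) (self b x)%:E) +
    h / N%:R * \sum_(e | e != b) fine (\int[nu e]_(x in slab u v) (inter e x)%:E).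
Proof.
move=> u0' uv.
have VE s : 0 <= s -> V s b = u0 b - fine (\int[nu b]_(x in dom0t s) (self b x)%:E) +
    h / N%:R * \sum_(e | e != b) fine (\int[nu e]_(x in dom0t s) (inter e x)%:E).
  move=> s0; have [is_ [ii E]] := sol _ s0 b; apply: EFin_inj; rewrite E.
  have ms := measurable_dom0t s.
  rewrite [in RHS]EFinD [in RHS]EFinM [in RHS]EFinB EFin_sum_fine ?fineK//.
  - exact: integrable_fin_num.
  - by move=> e _; exact: integrable_fin_num.
have v0 := le_trans u0' uv.
have [is_ [ii _]] := sol _ v0 b.
rewrite (VE v)// (VE u)// (integral_slab b u v)//.
have -> : \sum_(e | e != b) fine (\int[nu e]_(x in dom0t v) (inter e x)%:E) =
  \sum_(e | e != b) fine (\int[nu e]_(x in dom0t u) (inter e x)%:E) +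
  \sum_(e | e != b) fine (\int[nu e]_(x in slab u v) (inter e x)%:E).
  by rewrite -big_split; apply: eq_bigr => e _; exact: integral_slab.
by rewrite mulrDr; lra.
Qed.

Lemma spikes_slab b u v : spikes b `&` slab u v = spikes b `&` strip u v.
Proof.
apply/seteqP; split => x [s] ; first by move=> [].
by move=> sx; split => //; split => //; case: s; rewrite dom0tE => -[].
Qed.

Lemma slab_dom0t u v : 0 <= u -> v <= t -> slab u v `<=` dom0t t.
Proof.
move=> u0' vt x /(slab_sub _ _ u0'); rewrite !dom0tE => -[/andP[x0 xv] z0].
by split => //=; rewrite x0 (le_trans xv).
Qed.

Lemma inter_le b u v : 0 <= u -> u <= v -> v <= t ->
  `|fine (\int[nu b]_(x in slab u v) (inter b x)%:E)| <= (c b v - c b u)%N%:R.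
Proof.
move=> u0' uv vt.
have ms := measurable_slab u v.
have [_ [/(_ b) int _]] := sol _ t_ge0 b.
have {}int : (nu b).-integrable (slab u v) (fun x => (inter b x)%:E).
  by apply: integrableS int => //; [exact: measurable_dom0t|exact: slab_dom0t].
rewrite -lee_fin (cnt_strip _ _ (measurable_spikes b) (nat_c b))// -abse_EFin fineK; last first.
  exact: integrable_fin_num.
apply: (le_trans (le_abse_integral _ ms (measurable_int _ int))).
rewrite -spikes_slab -integral_indic//; last exact: measurable_spikes.
rewrite (eq_integral (fun x => (\1_(spikes b) x)%:E))// => x; rewrite inE => sx.
rewrite abse_EFin inter_abs indicE; congr (_%:R%:E).
rewrite /spikes in_setI mem_set//=; last exact: slab_dom0t sx.
by congr (nat_of_bool _); apply/idP/idP; rewrite inE.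
Qed.

Lemma self_zero b u v : 0 <= u -> u <= v -> v <= t -> c b u = c b v ->
  fine (\int[nu b]_(x in slab u v) (self b x)%:E) = 0.
Proof.
move=> u0' uv vt cE.
have ms := measurable_slab u v.
have [/(_ b) int _] := sol _ t_ge0 b.
have {}int : (nu b).-integrable (slab u v) (fun x => (self b x)%:E).
  by apply: integrableS int => //; [exact: measurable_dom0t|exact: slab_dom0t].
rewrite (@negligible_integral _ _ _ _ _ (spikes b `&` strip u v))//.
- rewrite integral0_eq// => x [sx nsx]; rewrite /self /self_integrand.
  case: ifP => // le; last by rewrite mulr0.
  exfalso; apply: nsx; split; last by case: sx.
  by split => //; exact: slab_dom0t sx.
- by apply: measurableI; [exact: measurable_spikes|exact: measurable_strip].
- by rewrite -(cnt_strip _ _ (measurable_spikes b) (nat_c b))// -/(c b) cE subnn.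
Qed.

Lemma drift b (u v : R) : 0 <= u -> u <= v -> v <= t -> c b u = c b v ->
  `|V v b - V u b| <= h / N%:R * (\sum_(e | e != b) (c e v - c e u)%N)%:R.
Proof.
move=> u0' uv vt cE; rewrite increment// self_zero// oppr0 add0r normrM ger0_norm; last first.
  by rewrite divr_ge0// ltW.
rewrite ler_wpM2l//; first by rewrite divr_ge0// ltW.
rewrite natr_sum (le_trans (ler_norm_sum _ _ _))//; apply: ler_sum => e _.
exact: inter_le.
Qed.

Definition quiet x q := forall b (y : R), x <= y -> y < q -> c b y = c b x.

Lemma quiet_const x q b y : 0 <= x -> q <= t -> quiet x q -> x <= y -> y < q -> V y b = V x b.
Proof.
move=> x0 qt qxq xy yq; apply/eqP; rewrite -subr_eq0 -normr_le0.
apply: (le_trans (drift b x y x0 xy (le_trans (ltW yq) qt) (esym (qxq b y xy yq)))).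
rewrite big1 ?mulr0// => e _; by rewrite (qxq e y xy yq) subnn.
Qed.

Lemma quiet_leftlim x q b s : 0 <= x -> q <= t -> quiet x q -> x < s -> s <= q ->
  leftlim (fun s => V s b) s = V x b.
Proof.
move=> x0 qt qxq xs sq; apply: leftlim_const => // y xy ys.
by apply: (quiet_const x q) => //; exact: lt_le_trans sq.
Qed.

(** On the slab the left limit is constantly [V x b], so the self term is [V x b] times one spike:
    the potential drops by exactly its value. The other actors are silent, as at most one spike
    occurs. *)
Lemma reset b (x q : R) : 0 <= x -> x < q -> q <= t -> quiet x q ->
  (\sum_b (c b q - c b x) <= 1)%N -> (c b x < c b q)%N -> V q b = 0.
Proof.
move=> x0 xq qt qxq; rewrite (bigD1 b)//= => le1 lt.
have c1 : (c b q - c b x = 1)%N by move: le1 lt; clear; lia.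
have others e : e != b -> (c e q - c e x = 0)%N.
  move=> eb; move: le1; rewrite (bigD1 e)//= c1.
  by move: (c e q - c e x)%N (\sum_(_ | _) _)%N; clear; lia.
have := increment b x q x0 (ltW xq).
rewrite big1 ?mulr0 ?addr0; last first.
  move=> e eb; apply/eqP; rewrite -normr_le0 (le_trans (inter_le e x q x0 (ltW xq) qt))//.
  by rewrite others.
rewrite (eq_integral (fun z => ((V x b) * \1_(spikes b) z)%:E)); last first.
  move=> z; rewrite inE => sz; have [/andP[xz zq] z0] := sz.
  rewrite /self /self_integrand (quiet_leftlim x q)// indicE; congr (_ * _)%:E.
  rewrite /spikes in_setI mem_set//=; last exact: slab_dom0t sz.
  case: ifPn => h1; first by rewrite mem_set//= (quiet_leftlim x q).
  by rewrite memNset//=; apply/negP; rewrite (quiet_leftlim x q).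
have msl := measurable_slab x q; have msp := measurable_spikes b.
under eq_integral do rewrite EFinM.
rewrite integralZl//; last first.
  apply/integrableP; split; first by apply/measurable_EFinP; exact: measurable_indic.
  under eq_integral do rewrite gee0_abs ?lee_fin//.
  rewrite integral_indic//; apply: le_lt_trans (spikes_fin b).
  by apply: le_measure; rewrite ?inE//; exact: measurableI.
rewrite integral_indic// spikes_slab -(cnt_strip _ _ (measurable_spikes b) (nat_c b)) ?ltW// -/(c b) c1.
by rewrite mule1 /=; lra.
Qed.

Lemma large b (x q : R) : 0 <= x -> x < q -> q <= t -> quiet x q ->
  (l b x < l b q)%N -> 2 * h < `|V x b|.
Proof.
move=> x0 xq qt qxq; rewrite -subn_gt0 => lt.
have [S0|/set0P[z [[_ /= lz] /andP[xz zq]]]] := eqVneq (large_spikes b `&` strip x q) set0.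
  have := cnt_strip _ _ (measurable_large_spikes b) (nat_l b) x q (ltW xq).
  rewrite S0 measure0 => -[/eqP]; rewrite pnatr_eq0 => /eqP E.
  by move: lt; rewrite /l E.
by rewrite -(quiet_leftlim x q b z.1).
Qed.

Let cmono b : {homo c b : x y / x <= y >-> (x <= y)%N} :=
  cnt_homo _ _ (measurable_spikes b) (nat_c b).

(** All spikes in []x, q]] sit at time [q]: the strips []x, q - (q - x)/(n+1)]], which exhaust []x,
    q[], have mass [0]. *)
Lemma quiet_spikes_at b x q : 0 <= x -> x < q -> q <= t -> quiet x q ->
  ((c b q - c b x)%:R%:E <=
     nu b (spikes b `&` ([set q] `*` `[0%R, +oo[%classic)))%E.
Proof.
move=> x0 xq qt qxq.
rewrite (cnt_strip _ _ (measurable_spikes b) (nat_c b) _ _ (ltW xq)).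
pose F n := spikes b `&` strip x (q - (q - x) / n.+1%:R).
have mq : measurable (spikes b `&` ([set q] `*` `[0%R, +oo[%classic) : set (R * R)).
  apply: measurableI; first exact: measurable_spikes.
  by apply: measurableX => //; exact: measurable_itv.
have F0 n : nu b (F n) = 0%E.
  have qn : x <= q - (q - x) / n.+1%:R < q.
    have ?: (0 : R) < n.+1%:R by rewrite ltr0n.
    apply/andP; split; last by rewrite ltrBlDr ltrDl divr_gt0 ?subr_gt0.
    rewrite lerBrDr -lerBrDl ler_pdivrMr// ler_peMr ?ler1n ?subr_ge0//.
    exact: ltW.
  case/andP: qn => xn nq.
  by rewrite /F -(cnt_strip _ _ (measurable_spikes b) (nat_c b))// -/(c b) (qxq b _ xn nq) subnn.
have mF n : measurable (F n).
  by apply: measurableI; [exact: measurable_spikes|exact: measurable_strip].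
have mU : measurable (\bigcup_n F n) by exact: bigcup_measurable.
have U0 : nu b (\bigcup_n F n) = 0%E.
  apply/negligibleP => //.
  by apply: negligible_bigcup => n; exact: (iffRL (negligibleP _ (mF n)) (F0 n)).
have sub : spikes b `&` strip x q `<=`
    (spikes b `&` ([set q] `*` `[0%R, +oo[%classic)) `|` \bigcup_n F n.
  move=> z [sz /andP[xz zq]]; have [zE|zNq] := eqVneq z.1 q.
    left; split => //; split => //=; rewrite in_itv/= ?andbT.
    by case: sz; rewrite dom0tE => -[].
  right; have zltq : 0 < (q - z.1) / (q - x).
    by rewrite divr_gt0 ?subr_gt0// lt_neqAle zNq.
  have [n _ /(_ n (leqnn _))/= ltn] := near_infty_natSinv_lt (PosNum zltq).
  exists n => //; split => //; apply/andP; split => //.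
  move: ltn; rewrite ltr_pdivlMr ?subr_gt0// => /ltW.
  by rewrite mulrC lerBrDl -lerBrDr.
have mS : measurable (spikes b `&` strip x q).
  by apply: measurableI; [exact: measurable_spikes|exact: measurable_strip].
rewrite -(measureU0 mq mU U0); apply: le_measure; rewrite ?inE//.
exact: measurableU.
Qed.

Lemma csimple (q : R) : 0 < q -> q <= t ->
  exists x : R, [/\ 0 <= x, x < q, quiet x q & (\sum_b (c b q - c b x) <= 1)%N].
Proof.
move=> q0 qt.
(* Applied to the total count: every count is nondecreasing, so constancy of the sum makes all of
   them constant. *)
have [x [x0 xq xc]] := left_step _ 0 q q0 (sum_homo N xpredT c cmono).
have qxq : quiet x q.
  move=> b y xy yq; apply/eqP; rewrite eqn_leq (cmono b x y xy) andbT leqNgt; apply/negP => lt.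
  have := xc y xy yq; rewrite (bigD1 b)//= [RHS](bigD1 b)//=.
  have : (\sum_(e | e != b) c e x <= \sum_(e | e != b) c e y)%N.
    by apply: leq_sum => e _; exact: cmono.
  by move: lt (\sum_(e | _) c e x)%N (\sum_(e | _) c e y)%N; clear; lia.
exists x; split => //.
rewrite -(ler_nat R) -lee_fin natr_sum -sumEFin.
apply: le_trans (nu_simple _ q0); apply: lee_sum => b _.
apply: (le_trans (quiet_spikes_at b x q x0 xq qt qxq)); apply: le_measure; rewrite ?inE.
- apply: measurableI; first exact: measurable_spikes.
  by apply: measurableX => //; exact: measurable_itv.
- by apply: measurableX => //; exact: measurable_itv.
- exact: subIsetr.
Qed.

Lemma Phi_abs r : Phi phi r = Phi phi `|r|.
Proof.
case: (lerP 0 r) => r0; first by rewrite ger0_norm.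
by rewrite ltr0_norm// /Phi opprK addrC.
Qed.

Lemma Phi_ge0 r : 0 <= Phi phi r.
Proof. by rewrite addr_ge0. Qed.

Lemma Phi_le_Mlt r : `|r| <= 2 * h -> (Mlt phi (2 * h) < +oo)%E ->
  Phi phi r <= fine (Mlt phi (2 * h)).
Proof.
move=> rh Mfin.
have le : ((Phi phi r)%:E <= Mlt phi (2 * h))%E.
  by apply: ereal_sup_ubound; exists `|r|; rewrite -?Phi_abs//= in_itv/= normr_ge0.
rewrite -lee_fin fineK// ge0_fin_numE// (le_trans _ le)// lee_fin.
exact: Phi_ge0.
Qed.

Lemma Mgt_inv_ge0 e : (0 <= Mgt_inv phi e)%E.
Proof. by apply: le_ereal_inf_tmp => _ [r [r0 _] <-]; rewrite lee_fin. Qed.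

(** A nonnegative [x < |r|] has [M^>(x) <= Phi |r| = Phi r < e], hence is not admissible in the
    infimum defining [Mgt_inv]. *)
Lemma Mgt_inv_ge r e : Phi phi r < e -> (`|r|%:E <= Mgt_inv phi e%:E)%E.
Proof.
move=> lt; apply: le_ereal_inf_tmp => _ [x [x0 xe] <-]; rewrite lee_fin leNgt.
apply/negP => xr; move: lt; rewrite ltNge => /negP; apply.
move: xe; rewrite lee_fin => /le_trans; apply; apply: ge_inf.
  by exists 0 => _ [y _ <-]; exact: Phi_ge0.
by exists `|r|; rewrite -?Phi_abs//= in_itv/= xr.
Qed.

Lemma potential_at_atom a (tau e : R) : 0 < tau -> tau <= t -> 0 <= e ->
  (1 <= nu a [set (tau, e)])%E -> (`|V tau a|%:E <= Mgt_inv phi e%:E)%E.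
Proof.
move=> tau0 taut e0 atom.
have [x [x0 xtau qx cs]] := csimple tau tau0 taut.
have mpt : measurable [set (tau, e)].
  rewrite (_ : [set _] = [set tau] `*` [set e]).
    by apply: measurableX; exact: measurable_set1.
  by apply/seteqP; split => -[y z] /= [-> ->].
have mtau : measurable ([set tau] `*` `[0%R, +oo[%classic : set (R * R)).
  by apply: measurableX => //; exact: measurable_itv.
have ltau : leftlim (fun s => V s a) tau = V x a by exact: (quiet_leftlim x tau).
have [eP|Pe] := leP e (Phi phi (V x a)).
  rewrite (reset a x tau)//; first by rewrite normr0; exact: Mgt_inv_ge0.
  rewrite -subn_gt0 -(ltr0n R) -lte_fin (cnt_strip _ _ (measurable_spikes a) (nat_c a) _ _ (ltW xtau)).
  apply: (@lt_le_trans _ _ 1%E) => //; apply: (le_trans atom); apply: le_measure; rewrite ?inE//.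
    by apply: measurableI; [exact: measurable_spikes|exact: measurable_strip].
  move=> _ ->; split; last by rewrite /strip /= xtau lexx.
  by rewrite /spikes dom0tE; split; rewrite /= ?ltau// taut (ltW tau0).
(* Here the atom [(tau, e)] is too high to be a spike of [a], so a spike of any actor at [tau] would
   be a second atom at the same time, against [nu_simple]. *)
have noneed b : (c b tau - c b x = 0)%N.
  apply/eqP/negP => /negP; rewrite -lt0n -(ler_nat R) -lee_fin => h1.
  have {}h1 := le_trans h1 (quiet_spikes_at b x tau x0 xtau taut qx).
  set H := [set tau] `*` `[0%R, +oo[%classic in h1 mtau *.
  have Hpt : [set (tau, e)] `<=` H by move=> _ -> /=; split => //=; rewrite in_itv/= andbT.
  have mSH e' : measurable (spikes e' `&` H).
    by apply: measurableI => //; exact: measurable_spikes.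
  have : (1 + 1 <= \sum_e nu e H)%E.
    have [ba|ba] := eqVneq b a.
      rewrite (bigD1 a)//=; apply: (@le_trans _ _ (nu a H)); last first.
        by rewrite leeDl// sume_ge0.
      apply: (@le_trans _ _ (nu a ((spikes a `&` H) `|` [set (tau, e)]))).
        rewrite measureU//; first by rewrite leeD// -ba.
        rewrite -subset0 => z [[sz _] /= zE]; move: sz; rewrite zE /spikes /= ltau.
        by move=> [_]; rewrite leNgt Pe.
      apply: le_measure; rewrite ?inE//; first exact: measurableU.
      by move=> z [[]//|]; exact: Hpt.
    rewrite (bigD1 a)//= (bigD1 b)//= addeA.
    rewrite (@le_trans _ _ (nu a H + nu b H)%E)//; last by rewrite leeDl// sume_ge0.
    apply: leeD.
      by apply: (le_trans atom); apply: le_measure; rewrite ?inE.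
    by apply: (le_trans h1); apply: le_measure; rewrite ?inE//; exact: subIsetr.
  move=> /le_trans/(_ (nu_simple tau tau0)).
  by rewrite -EFinD lee_fin; lra.
suff -> : V tau a = V x a by exact: Mgt_inv_ge.
apply/eqP; rewrite -subr_eq0 -normr_le0.
have cE : c a x = c a tau.
  by have := cmono a _ _ (ltW xtau); have := noneed a; clear; lia.
apply: (le_trans (drift a x tau x0 (ltW xtau) taut cE)).
by rewrite big1 ?mulr0// => b _; rewrite noneed.
Qed.

Lemma small_spikes_le b u v : 0 <= u -> u <= v -> v <= t -> (Mlt phi (2 * h) < +oo)%E ->
  (((c b v - c b u) - (l b v - l b u))%:R%:E <=
   nu b (`[u, v]%classic `*` `[0%R, fine (Mlt phi (2 * h))]%classic))%E.
Proof.
move=> u0' uv vt Mfin.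
have mS := measurable_spikes b; have mL := measurable_large_spikes b.
have mst := measurable_strip u v.
have mD : measurable ((spikes b `\` large_spikes b) `&` strip u v).
  by apply: measurableI => //; exact: measurableD.
have [k kE] : isnat (nu b ((spikes b `\` large_spikes b) `&` strip u v)).
  by apply: (isnat_spikes b) => // z [[]].
have : nu b (spikes b `&` strip u v) = (nu b (large_spikes b `&` strip u v) +
    nu b ((spikes b `\` large_spikes b) `&` strip u v))%E.
  rewrite -measureU//.
  - congr (nu b _); rewrite -setIUl; congr (_ `&` _).
    by rewrite setDUK// => z [].
  - exact: measurableI.
  - by rewrite -subset0 => z [[lz _] [[_ nlz] _]].
rewrite -(cnt_strip _ _ mS (nat_c b))// -(cnt_strip _ _ mL (nat_l b))// kE -EFinD -natrD.
rewrite -/(c b) -/(l b) => -[/eqP]; rewrite eqr_nat => /eqP ->.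
rewrite addKn -kE; apply: le_measure; rewrite ?inE//.
  by apply: measurableX; exact: measurable_itv.
move=> z [[sz nlz] /andP[uz zv]]; split; rewrite /= in_itv/=; first by rewrite (ltW uz).
case: (sz) => + zP; rewrite dom0tE => -[_ ->]/=; apply: (le_trans zP).
apply: Phi_le_Mlt => //; rewrite leNgt; apply/negP => lt; apply: nlz.
by split.
Qed.

Lemma path_bound a (tau e : R) : 0 < tau -> tau <= t -> 0 <= e ->
  (1 <= nu a [set (tau, e)])%E -> (Mlt phi (2 * h) < +oo)%E ->
  (`|V t a|%:E <= Mgt_inv phi e%:E + h%:E + (2 * h / N%:R)%:E *
     \sum_(b | b != a) nu b (`[tau, t]%classic `*` `[0%R, fine (Mlt phi (2 * h))]%classic))%E.
Proof.
move=> tau0 taut e0 atom Mfin.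
have lmono b : {homo l b : x y / x <= y >-> (x <= y)%N}.
  exact: cnt_homo (measurable_large_spikes b) (nat_l b).
have cright b : right_step (c b) by exact: cnt_right_step (measurable_spikes b) (nat_c b).
have lright b : right_step (l b) by exact: cnt_right_step (measurable_large_spikes b) (nat_l b).
have lec b u v : u <= v -> (l b v - l b u <= c b v - c b u)%N.
  move=> uv; rewrite -(ler_nat R) -lee_fin.
  rewrite (cnt_strip _ _ (measurable_spikes b) (nat_c b))//.
  rewrite (cnt_strip _ _ (measurable_large_spikes b) (nat_l b))//.
  apply: le_measure; rewrite ?inE//.
  - by apply: measurableI; [exact: measurable_large_spikes|exact: measurable_strip].
  - by apply: measurableI; [exact: measurable_spikes|exact: measurable_strip].
  - by apply: setSI => z [].
have [u /andP[tauu ut]] := potential_bound h N a t (fun b s => V s b) c l h_gt0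
  cmono cright lmono lright lec csimple drift reset large tau (ltW tau0) taut.
rewrite -lee_fin => /le_trans; apply.
have hN : 0 <= 2 * h / N%:R by rewrite divr_ge0 ?mulr_ge0 ?(ltW h_gt0).
rewrite EFinD EFinD EFinM; apply: leeD; first by apply: leeD => //; exact: (potential_at_atom a tau e).
apply: lee_wpmul2l; first by rewrite lee_fin.
rewrite natr_sum -sumEFin; apply: lee_sum => b _.
apply: (le_trans (small_spikes_le b u t (le_trans (ltW tau0) tauu) ut (lexx t) Mfin)).
(* The left end is moved from [u], which depends on the whole path, down to [tau], the time of an
   atom of [nu a]. *)
apply: le_measure; rewrite ?inE//; try by apply: measurableX; exact: measurable_itv.
move=> z [/= z1 z2]; split => //=; move: z1; rewrite !in_itv/= => /andP[uz ->].
by rewrite (le_trans tauu).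
Qed.

End path.

(** * Natural values on all Borel sets from a countable generating class *)

Section natural_dynkin.
Context {R : realType} {d0 d : measure_display} {T0 : measurableType d0} {T : measurableType d}.
Variables (m : {measure set T0 -> \bar R}) (D : set T0) (g : T0 -> T).
Hypotheses (mD : measurable D) (mg : measurable_fun setT g).
Hypothesis natD : isnat (m D).

Lemma isnat_le (A : set T0) : measurable A -> A `<=` D -> m A \is a fin_num.
Proof.
move=> mA AD; rewrite ge0_fin_numE//; case: natD => k kE.
by apply: (@le_lt_trans _ _ (m D)); [apply: le_measure; rewrite ?inE|rewrite kE ltry].
Qed.

(** The sets of natural mass form a Dynkin system: complements by subtraction inside [D], disjoint
    unions by stationarity of the partial sums. The map [g] allows one coordinate to be treated at a
    time. *)
Lemma isnat_dynkin (G : set_system T) :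
  @measurable _ T = <<s G >> -> setI_closed G ->
  (forall A, G A -> isnat (m (D `&` g @^-1` A))) ->
  forall A, measurable A -> isnat (m (D `&` g @^-1` A)).
Proof.
move=> GE GI GP A; rewrite GE; move: A.
have mpre A : measurable A -> measurable (D `&` g @^-1` A).
  by move=> mA; apply: measurableI => //; rewrite -[X in measurable X]setTI; exact: mg.
apply: dynkin_induction => //.
- by rewrite preimage_setT setIT.
- move=> S mS [k kE]; have [n nE] := natD.
  have mDS := mpre _ mS; have mDC := mpre _ (measurableC mS).
  have : m D = (m (D `&` g @^-1` S) + m (D `&` g @^-1` (~` S)))%E.
    rewrite -measureU//; last by rewrite -subset0 => x [[_ +] [_]].
    by rewrite -setIUr preimage_setC setUv setIT.
  have : m (D `&` g @^-1` (~` S)) \is a fin_num by apply: isnat_le => //; exact: subIsetl.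
  rewrite nE kE; case: (m (D `&` g @^-1` (~` S))) => // r _.
  rewrite -EFinD => -[nkr]; exists (n - k)%N.
  have -> : r = n%:R - k%:R by rewrite nkr addrAC subrr add0r.
  rewrite natrB// -(ler_nat R) -lee_fin -kE -nE; apply: le_measure; rewrite ?inE//.
  
- move=> F mF tF PF.
  pose F' n := D `&` g @^-1` (F n).
  have mF' n : measurable (F' n) by exact: mpre.
  have UE : D `&` g @^-1` (\bigcup_k F k) = \bigcup_k F' k.
    by rewrite preimage_bigcup setI_bigcupr.
  have mU : measurable (\bigcup_k F' k) by exact: bigcup_measurable.
  have tF' : trivIset setT F'.
    by move=> i j _ _ [x [[_ xi] [_ xj]]]; apply: (tF i j) => //; exists (g x).
  rewrite UE.
  have cv := @measure_semi_sigma_additive _ _ _ m F' mF' tF' mU.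
  have natn n : isnat (\sum_(0 <= i < n) m (F' i))%E.
    elim: n => [|n [k kE]]; first by exists 0%N; rewrite big_geq.
    by have [k' k'E] := PF n; exists (k + k')%N; rewrite big_nat_recr//= kE k'E natrD.
  have fin : m (\bigcup_k F' k) \is a fin_num.
    by apply: isnat_le => //; rewrite -UE; exact: subIsetl.
  have [n0 /(_ _ (leqnn _)) <-] := isnat_stationary _ _ natn fin cv.
  exact: natn.
Qed.

End natural_dynkin.

Section borel_generators.
Context {R : realType}.

(** A countable pi-system generating the Borel sets; [None] adds the whole line, so that a condition
    on one coordinate alone is a special case. *)
Definition ray (p : option rat) : set R :=
  if p is Some q then `]-oo, (ratr q : R)[%classic else setT.

Lemma measurable_ray p : measurable (ray p).
Proof. by case: p => [q|]; [exact: measurable_itv|exact: measurableT]. Qed.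

Lemma ray_setI : setI_closed (range ray).
Proof.
move=> _ _ [p _ <-] [r _ <-]; case: p => [q|]; last by rewrite setTI; exists r.
case: r => [r|]; last by rewrite setIT; exists (Some q).
exists (Some (Order.min q r)) => //; rewrite /ray.
have -> : (ratr (Order.min q r) : R) = Num.min (ratr q) (ratr r).
  by rewrite /Order.min ltr_rat; case: ifP.
apply/seteqP; split => x /=; rewrite !in_itv/= lt_min.
  by move=> /andP[].
by move=> [-> ->].
Qed.

Lemma measurable_range_ray : (@measurable _ R : set_system R) = <<s range ray >>.
Proof.
apply/seteqP; split => A; last first.
  move: A; apply: smallest_sub; first exact: sigma_algebra_measurable.
  by move=> _ [p _ <-]; exact: measurable_ray.
rewrite [X in X A -> _]RGenInftyO.measurableE; move: A.
apply: smallest_sub; first exact: smallest_sigma_algebra.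
move=> _ [x ->].
have -> : `]-oo, x[%classic = \bigcup_n (if unpickle n is Some q then
    if (ratr q : R) <= x then `]-oo, (ratr q : R)[%classic else set0 else set0).
  apply/seteqP; split => y /=; rewrite in_itv/=.
    move=> /rat_in_itvoo[q]; rewrite in_itv/= => /andP[yq qx].
    exists (pickle q); first exact: I.
    by rewrite pickleK (ltW qx) /= in_itv.
  move=> [n _]; case: unpickle => // q; case: ifP => // qx.
  by rewrite /= in_itv/= => /lt_le_trans; apply.
apply: sigma_algebra_bigcup => n; case: unpickle => [q|]; last exact: sigma_algebra0.
case: ifP => _; last exact: sigma_algebra0.
by apply: sub_sigma_algebra; exists (Some q).
Qed.

(** Countably many conditions suffice, which is what lets them hold simultaneously almost surely.
    [isnat_dynkin] is applied to the first coordinate, then to the second, then to the pi-system of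
    rectangles. *)
Lemma isnat_box (m : {measure set (R * R) -> \bar R}) n :
  (forall p r, isnat (m (box n `&` (ray p `*` ray r)))) ->
  forall A, measurable A -> A `<=` box n -> isnat (m A).
Proof.
move=> nat2 A mA Ab.
have mb := @measurable_box R n.
have mfst := @measurable_fst _ _ R R; have msnd := @measurable_snd _ _ R R.
have step1 p B : measurable B -> isnat (m ((box n `&` (setT `*` ray p)) `&` fst @^-1` B)).
  apply: (isnat_dynkin _ _ fst _ _ _ (range ray)) => //.
  - by apply: measurableI => //; apply: measurableX => //; exact: measurable_ray.
  - exact: nat2 None p.
  - exact: measurable_range_ray.
  - exact: ray_setI.
  move=> _ [r _ <-]; rewrite [X in isnat (m X)](_ : _ = box n `&` (ray r `*` ray p)).
    exact: nat2.
  by apply/seteqP; split => x; [move=> [[bx [_ ?]] ?]|move=> [bx [? ?]]].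
have step2 B1 B2 : measurable B1 -> measurable B2 ->
    isnat (m ((box n `&` fst @^-1` B1) `&` snd @^-1` B2)).
  move=> mB1; apply: (isnat_dynkin _ _ snd _ _ _ (range ray)) => //.
  - by apply: measurableI => //; rewrite -[X in measurable X]setTI; exact: mfst.
  - by have := step1 None _ mB1; rewrite setXTT setIT.
  - exact: measurable_range_ray.
  - exact: ray_setI.
  move=> _ [p _ <-]; rewrite [X in isnat (m X)](_ : _ = (box n `&` (setT `*` ray p)) `&` fst @^-1` B1).
    exact: step1.
  by apply/seteqP; split => x; [move=> [[bx ?] ?]|move=> [[bx [_ ?]] ?]].
rewrite -(setIidr Ab).
apply: (isnat_dynkin _ _ id _ _ _ [set A `*` B | A in measurable & B in measurable]) => //.
- by have := nat2 None None; rewrite /ray setXTT setIT.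
- by rewrite measurable_prod_measurableType.
- move=> _ _ [A1 mA1 [B1 mB1 <-]] [A2 mA2 [B2 mB2 <-]].
  exists (A1 `&` A2); first exact: measurableI.
  exists (B1 `&` B2); first exact: measurableI.
  by rewrite setXI.
- move=> _ [B1 mB1 [B2 mB2 <-]]; have := step2 _ _ mB1 mB2; congr (isnat (m _)).
  by rewrite -setIA.
Qed.

End borel_generators.

(** * Superposition of Poisson random measures *)

Section poisson_weights.
Context {R : realType}.

Lemma poisson_w_ge0 (m : R) k : 0 <= m -> 0 <= poisson_w m k.
Proof. by move=> m0; rewrite /poisson_w mulr_ge0 ?expR_ge0// divr_ge0// exprn_ge0. Qed.

Lemma sum_poisson_w (m : R) : 0 <= m -> (\sum_(0 <= k <oo) (poisson_w m k)%:E = 1)%E.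
Proof.
move=> m0.
rewrite [RHS](_ : _ = (expR (- m))%:E * (expR m)%:E)%E; last first.
  by rewrite -EFinM expRN mulVf ?gt_eqF ?expR_gt0.
under eq_eseriesr do rewrite /poisson_w EFinM muleC.
rewrite nneseriesZl/=; last by move=> n _; rewrite lee_fin divr_ge0// exprn_ge0.
congr *%E; rewrite expRE -EFin_lim; last first.
  rewrite /pseries/=; under eq_fun do rewrite mulrC.
  exact: is_cvg_series_exp_coeff.
apply/congr_lim/funext => n/=; rewrite /pseries/= /series/= -sumEFin//.
by under eq_bigr do rewrite mulrC.
Qed.

Lemma poisson_w_conv (x y : R) (k : nat) :
  \sum_(j < k.+1) poisson_w x j * poisson_w y (k - j) = poisson_w (x + y) k.
Proof.
have fne n : n`!%:R != 0 :> R by rewrite pnatr_eq0 -lt0n fact_gt0.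
rewrite /poisson_w [x + y]addrC exprDn opprD expRD mulr_suml mulr_suml.
apply: eq_bigr => -[j jk] _ /=; rewrite -(bin_fact (leq_ltn_trans (leqnn j) jk : (j <= k)%N)).
rewrite -mulr_natr !natrM; field.
by rewrite !fne pnatr_eq0 -lt0n bin_gt0 -ltnS jk.
Qed.

Lemma poisson_w0 k : poisson_w (0 : R) k = (k == 0)%N%:R.
Proof.
rewrite /poisson_w oppr0 expR0 mulr1 expr0n; case: k => [|k] /=.
  by rewrite fact0 divr1.
by rewrite mul0r.
Qed.

(** The left side is the probability of at least two points; the bound is [(1 - m) * (1 + m) <= expR
    (- m) * (1 + m)]. *)
Lemma poisson_w_le2 (m : R) : 0 <= m -> 1 - poisson_w m 0 - poisson_w m 1 <= m ^+ 2.
Proof.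
move=> m0; rewrite /poisson_w expr0 expr1 (_ : 0`! = 1%N)// (_ : 1`! = 1%N)// !divr1 mul1r.
have e1 : 1 - m <= expR (- m) by have := expR_ge1Dx (- m).
have : (1 - m) * (1 + m) <= expR (- m) * (1 + m) by rewrite ler_wpM2r// addr_ge0.
lra.
Qed.

End poisson_weights.

Section prob_lemmas.
Context {R : realType} {d : measure_display} {T : measurableType d}.
Variable P : probability T R.

Lemma prob_ae_eq (G X Y : set T) : {ae P, forall w, G w} -> measurable X -> measurable Y ->
  (forall w, G w -> X w <-> Y w) -> P X = P Y.
Proof.
move=> [N [mN N0 GN]] mX mY XY.
have rm Z : measurable Z -> P Z = P (Z `\` N).
  move=> mZ; rewrite (measureDI _ mZ mN) [X in (_ + X)%E](_ : _ = 0%E) ?adde0//.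
  apply/eqP; rewrite eq_le measure_ge0 andbT -N0; apply: le_measure; rewrite ?inE//.
  exact: measurableI.
rewrite (rm X)// (rm Y)//; congr (P _); apply/seteqP; split => w [Zw nNw]; split => //;
  have [/XY H|nG] := pselect (G w); [tauto|by have := GN _ nG|tauto|by have := GN _ nG].
Qed.

Lemma prob_disjoint_seq (J : eqType) (s : seq J) (F : J -> set T) : uniq s ->
  (forall j, measurable (F j)) -> (forall i j w, F i w -> F j w -> i = j) ->
  P [set w | exists2 j, j \in s & F j w] = (\sum_(j <- s) P (F j))%E.
Proof.
move=> + mF disj; elim: s => [_|j s IH /= /andP[js us]].
  by rewrite big_nil (_ : [set w | _] = set0) ?measure0// -subset0 => w [].
have mU (r : seq J) : measurable [set w | exists2 j, j \in r & F j w].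
  elim: r => [|i r IHr].
    by rewrite (_ : [set w | _] = set0)// -subset0 => w [].
  rewrite (_ : [set w | _] = F i `|` [set w | exists2 j, j \in r & F j w]); first exact: measurableU.
  apply/seteqP; split => w /=.
    by move=> [i']; rewrite inE => /predU1P[->|ir]; [left|right; exists i'].
  by move=> [Fw|[i' ir Fw]]; [exists i; rewrite ?mem_head|exists i' => //; rewrite inE ir orbT].
rewrite big_cons -IH// -measureU//.
- congr (P _); apply/seteqP; split => w /=.
    by move=> [i]; rewrite inE => /predU1P[->|ir]; [left|right; exists i].
  by move=> [Fw|[i ir Fw]]; [exists j; rewrite ?mem_head|exists i => //; rewrite inE ir orbT].
- rewrite -subset0 => w [Fw [i ir Fiw]]; move: js; rewrite (disj _ _ _ Fw Fiw).
  by rewrite ir.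
Qed.

Lemma prob_disjoint_fin (J : finType) (Q : pred J) (F : J -> set T) :
  (forall j, measurable (F j)) -> (forall i j w, F i w -> F j w -> i = j) ->
  P [set w | exists2 j, Q j & F j w] = (\sum_(j | Q j) P (F j))%E.
Proof.
move=> mF disj; rewrite -big_filter -prob_disjoint_seq//.
- congr (P _); apply/seteqP; split => w [j Qj Fj]; exists j => //.
    by rewrite mem_filter Qj mem_index_enum.
  by move: Qj; rewrite mem_filter => /andP[].
- by rewrite filter_uniq// index_enum_uniq.
Qed.

Lemma ae_prob1 (X : set T) : measurable X -> P X = 1%E -> {ae P, forall w, X w}.
Proof.
move=> mX PX; exists (~` X); split => //; first exact: measurableC.
by rewrite probability_setC// PX subee.
Qed.

End prob_lemmas.

Section superposition.
Context {R : realType} {d : measure_display} {T : measurableType d}.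
Variable P : probability T R.
Variables (N : nat) (Nm : 'I_N -> T -> {measure set (R * R) -> \bar R}).
Hypothesis PRM : forall b, is_PRM P (Nm b).
Hypothesis indep : mutual_indep_pi P (fun b => rm_events (Nm b)).

Lemma intensity_ge0 (A : set (R * R)) : (0 <= intensity A)%E.
Proof. exact: measure_ge0. Qed.

Lemma measurable_Nm b A : measurable A -> measurable_fun setT (fun w => Nm b w A).
Proof. by case: (PRM b) => + _; exact. Qed.

Lemma measurable_Nm_pre b A (B : set (\bar R)) : measurable A -> measurable B ->
  measurable [set w | B (Nm b w A)].
Proof.
move=> mA mB; have := measurable_Nm b A mA measurableT _ mB.
by rewrite setTI.
Qed.

Lemma ae_isnat b A : measurable A -> (intensity A < +oo)%E ->
  {ae P, forall w, isnat (Nm b w A)}.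
Proof.
move=> mA fA; have [_ [/(_ A mA fA) law _]] := PRM b.
have mF k : measurable [set w | Nm b w A = k%:R%:E].
  exact: (measurable_Nm_pre b A [set k%:R%:E]).
apply: (@ae_prob1 _ _ _ P [set w | isnat (Nm b w A)]).
  rewrite (_ : [set w | _] = \bigcup_k [set w | Nm b w A = k%:R%:E]).
    exact: bigcup_measurable.
  by apply/seteqP; split => w /= [k]; [exists k|move=> _; exists k].
rewrite (_ : [set w | _] = \bigcup_(k in setT) [set w | Nm b w A = k%:R%:E]); last first.
  by apply/seteqP; split => w /= [k]; [exists k|move=> _; exists k].
rewrite measure_semi_bigcup//; last 2 first.
- by move=> i j _ _ [w [/= -> [/eqP]]]; rewrite eqr_nat => /eqP.
- exact: bigcup_measurable.
rewrite -(sum_poisson_w (fine (intensity A))) ?fine_ge0 ?intensity_ge0//.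
by apply: eq_eseriesr => k _; rewrite -law.
Qed.

Section family.
Variables (n : nat) (A : 'I_n -> set (R * R)).
Hypothesis mA : forall i, measurable (A i).
Hypothesis fA : forall i, (intensity (A i) < +oo)%E.

Definition sum_event (s : seq 'I_N) (k : 'I_n -> nat) : set T :=
  [set w | forall i, (\sum_(b <- s) Nm b w (A i))%E = (k i)%:R%:E].

Definition point_event b (k : 'I_n -> nat) : set T :=
  [set w | forall i, Nm b w (A i) = (k i)%:R%:E].

Lemma measurable_forall_ord (F : 'I_n -> set T) : (forall i, measurable (F i)) ->
  measurable [set w | forall i, F i w].
Proof.
move=> mF; rewrite (_ : [set w | _] = \bigcap_(i in setT) F i).
  by apply: fin_bigcap_measurable.
by apply/seteqP; split => w Fw i; [move=> _; exact: Fw|exact: Fw].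
Qed.

Lemma measurable_sum_Nm (s : seq 'I_N) B : measurable B ->
  measurable_fun setT (fun w => \sum_(b <- s) Nm b w B)%E.
Proof. by move=> mB; apply: emeasurable_sum => b; exact: measurable_Nm. Qed.

Lemma measurable_sum_event s k : measurable (sum_event s k).
Proof.
apply: measurable_forall_ord => i.
rewrite -[X in measurable X]setTI.
exact: (measurable_sum_Nm s (A i) (mA i) measurableT _ (emeasurable_set1 _)).
Qed.

Lemma rm_events_point b k : rm_events (Nm b) (point_event b k).
Proof.
exists n, A, (fun i => [set (k i)%:R%:E]); split => //.
by apply/seteqP; split => w H i //=; exact: H.
Qed.

Lemma measurable_rm_events b E : rm_events (Nm b) E -> measurable E.
Proof.
move=> [p [B [C [mBC ->]]]]; apply: fin_bigcap_measurable => // i _.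
by case: (mBC i) => mB mC; exact: measurable_Nm_pre.
Qed.

Lemma rm_eventsT b : rm_events (Nm b) setT.
Proof.
exists 0%N, (fun _ => set0), (fun _ => set0); split; first by case.
by apply/seteqP; split => // w _ [].
Qed.

(** Law of a sum of independent vectors by iterated convolution. The bound [\max_i k i] serves to
    make the index type finite; the condition [j i <= k i] selects the terms. *)
Fixpoint conv_law (s : seq 'I_N) (k : 'I_n -> nat) : \bar R :=
  if s is b :: s' then
    (\sum_(j : {ffun 'I_n -> 'I_(\max_i k i).+1} | [forall i, (j i <= k i)%N])
       P (point_event b (fun i => j i)) * conv_law s' (fun i => (k i - j i)%N))%E
  else ([forall i, k i == 0%N])%:R%:E.

Lemma conv_law_ge0 s k : (0 <= conv_law s k)%E.
Proof.
by elim: s k => [k|b s IH k] /=; [rewrite lee_fin|apply: sume_ge0 => j _; rewrite mule_ge0].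
Qed.

(** The arbitrary events [E] carry the induction: the head [b] of [s] is removed by splitting over
    its values [j], and [point_event b j] takes the place of [E b = setT]. Mutual independence is
    used once [s] is empty. *)
Lemma prob_sum_event (s : seq 'I_N) (E : 'I_N -> set T) (k : 'I_n -> nat) : uniq s ->
  (forall b, rm_events (Nm b) (E b)) -> (forall b, b \in s -> E b = setT) ->
  P (\bigcap_b E b `&` sum_event s k) = ((\prod_b P (E b)) * conv_law s k)%E.
Proof.
elim: s E k => [|b s IH] E k /=.
  move=> _ rmE _; rewrite -indep//.
  have [/forallP k0|/forallPn[i ki]] := boolP [forall i, k i == 0%N].
    rewrite mule1; congr (P _); apply/seteqP; split => w; [by case|split => //].
    by move=> i; rewrite big_nil (eqP (k0 i)).
  rewrite mule0 -(measure0 P); congr (P _); rewrite -subset0 => w [_ /(_ i)].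
  by rewrite big_nil => -[/esym/eqP]; rewrite pnatr_eq0 (negbTE ki).
move=> /andP[bs us] rmE sT.
pose J := {ffun 'I_n -> 'I_(\max_i k i).+1}.
pose E' (j : J) c := if c == b then point_event b (fun i => j i) else E c.
pose F (j : J) := \bigcap_c E' j c `&` sum_event s (fun i => (k i - j i)%N).
have rmE' j c : rm_events (Nm c) (E' j c).
  by rewrite /E'; case: eqP => [->|_]; [exact: rm_events_point|exact: rmE].
have mcap (H : 'I_N -> set T) : (forall c, rm_events (Nm c) (H c)) -> measurable (\bigcap_c H c).
  by move=> rmH; apply: fin_bigcap_measurable => // c _; exact: measurable_rm_events (rmH c).
have mF j : measurable (F j).
  by apply: measurableI; [exact: mcap|exact: measurable_sum_event].
have aeG : {ae P, forall w, (fun w => forall i, isnat (Nm b w (A i))) w}.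
  by apply: filter_forall => i; exact: ae_isnat.
(* The split over the values [j] is exact where the measure of the head is natural, hence almost
   surely. *)
rewrite (prob_ae_eq P _ _ [set w | exists2 j : J, [forall i, (j i <= k i)%N] & F j w] aeG).
- rewrite prob_disjoint_fin//; last first.
    move=> i j w [/(_ b I) + _] [/(_ b I) + _]; rewrite /E' eqxx => Hi Hj.
    apply/ffunP => p; apply/val_inj/eqP; rewrite -(eqr_nat R).
    by have := Hi p; rewrite (Hj p) => -[->].
  rewrite ge0_sume_distrr; last by move=> j _; rewrite mule_ge0// conv_law_ge0.
  apply: eq_bigr => j /forallP jk; rewrite IH//; last first.
    move=> c cs; rewrite /E'; case: eqP => [cb|_]; first by move: bs; rewrite -cb cs.
    by rewrite sT// inE cs orbT.
  rewrite muleA; congr (_ * _)%E; rewrite (bigD1 b)//= [in RHS](bigD1 b)//=.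
  rewrite {1}/E' eqxx (sT b (mem_head _ _)) probability_setT mul1e muleC; congr (_ * _)%E.
  by apply: eq_bigr => c /negbTE cb; rewrite /E' cb.
- apply: measurableI; first exact: mcap.
  exact: measurable_sum_event.
- rewrite (_ : [set w | _] = \bigcup_(j in [set j : J | [forall i, (j i <= k i)%N]]) F j).
    by apply: fin_bigcup_measurable => //; exact: finite_finset.
  by apply/seteqP; split => w [j Qj Fj]; exists j.
- move=> w natw; split.
    move=> [Ew Sw]; have [j jE] := choice natw.
    have jk i : (j i <= k i)%N.
      rewrite -(ler_nat R) -lee_fin -jE -(Sw i) big_cons leeDl//.
      by apply: sume_ge0.
    have jm i : (j i < (\max_i k i).+1)%N.
      by rewrite ltnS (leq_trans (jk i))//; exact: leq_bigmax.
    exists [ffun i => Ordinal (jm i)]; first by apply/forallP => i; rewrite ffunE; exact: jk.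
    split.
      move=> c _; rewrite /E'; case: eqP => [_|_]; last exact: Ew.
      by move=> i; rewrite ffunE/= jE.
    move=> i; rewrite ffunE/=; have := Sw i; rewrite big_cons jE.
    case: (\sum_(b <- s) _)%E => // r; rewrite -EFinD => -[kE].
    by rewrite natrB// -kE addrAC subrr add0r.
  move=> [j /forallP jk [Ew Sw]]; split.
    move=> c _; have := Ew c I; rewrite /E'; case: eqP => [->|//] _.
    by rewrite sT ?mem_head.
  move=> i; have := Ew b I; rewrite /E' eqxx => /(_ i) bi.
  by rewrite big_cons bi Sw -EFinD -natrD subnKC.
Qed.

End family.

End superposition.

Arguments sum_event {R d T N} Nm {n} A s k.
Arguments point_event {R d T N} Nm {n} A b k.

Section superposition_law.
Context {R : realType} {d : measure_display} {T : measurableType d}.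
Variable P : probability T R.
Variables (N : nat) (Nm : 'I_N -> T -> {measure set (R * R) -> \bar R}).
Hypothesis PRM : forall b, is_PRM P (Nm b).
Hypothesis indep : mutual_indep_pi P (fun b => rm_events (Nm b)).
Variables (n : nat) (A : 'I_n -> set (R * R)).
Hypothesis mA : forall i, measurable (A i).
Hypothesis fA : forall i, (intensity (A i) < +oo)%E.

(** The case of [prob_sum_event] where all events but the one at [a] are trivial. The regions may
    overlap, as the nested regions of the counting process do. *)
Lemma indep_sum_event (s : seq 'I_N) (a : 'I_N) (E : set T) (k : 'I_n -> nat) : uniq s ->
  a \notin s -> rm_events (Nm a) E ->
  P (E `&` sum_event Nm A s k) = (P E * P (sum_event Nm A s k))%E.
Proof.
move=> us as_ rmE.
have key (F : 'I_N -> set T) := prob_sum_event P N Nm PRM indep n A mA fA s F k us.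
pose F (c : 'I_N) := if c == a then E else setT.
have capF : \bigcap_c F c = E.
  apply/seteqP; split => w; first by move=> /(_ a I); rewrite /F eqxx.
  by move=> Ew c _; rewrite /F; case: ifP.
have := key F; rewrite capF => ->.
- have := key (fun=> setT).
  rewrite (_ : \bigcap_c setT = setT) ?setTI; last by apply/seteqP; split.
  move=> ->//; last by move=> b; exact: rm_eventsT.
  rewrite (bigD1 a)//= big1 ?mule1; last by move=> c /negbTE ca; rewrite /F ca probability_setT.
  by rewrite big1 ?mul1e ?/F ?eqxx// => c _; exact: probability_setT.
- by move=> c; rewrite /F; case: eqP => [->//|_]; exact: rm_eventsT.
- by move=> c cs; rewrite /F; case: eqP => // ca; move: as_; rewrite -ca cs.
Qed.

Hypothesis tA : forall i j, i != j -> A i `&` A j = set0.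

Lemma poisson_point_event b (j : 'I_n -> nat) :
  P (point_event Nm A b j) = (\prod_i poisson_w (fine (intensity (A i))) (j i))%:E.
Proof.
have [mN [law ind]] := PRM b.
have := ind n A mA tA (fun i => [set (j i)%:R%:E]) (fun i => emeasurable_set1 _).
rewrite (_ : \bigcap_i _ = point_event Nm A b j); last first.
  by apply/seteqP; split => w H i; [exact: (H i I)|move=> _; exact: H].
move=> ->; rewrite -prodEFin; apply: eq_bigr => i _.
by rewrite -law.
Qed.

Lemma sum_event_law (s : seq 'I_N) (k : 'I_n -> nat) : uniq s ->
  P (sum_event Nm A s k) =
  (\prod_i poisson_w ((size s)%:R * fine (intensity (A i))) (k i))%:E.
Proof.
move=> us.
have := prob_sum_event P N Nm PRM indep n A mA fA s (fun=> setT) k us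
  (fun b => rm_eventsT N Nm b) (fun _ _ => erefl).
rewrite (_ : \bigcap_c setT = setT) ?setTI; last by apply/seteqP; split.
rewrite big1 ?mul1e => [->|c _]; last exact: probability_setT.
elim: s k {us} => [|b s IH] k /=.
  congr EFin; under eq_bigr do rewrite mul0r poisson_w0.
  have [/forallP k0|/forallPn[i ki]] := boolP [forall i, k i == 0%N].
    by rewrite big1// => i _; rewrite k0.
  by rewrite (bigD1 i)//= (negbTE ki) mul0r.
under eq_bigr do rewrite IH poisson_point_event -EFinM -big_split/=.
rewrite sumEFin; congr EFin.
(* The sum over vectors [j] of products is a product over [i] of one-dimensional convolutions, each
   evaluated by [poisson_w_conv]. *)
transitivity (\prod_i \sum_(j < (\max_i k i).+1 | (j < (k i).+1)%N)
   (poisson_w (fine (intensity (A i))) j *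
    poisson_w ((size s)%:R * fine (intensity (A i))) (k i - j))).
  rewrite bigA_distr_big_dep; apply: eq_bigl => f.
  by apply/forallP/familyP => H i; exact: H.
apply: eq_bigr => i _.
rewrite -(big_ord_widen _ (fun j => poisson_w (fine (intensity (A i))) j *
    poisson_w ((size s)%:R * fine (intensity (A i))) (k i - j))); last first.
  by rewrite ltnS; exact: leq_bigmax.
by rewrite poisson_w_conv -[X in X + _]mul1r -mulrDl -natr1 addrC.
Qed.

End superposition_law.

(** * Independence of natural-valued variables: from single values to Borel sets *)

Section discrete_lifting.
Context {R : realType} {d : measure_display} {T : measurableType d}.
Variable P : probability T R.

Definition natural_rv (X : T -> R) := forall w, exists k : nat, X w = k%:R.

Lemma prob_nat_split (X : T -> R) (E : set T) (B : set R) : measurable_fun setT X ->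
  natural_rv X -> measurable E ->
  P (E `&` X @^-1` B) = (\sum_(0 <= k <oo)
    (if k%:R \in B then P (E `&` X @^-1` [set k%:R]) else 0))%E.
Proof.
move=> mX natX mE.
pose F k := if k%:R \in B then E `&` X @^-1` [set k%:R] else set0.
have mF k : measurable (F k).
  rewrite /F; case: ifP => // _; apply: measurableI => //.
  by rewrite -[X in measurable X]setTI; exact: mX.
have -> : E `&` X @^-1` B = \bigcup_k F k.
  apply/seteqP; split => w.
    move=> [Ew Bw]; have [k kE] := natX w; exists k => //.
    by rewrite /F mem_set -?kE.
  by move=> [k _]; rewrite /F; case: ifPn => // kB [Ew /= ->]; split => //; exact: set_mem.
rewrite measure_semi_bigcup//.
- by apply: eq_eseriesr => k _; rewrite /F; case: ifP.
- move=> i j _ _ [w]; rewrite /F; case: ifP => _; case: ifP => _ [] // [_ /= Xi] [_ Xj].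
  by apply/eqP; rewrite -(eqr_nat R) -Xi -Xj.
- exact: bigcup_measurable.
Qed.

Definition upd {n} (B : 'I_n -> set R) i (C : set R) := fun j => if j == i then C else B j.

(** The list [l] in [H] holds the coordinates not yet reduced to a single value; additivity in a
    coordinate removes it from [l]. *)
Lemma discrete_ext n (F1 F2 : ('I_n -> set R) -> \bar R) :
  let additive (F : ('I_n -> set R) -> \bar R) := forall B i, (forall j, measurable (B j)) ->
     F B = (\sum_(0 <= k <oo) (if (k%:R : R) \in B i then F (upd B i [set k%:R]) else 0))%E in
  additive F1 -> additive F2 ->
  (forall k : 'I_n -> nat, F1 (fun i => [set (k i)%:R]) = F2 (fun i => [set (k i)%:R])) ->
  forall B, (forall j, measurable (B j)) -> F1 B = F2 B.
Proof.
move=> additive add1 add2 F12.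
suff H : forall (l : seq 'I_n) B, (forall j, measurable (B j)) ->
    (forall j, j \notin l -> exists k : nat, B j = [set (k%:R : R)]) -> F1 B = F2 B.
  by move=> B mB; apply: (H (enum 'I_n)) => // j; rewrite mem_enum.
elim=> [|i l IH] B mB Bl.
  have [k kE] := choice (fun j => Bl j isT).
  by rewrite (_ : B = fun j => [set ((k j)%:R : R)])//; apply/funext.
rewrite (add1 B i mB) (add2 B i mB); apply: eq_eseriesr => k _; case: ifP => // _; apply: IH.
  by move=> j; rewrite /upd; case: eqP => // _; exact: measurable_set1.
move=> j jl; rewrite /upd; case: eqP => [_|/eqP ji]; first by exists k.
by apply: Bl; rewrite inE negb_or ji.
Qed.

Section family.
Variables (n : nat) (X : 'I_n -> T -> R).
Hypothesis mX : forall i, measurable_fun setT (X i).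
Hypothesis natX : forall i, natural_rv (X i).

Let mXB i B : measurable B -> measurable (X i @^-1` B).
Proof. by move=> mB; rewrite -[X in measurable X]setTI; exact: mX. Qed.

Lemma joint_additive (E : set T) (B : 'I_n -> set R) i : measurable E ->
  (forall j, measurable (B j)) ->
  P (E `&` \bigcap_j (X j @^-1` B j)) =
  (\sum_(0 <= k <oo) (if (k%:R : R) \in B i then
     P (E `&` \bigcap_j (X j @^-1` upd B i [set k%:R] j)) else 0))%E.
Proof.
move=> mE mB.
pose E' := E `&` \bigcap_(j in [set j | j != i]) (X j @^-1` B j).
have mE' : measurable E'.
  apply: measurableI => //; apply: fin_bigcap_measurable; first exact: finite_finset.
  by move=> j _; exact: mXB.
have -> : E `&` \bigcap_j (X j @^-1` B j) = E' `&` X i @^-1` B i.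
  apply/seteqP; split => w; first by move=> [Ew Hw]; split; [split => // j _; exact: Hw|exact: Hw].
  move=> [[Ew Hw] Bw]; split => // j _; have [->//|ji] := eqVneq j i; exact: Hw.
rewrite (prob_nat_split (X i))//; apply: eq_eseriesr => k _; case: ifP => // _; congr (P _).
apply/seteqP; split => w.
  move=> [[Ew Hw] /= Xk]; split => // j _; rewrite /upd; case: eqP => [->//|/eqP ji].
  exact: Hw.
move=> [Ew Hw]; split; last by have := Hw i I; rewrite /upd eqxx.
by split => // j ji; have := Hw j I; rewrite /upd (negbTE ji).
Qed.

Lemma lift_indep (E : set T) : measurable E ->
  (forall k : 'I_n -> nat, P (E `&` \bigcap_i (X i @^-1` [set (k i)%:R])) =
     P E * P (\bigcap_i (X i @^-1` [set (k i)%:R])))%E ->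
  forall B, (forall j, measurable (B j)) ->
  (P (E `&` \bigcap_i (X i @^-1` B i)) = P E * P (\bigcap_i (X i @^-1` B i)))%E.
Proof.
move=> mE H B mB.
apply: (@discrete_ext n (fun B => P (E `&` \bigcap_i (X i @^-1` B i)))
  (fun B => P E * P (\bigcap_i (X i @^-1` B i)))%E) => //.
- by move=> C i mC; exact: joint_additive.
- move=> C i mC.
  have := joint_additive setT C i measurableT mC; rewrite setTI => ->.
  have [p ->] : exists p, P E = p%:E.
    by exists (fine (P E)); rewrite fineK// fin_num_measure.
  rewrite -nneseriesZl//; last by move=> k _; case: ifP => _.
  by apply: eq_eseriesr => k _; case: ifP => _; rewrite ?mule0 ?setTI.
Qed.

Lemma lift_mutual_indep :
  (forall k : 'I_n -> nat, P (\bigcap_i (X i @^-1` [set (k i)%:R])) =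
     \prod_i P (X i @^-1` [set (k i)%:R]))%E ->
  mutual_indep_rv P X.
Proof.
move=> H B mB.
apply: (@discrete_ext n (fun B => P (\bigcap_i (X i @^-1` B i)))
  (fun B => \prod_i P (X i @^-1` B i))%E) => //.
- move=> C i mC; have := joint_additive setT C i measurableT mC; rewrite setTI => ->.
  by apply: eq_eseriesr => k _; rewrite setTI.
- move=> C i mC; rewrite (bigD1 i)//=.
  have := prob_nat_split (X i) setT (C i) (mX i) (natX i) measurableT; rewrite setTI => ->.
  have [p pE] : exists p, (\prod_(j < n | j != i) P (X j @^-1` C j) = p%:E)%E.
    exists (\prod_(j < n | j != i) fine (P (X j @^-1` C j))); rewrite -prodEFin.
    by apply: eq_bigr => j _; rewrite fineK// fin_num_measure//; exact: mXB.
  rewrite pE muleC -nneseriesZl; last by move=> k _; case: ifP => _.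
  apply: eq_eseriesr => k _; case: ifP => _; last by rewrite mule0.
  rewrite [RHS](bigD1 i)//= setTI muleC /upd eqxx; congr (_ * _)%E.
  by rewrite -pE; apply: eq_bigr => j /negbTE ->.
Qed.

End family.
End discrete_lifting.

(** * Almost sure properties *)

Section intensity.
Context {R : realType}.

Lemma intensity_setX (A B : set R) : measurable A -> measurable B ->
  (intensity (A `*` B) = lebesgue_measure (A `&` `[0%R, +oo[%classic) *
    lebesgue_measure (B `&` `[0%R, +oo[%classic))%E.
Proof.
move=> mA mB; rewrite /intensity -setXI product_measure1E//;
  by apply: measurableI => //; exact: measurable_itv.
Qed.

Lemma lebesgue_nneg_itv (b0 b1 : bool) (u v : R) : 0 <= u -> u <= v ->
  lebesgue_measure ([set` Interval (BSide b0 u) (BSide b1 v)] `&` `[0%R, +oo[%classic) = (v - u)%:E.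
Proof.
move=> u0 uv; rewrite setIidl; last first.
  move=> x; rewrite /= !in_itv/= andbT => /andP[+ _].
  by case: b0 => /= ux; apply: (le_trans u0) => //; exact: ltW.
rewrite lebesgue_measure_itv /= lte_fin; case: ltP => // vu.
by rewrite (le_anti (introT andP (conj uv vu))) subrr.
Qed.

Lemma intensity_rect (b0 b1 b2 b3 : bool) (u v x y : R) : 0 <= u -> u <= v -> 0 <= x -> x <= y ->
  intensity ([set` Interval (BSide b0 u) (BSide b1 v)] `*` [set` Interval (BSide b2 x) (BSide b3 y)])
  = ((v - u) * (y - x))%:E.
Proof. by move=> *; rewrite intensity_setX ?lebesgue_nneg_itv//; exact: measurable_itv. Qed.

Lemma intensity_le (A B : set (R * R)) : measurable A -> measurable B -> A `<=` B ->
  (intensity A <= intensity B)%E.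
Proof.
move=> mA mB AB.
have mQ : measurable (`[0%R, +oo[%classic `*` `[0%R, +oo[%classic : set (R * R)).
  by apply: measurableX; exact: measurable_itv.
by apply: le_measure; rewrite ?inE; [exact: measurableI|exact: measurableI|exact: setSI].
Qed.

Lemma intensity_box n : intensity (@box R n) = (n%:R * n%:R)%:E.
Proof. by rewrite /box intensity_rect// !subr0. Qed.

Lemma intensity_box_fin n (A : set (R * R)) : measurable A -> A `<=` box n ->
  (intensity A < +oo)%E.
Proof.
move=> mA /(intensity_le _ _ mA (measurable_box n)); rewrite intensity_box => /le_lt_trans; apply.
exact: ltry.
Qed.

End intensity.

Section ae_properties.
Context {R : realType} {d : measure_display} {T : measurableType d}.
Variable P : probability T R.
Variables (N : nat) (Nm : 'I_N -> T -> {measure set (R * R) -> \bar R}).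
Hypothesis PRM : forall b, is_PRM P (Nm b).
Hypothesis indep : mutual_indep_pi P (fun b => rm_events (Nm b)).

Lemma ae_vanish (F : nat -> set T) (K : R) : (forall n, measurable (F n)) ->
  (forall n, P (F n) <= (K / n.+1%:R)%:E)%E -> {ae P, forall w, exists n, ~ F n w}.
Proof.
move=> mF PF; exists (\bigcap_n F n); split.
- exact: bigcapT_measurable.
- apply/eqP; rewrite eq_le measure_ge0 andbT; apply/lee_addgt0Pr => e e0; rewrite add0e.
  have [n nP] : exists n : nat, K / n.+1%:R <= e.
    exists (Num.truncn (K / e)); rewrite ler_pdivrMr// mulrC -ler_pdivrMr//.
    exact/ltW/truncnS_gt.
  apply: (@le_trans _ _ (P (F n))); last by rewrite (le_trans (PF n))// lee_fin.
  apply: le_measure; rewrite ?inE//; first exact: bigcapT_measurable.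
  by move=> w; apply.
- move=> w /= H n _; apply/not_notP => nF; apply: H; by exists n.
Qed.

Lemma sum_law1 (s : seq 'I_N) (C : set (R * R)) k : uniq s -> measurable C ->
  (intensity C < +oo)%E ->
  P [set w | (\sum_(b <- s) Nm b w C)%E = k%:R%:E] =
  (poisson_w ((size s)%:R * fine (intensity C)) k)%:E.
Proof.
move=> us mC fC.
have := sum_event_law P N Nm PRM indep 1 (fun _ => C) (fun _ => mC) (fun _ => fC) _ s (fun=> k) us.
rewrite big_ord1 => <-; last by move=> i j; rewrite !ord1.
by congr (P _); apply/seteqP; split => w; [move=> H i|move=> /(_ ord0)].
Qed.

Lemma prob_double (s : seq 'I_N) (C : set (R * R)) (m : R) : uniq s -> measurable C ->
  intensity C = m%:E ->
  (P [set w | (1 < \sum_(b <- s) Nm b w C)%E] <= (((size s)%:R * m) ^+ 2)%:E)%E.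
Proof.
move=> us mC iC.
have fC : (intensity C < +oo)%E by rewrite iC ltry.
have m0 : 0 <= m by rewrite -lee_fin -iC; exact: intensity_ge0.
have mS := measurable_sum_Nm P N Nm PRM s C mC.
have mE (B : set (\bar R)) : measurable B -> measurable [set w | B (\sum_(b <- s) Nm b w C)%E].
  by move=> mB; rewrite -[X in measurable X]setTI; exact: mS.
have mk k : measurable [set w | (\sum_(b <- s) Nm b w C)%E = k%:R%:E].
  exact: (mE [set k%:R%:E]).
have mle : measurable [set w | (\sum_(b <- s) Nm b w C <= 1)%E].
  by have := mE _ (emeasurable_itv `]-oo, 1%E]); under eq_set do rewrite /= in_itv/=.
rewrite (_ : [set w | _] = ~` [set w | (\sum_(b <- s) Nm b w C <= 1)%E]); last first.
  by apply/seteqP; split => w /=; rewrite ltNge => /negP.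
rewrite probability_setC//.
have : (P [set w | (\sum_(b <- s) Nm b w C)%E = 0%:R%:E] +
        P [set w | (\sum_(b <- s) Nm b w C)%E = 1%:R%:E] <=
        P [set w | \sum_(b <- s) Nm b w C <= 1])%E.
  rewrite -measureU//; last first.
    by rewrite -subset0 => w [/= -> [/eqP]]; rewrite eqr_nat.
  apply: le_measure; rewrite ?inE//; first exact: measurableU.
  by move=> w [|] /= ->; rewrite ?lee_fin.
rewrite !sum_law1// iC /=.
have [p ->] : exists p, P [set w | (\sum_(b <- s) Nm b w C <= 1)%E] = p%:E.
  by eexists; rewrite -[LHS]fineK// fin_num_measure.
move=> le; have {}le : poisson_w ((size s)%:R * m) 0 + poisson_w ((size s)%:R * m) 1 <= p.
  by rewrite -lee_fin EFinD.
rewrite -EFinB lee_fin.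
apply: le_trans (poisson_w_le2 _ (mulr_ge0 (ler0n _ _) m0)).
lra.
Qed.

(** The probability that some of the [m + 1] cells has two points is at most
    [(m + 1) (size s * x / (m + 1))^2], which tends to [0]. *)
Lemma ae_no_double (s : seq 'I_N) (C : nat -> nat -> set (R * R)) (x : R) : uniq s ->
  (forall m i, measurable (C m i)) ->
  (forall m i, intensity (C m i) = (x / m.+1%:R)%:E) ->
  {ae P, forall w, exists m, forall i, (i < m.+1)%N -> (\sum_(b <- s) Nm b w (C m i) <= 1)%E}.
Proof.
move=> us mC iC.
pose F m := \big[setU/set0]_(i < m.+1) [set w | (1 < \sum_(b <- s) Nm b w (C m i))%E].
have mF' m i : measurable [set w | (1 < \sum_(b <- s) Nm b w (C m i))%E].
  have := measurable_sum_Nm P N Nm PRM s (C m i) (mC m i) measurableT _ (emeasurable_itv `]1%E, +oo[).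
  by rewrite setTI; congr (measurable _); apply/seteqP; split => w /=; rewrite in_itv/= andbT.
have mF m : measurable (F m) by apply: bigsetU_measurable => i _; exact: mF'.
have PF m : (P (F m) <= (((size s)%:R * x) ^+ 2 / m.+1%:R)%:E)%E.
  apply: (le_trans (Boole_inequality P (fun i _ => mF' m i))).
  apply: (@le_trans _ _ (\sum_(i < m.+1) (((size s)%:R * (x / m.+1%:R)) ^+ 2)%:E)%E).
    by apply: lee_sum => i _; exact: prob_double.
  rewrite sumEFin lee_fin sumr_const card_ord -mulr_natr le_eqVlt; apply/orP; left.
  by apply/eqP; field; rewrite addrC natr1 pnatr_eq0.
have := ae_vanish F _ mF PF; apply: filterS => w [m nF].
exists m => i im; rewrite leNgt; apply/negP => lt; apply: nF.
by rewrite /F -(bigcup_mkord m.+1 (fun i => [set w | (1 < \sum_(b <- s) Nm b w (C m i))%E])); exists i.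
Qed.

Lemma ae_null b (C : set (R * R)) : measurable C -> intensity C = 0%E ->
  {ae P, forall w, Nm b w C = 0%E}.
Proof.
move=> mC iC; have := sum_law1 [:: b] C 0 isT mC; rewrite iC mulr0 poisson_w0 => /(_ (ltry 0)) law.
apply: (ae_prob1 P [set w | Nm b w C = 0%E]).
  exact: (measurable_Nm_pre P N Nm PRM b C [set 0%E]).
by rewrite -law; congr (P _); apply/seteqP; split => w /=; rewrite big_seq1.
Qed.

Lemma ae_isnat_box : {ae P, forall w, forall b n A, measurable A -> A `<=` box n -> isnat (Nm b w A)}.
Proof.
suff : {ae P, forall w, forall b n (p r : option rat), isnat (Nm b w (box n `&` (ray p `*` ray r)))}.
  by apply: filterS => w H b n A mA Ab; apply: (isnat_box (Nm b w) n) => //; exact: H.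
have mC n (p r : option rat) : measurable (@box R n `&` (ray p `*` ray r)).
  by apply: measurableI; [exact: measurable_box|apply: measurableX; exact: measurable_ray].
apply: filter_forall => b; apply: ae_foralln => n.
have ae_rat (Q : option rat -> T -> Prop) :
    (forall p, {ae P, forall w, Q p w}) -> {ae P, forall w, forall p, Q p w}.
  move=> H; pose F k w := if (unpickle k : option (option rat)) is Some p then Q p w else True.
  have : {ae P, forall w, forall k, F k w}.
    apply: ae_foralln => k; rewrite /F; case: unpickle => [p|]; first exact: H.
    exact: filterT.
  by apply: filterS => w Hw p; have := Hw (pickle p); rewrite /F pickleK.
apply: (ae_rat _) => p; apply: (ae_rat _) => r.
apply: (ae_isnat P N Nm PRM b _ (mC n p r)).
by apply: (intensity_box_fin n) => //; exact: subIsetl.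
Qed.

(** Two atoms of any actors at the same time would, for large [n] and every [m], lie in a common
    cell [C n m i]. *)
Lemma ae_simple_time : {ae P, forall w, forall q : R, 0 < q ->
  (\sum_b Nm b w ([set q] `*` `[0%R, +oo[%classic) <= 1)%E}.
Proof.
pose C n m i : set (R * R) :=
  `[i%:R * (n%:R / m.+1%:R), i.+1%:R * (n%:R / m.+1%:R)]%classic `*` `[0%R, n%:R]%classic.
have mC n m i : measurable (C n m i) by apply: measurableX; exact: measurable_itv.
have iC n m i : intensity (C n m i) = ((n%:R * n%:R) / m.+1%:R)%:E.
  rewrite /C intensity_rect ?mulr_ge0 ?divr_ge0//; last first.
    by rewrite ler_wpM2r ?divr_ge0// ler_nat.
  by rewrite subr0 -mulrBl -natrB// subSnn mul1r mulrAC.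
have : {ae P, forall w, forall n, exists m, forall i, (i < m.+1)%N ->
    (\sum_(b <- index_enum 'I_N) Nm b w (C n m i) <= 1)%E}.
  apply: ae_foralln => n; apply: ae_no_double; [exact: index_enum_uniq|exact: mC|exact: iC].
apply: filterS => w H q q0.
have Hn n : q <= n%:R -> (\sum_b Nm b w ([set q] `*` `[0%R, n%:R]%classic) <= 1)%E.
  move=> qn; have [m Hm] := H n.
  have n0 : (0 : R) < n%:R by exact: lt_le_trans qn.
  have e0 : 0 < (n%:R : R) / m.+1%:R by rewrite divr_gt0.
  pose i := (Num.truncn (q / (n%:R / m.+1%:R))).
  have /andP[iq qi] : i%:R <= q / (n%:R / m.+1%:R) < i.+1%:R.
    by apply: truncn_itv; rewrite divr_ge0// ltW.
  have me : m.+1%:R * (n%:R / m.+1%:R) = n%:R :> R by rewrite mulrC divfK ?pnatr_eq0.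
  rewrite ler_pdivlMr// in iq; rewrite ltr_pdivrMr// in qi.
  (* For [q = n] the index is [i = m + 1], one too many; the last cell, being closed, contains that
     time. *)
  have im : (minn i m < m.+1)%N by rewrite ltnS geq_minr.
  apply: le_trans (Hm _ im); apply: lee_sum => b _; apply: le_measure; rewrite ?inE//.
    by apply: measurableX => //; exact: measurable_itv.
  move=> z [/= zq z2]; split => //=; rewrite in_itv/= zq; apply/andP; split.
    by rewrite (le_trans _ iq)// ler_wpM2r ?(ltW e0)// ler_nat geq_minl.
  by rewrite /minn; case: ifP => _; [exact: ltW|rewrite me].
have cv : (\sum_b Nm b w ([set q] `*` `[0%R, n%:R]%classic))%E @[n --> \oo] -->
    (\sum_b Nm b w ([set q] `*` `[0%R, +oo[%classic))%E.
  apply: cvg_nnesum => b _; first by apply: nearW => n; exact: measure_ge0.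
  have -> : ([set q] `*` `[0%R, +oo[%classic : set (R * R)) =
      \bigcup_n ([set q] `*` `[0%R, n%:R]%classic).
    rewrite eqEsubset; split => z /=.
      rewrite in_itv/= andbT => -[zq z0]; exists (Num.truncn z.2).+1 => //; split => //=.
      by rewrite in_itv/= z0 ltW// truncnS_gt.
    by move=> [n _ [/= zq]]; rewrite !in_itv/= => /andP[->].
  have mR n : measurable ([set q] `*` `[0%R, n%:R]%classic : set (R * R)).
    by apply: measurableX => //; exact: measurable_itv.
  apply: nondecreasing_cvg_mu => //; first exact: bigcup_measurable.
  apply/nondecreasing_seqP => n; apply/subsetPset => z [/= zq]; rewrite in_itv/= => /andP[z0 z2].
  by split => //=; rewrite in_itv/= z0 (le_trans z2)// ler_nat.
apply: cvge_le cv.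
exists (Num.truncn q).+1 => // n /= qn; apply: Hn.
by rewrite (le_trans (ltW (truncnS_gt q)))// ler_nat.
Qed.

End ae_properties.

Section ae_properties_height.
Context {R : realType} {d : measure_display} {T : measurableType d}.
Variable P : probability T R.
Variables (N : nat) (Nm : 'I_N -> T -> {measure set (R * R) -> \bar R}).
Hypothesis PRM : forall b, is_PRM P (Nm b).
Hypothesis indep : mutual_indep_pi P (fun b => rm_events (Nm b)).

Lemma ae_simple_height a : {ae P, forall w, forall n (z : R), 0 <= z -> z <= n%:R ->
  (Nm a w (`[0%R, n%:R]%classic `*` [set z]) <= 1)%E}.
Proof.
pose C n m i : set (R * R) :=
  `[0%R, n%:R]%classic `*` `[i%:R * (n%:R / m.+1%:R), i.+1%:R * (n%:R / m.+1%:R)]%classic.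
have mC n m i : measurable (C n m i) by apply: measurableX; exact: measurable_itv.
have iC n m i : intensity (C n m i) = ((n%:R * n%:R) / m.+1%:R)%:E.
  rewrite /C intensity_rect ?mulr_ge0 ?divr_ge0//; last first.
    by rewrite ler_wpM2r ?divr_ge0// ler_nat.
  by rewrite subr0 -mulrBl -natrB// subSnn mul1r mulrA.
have : {ae P, forall w, forall n, exists m, forall i, (i < m.+1)%N ->
    (\sum_(b <- [:: a]) Nm b w (C n m i) <= 1)%E}.
  apply: ae_foralln => n; apply: (ae_no_double P N Nm PRM indep [:: a]) => //; exact: iC.
apply: filterS => w H n q q0 qn.
have [m Hm] := H n.
have [n0|n0] := eqVneq n 0%N.
  apply: le_trans (Hm 0%N isT); rewrite big_seq1; apply: le_measure; rewrite ?inE//.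
    by apply: measurableX => //; exact: measurable_itv.
  by move=> z [z1 /= zq]; split => //=; rewrite in_itv/= zq mul0r q0/=; move: qn; rewrite n0 mulr0n mul0r mulr0.
have n0' : (0 : R) < n%:R by rewrite ltr0n lt0n.
have e0 : 0 < (n%:R : R) / m.+1%:R by rewrite divr_gt0.
pose i := (Num.truncn (q / (n%:R / m.+1%:R))).
have /andP[iq qi] : i%:R <= q / (n%:R / m.+1%:R) < i.+1%:R.
  by apply: truncn_itv; rewrite divr_ge0// ltW.
have me : m.+1%:R * (n%:R / m.+1%:R) = n%:R :> R by rewrite mulrC divfK ?pnatr_eq0.
rewrite ler_pdivlMr// in iq; rewrite ltr_pdivrMr// in qi.
have im : (minn i m < m.+1)%N by rewrite ltnS geq_minr.
apply: le_trans (Hm _ im); rewrite big_seq1; apply: le_measure; rewrite ?inE//.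
  by apply: measurableX => //; exact: measurable_itv.
move=> z [z1 /= zq]; split => //=; rewrite in_itv/= zq; apply/andP; split.
  by rewrite (le_trans _ iq)// ler_wpM2r ?(ltW e0)// ler_nat geq_minl.
by rewrite /minn; case: ifP => _; [exact: ltW|rewrite me].
Qed.

Lemma ae_atom a (s t : R) : 0 <= s -> s < t ->
  {ae P, forall w, exists n, (1 <= Nm a w (`[s, t]%classic `*` `[0%R, n%:R]%classic))%E}.
Proof.
move=> s0 st.
pose C n : set (R * R) := `[s, t]%classic `*` `[0%R, n.+1%:R]%classic.
have mC n : measurable (C n) by apply: measurableX; exact: measurable_itv.
have iC n : intensity (C n) = ((t - s) * n.+1%:R)%:E by rewrite intensity_rect ?(ltW st)// subr0.
have fC n : (intensity (C n) < +oo)%E by rewrite iC ltry.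
have mF n : measurable [set w | (Nm a w (C n) < 1)%E].
  have := measurable_Nm_pre P N Nm PRM a (C n) _ (mC n) (emeasurable_itv `]-oo, 1%E[).
  by congr (measurable _); apply/seteqP; split => w /=; rewrite in_itv/=.
have PF n : (P [set w | (Nm a w (C n) < 1)%E] <= (1 / (t - s) / n.+1%:R)%:E)%E.
  rewrite (prob_ae_eq P [set w | isnat (Nm a w (C n))] _ [set w | Nm a w (C n) = 0%:R%:E]) //.
  - have [_ [-> // _]] := PRM a; rewrite iC /= lee_fin /poisson_w expr0 (_ : 0`! = 1%N)// divr1 mul1r.
    have -> : 1 / (t - s) / n.+1%:R = ((t - s) * n.+1%:R)^-1 by rewrite invfM div1r.
    (* The void probability [expR (- x)] is at most [1 / x], because [x <= 1 + x <= expR x]. *)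
    rewrite expRN lef_pV2 ?posrE ?mulr_gt0 ?subr_gt0 ?expR_gt0//.
    by apply: le_trans (expR_ge1Dx _); rewrite lerDr.
  - exact: ae_isnat.
  - exact: (measurable_Nm_pre P N Nm PRM a (C n) [set 0%:R%:E]).
  - move=> w [k kE]; rewrite /= kE lte_fin; split; last by move=> [->].
    by rewrite (ltr_nat R k 1) ltnS leqn0 => /eqP ->.
have := ae_vanish P _ _ mF PF; apply: filterS => w [n nF]; exists n.+1.
by rewrite leNgt; apply/negP.
Qed.

End ae_properties_height.

(** * The lowest atom of a point measure over a time interval *)

Section first_atom.
Context {R : realType}.

Lemma null_below (nu : {measure set (R * R) -> \bar R}) (D : set (R * R)) (g : R * R -> R) (e : R) :
  measurable D -> measurable_fun setT g ->
  (forall r, r < e -> nu (D `&` [set x | g x <= r]) = 0%E) ->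
  nu (D `&` [set x | g x < e]) = 0%E.
Proof.
move=> mD mg H.
have mle r : measurable (D `&` [set x | g x <= r]).
  apply: measurableI => //.
  rewrite (_ : [set x | _] = g @^-1` `]-oo, r]%classic).
    by rewrite -[X in measurable X]setTI; exact: mg.
  by apply/seteqP; split => x; rewrite /= in_itv.
have -> : D `&` [set x | g x < e] = \bigcup_n (D `&` [set x | g x <= e - n.+1%:R^-1]).
  apply/seteqP; split => x.
    move=> [Dx /= ge]; have e0 : 0 < e - g x by rewrite subr_gt0.
    have [n _ /(_ n (leqnn _))/= ltn] := near_infty_natSinv_lt (PosNum e0).
    by exists n => //; split => //=; rewrite lerBrDl -lerBrDr ltW.
  move=> [n _ [Dx /= ge]]; split => //=; apply: (le_lt_trans ge).
  by rewrite ltrBlDr ltrDl invr_gt0.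
apply/negligibleP; first exact: bigcup_measurable.
apply: negligible_bigcup => n; apply: (iffRL (negligibleP _ (mle _))).
by apply: H; rewrite ltrBlDr ltrDl invr_gt0.
Qed.

Lemma measurable_point (x y : R) : measurable [set (x, y)].
Proof.
rewrite (_ : [set _] = [set x] `*` [set y]).
  by apply: measurableX; exact: measurable_set1.
by apply/seteqP; split => -[u v] /= [-> ->].
Qed.

(** A measure could spread its mass along the line; integrality excludes this: the count along the
    line first becomes positive at some [q], and the jump sits at the point [(q, e)]. *)
Lemma atom_on_line (nu : {measure set (R * R) -> \bar R}) (s t e : R) : s <= t ->
  (forall A, measurable A -> isnat (nu ((`[s, t]%classic `*` [set e]) `&` A))) ->
  (1 <= nu (`[s, t]%classic `*` [set e]))%E ->
  exists2 u, s <= u <= t & (1 <= nu [set (u, e)])%E.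
Proof.
move=> st nat1 ge1.
set L := `[s, t]%classic `*` [set e] in nat1 ge1 *.
have mL : measurable L by apply: measurableX; [exact: measurable_itv|exact: measurable_set1].
pose c := cnt nu L.
have cs : c (s - 1) = 0%N.
  apply/eqP; rewrite -(eqr_nat R); apply/eqP; apply: EFin_inj; rewrite cntE//.
  rewrite (_ : _ `&` _ = set0) ?measure0// -subset0 => -[x y] [[/= + _]]; rewrite /upto /= in_itv/=.
  by move=> /andP[sx _] xs; lra.
have ct : (1 <= c t)%N.
  rewrite -(ler_nat R) -lee_fin cntE// (_ : _ `&` _ = L)//.
  by apply/setIidl => -[x y] [/= + _]; rewrite in_itv/= => /andP[].
have [q [sq qt cq ltq]] := first_hit c (s - 1) t 1 (cnt_homo _ _ mL nat1)
  (cnt_right_step _ _ mL nat1) ltac:(by rewrite cs) ct.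
have null : nu (L `&` [set x | x.1 < q]) = 0%E.
  apply: null_below => // r /ltq; rewrite ltnS leqn0 => /eqP cr.
  by have := cntE _ _ nat1 r; rewrite -/(c r) cr => <-.
have mlt : measurable (L `&` [set x | x.1 < q]).
  apply: measurableI => //; rewrite (_ : [set x | _] = fst @^-1` `]-oo, q[%classic).
    by rewrite -[X in measurable X]setTI; exact: measurable_fst.
  by apply/seteqP; split => x; rewrite /= in_itv.
have ptE : (1 <= nu (L `&` [set (q, e)]))%E.
  rewrite -(measureU0 _ mlt null); last by apply: measurableI => //; exact: measurable_point.
  apply: (@le_trans _ _ (nu (L `&` upto q))); first by rewrite -cntE// lee_fin ler1n.
  apply: le_measure; rewrite ?inE.
  - by apply: measurableI => //; exact: measurable_upto.
  - by apply: measurableU => //; apply: measurableI => //; exact: measurable_point.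
  - move=> -[x y] [Lx]; rewrite /upto /= le_eqVlt => /orP[/eqP xq|xq]; last by right.
    by left; split => //; case: Lx => /= _ ->; rewrite xq.
exists q.
  have [L0|/set0P[[x y] [[/= + _] [<- _]]]] := eqVneq (L `&` [set (q, e)]) set0; last by rewrite in_itv.
  by move: ptE; rewrite L0 measure0 lee_fin ler10.
apply: (le_trans ptE); apply: le_measure; rewrite ?inE//.
- by apply: measurableI => //; exact: measurable_point.
- exact: measurable_point.
Qed.

Variables (d : measure_display) (T : measurableType d) (Nm : T -> {measure set (R * R) -> \bar R}) (s t : R) (w : T).
Hypotheses (s_ge0 : 0 <= s) (st : s <= t).
Hypothesis nat_box : forall n A, measurable A -> A `<=` box n -> isnat (Nm w A).
Hypothesis null0 : forall n, Nm w (`[0%R, n%:R]%classic `*` [set 0%R]) = 0%E.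
Hypothesis simple : forall n (z : R), 0 <= z -> z <= n%:R ->
  (Nm w (`[0%R, n%:R]%classic `*` [set z]) <= 1)%E.

Definition rect (r : R) : set (R * R) := `[s, t]%classic `*` `[0%R, r]%classic.

Lemma measurable_rect r : measurable (rect r).
Proof. by apply: measurableX; exact: measurable_itv. Qed.

Lemma box_large (x y : R) : exists n, x <= n%:R /\ y <= n%:R.
Proof.
exists (maxn (Num.truncn x) (Num.truncn y)).+1.
by split; apply: (le_trans (ltW (truncnS_gt _))); rewrite ler_nat ltnS ?leq_maxl ?leq_maxr.
Qed.

Lemma isnat_rect r A : measurable A -> A `<=` rect r -> isnat (Nm w A).
Proof.
move=> mA Ar; have [n [tn rn]] := box_large t r.
apply: (nat_box n) => // x /Ar[/=]; rewrite !in_itv/= => /andP[sx xt] /andP[x0 xr].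
by split; rewrite /= in_itv/= ?(le_trans s_ge0 sx) ?(le_trans xt tn) ?x0 ?(le_trans xr rn).
Qed.

Lemma rect_homo r r' : r <= r' -> (Nm w (rect r) <= Nm w (rect r'))%E.
Proof.
move=> rr; apply: le_measure; rewrite ?inE; try exact: measurable_rect.
move=> x [x1 x2]; split => //; move: x2; rewrite /= !in_itv/= => /andP[-> /= x2].
exact: le_trans rr.
Qed.

Lemma rect_lt1 r : (Nm w (rect r) < 1)%E -> Nm w (rect r) = 0%E.
Proof.
have [k ->] := isnat_rect r _ (measurable_rect r) (@subset_refl _ _).
by rewrite lte_fin (ltr_nat R k 1) ltnS leqn0 => /eqP ->.
Qed.

(** The infimum is attained by continuity from above along [rect (inf S + 1/(n+1))], and it is
    positive because the line of height [0] has mass [0]. *)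
Lemma EhitP : (exists n, 1 <= Nm w (rect n%:R))%E ->
  exists e : R, [/\ Ehit Nm s t w = e%:E, 0 < e,
    (forall r, r < e -> Nm w (rect r) = 0%E) & (1 <= Nm w (rect e))%E].
Proof.
move=> [n0 hn0].
pose S := [set r : R | 0 < r /\ (1 <= Nm w (rect r))%E].
have Slb : has_lbound S by exists 0 => r [/ltW].
have S0 : S !=set0.
  exists n0.+1%:R; split => //; apply: (le_trans hn0); apply: rect_homo.
  by rewrite ler_nat.
have infS : has_inf S by split.
have EE : Ehit Nm s t w = (inf S)%:E by rewrite /Ehit -ereal_inf_EFin.
have below r : r < inf S -> Nm w (rect r) = 0%E.
  move=> rS; have [r0|r0] := ltP 0 r.
    apply: rect_lt1; rewrite ltNge; apply/negP => h1.
    by have := ge_inf Slb (conj r0 h1 : S r); rewrite leNgt rS.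
  (* For [r <= 0], which [S] excludes, the rectangle is empty or lies on the null line of height
     [0]. *)
  have [n [tn _]] := box_large t 0.
  apply/eqP; rewrite eq_le measure_ge0 andbT -(null0 n); apply: le_measure; rewrite ?inE.
  - exact: measurable_rect.
  - by apply: measurableX; [exact: measurable_itv|exact: measurable_set1].
  - move=> x [] /=; rewrite !in_itv/= => /andP[sx xt] /andP[x0 xr]; split => /=.
      by rewrite ?in_itv/= (le_trans s_ge0 sx) (le_trans xt).
    by apply/eqP; rewrite eq_le x0 (le_trans xr).
pose F n := rect (inf S + n.+1%:R^-1).
have F1 n : (1 <= Nm w (F n))%E.
  have [|r [r0 rS] lt] := @inf_adherent _ S n.+1%:R^-1 _ infS; first by rewrite invr_gt0.
  by apply: (le_trans rS); apply: rect_homo; exact: ltW.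
have FE : \bigcap_n F n = rect (inf S).
  apply/seteqP; split => x.
    move=> H; have [/= x1 x2] := H 0%N I; split => //; move: x2; rewrite /= !in_itv/= => /andP[-> _]/=.
    rewrite leNgt; apply/negP => lt; have e0 : 0 < x.2 - inf S by rewrite subr_gt0.
    have [n _ /(_ n (leqnn _))/= ltn] := near_infty_natSinv_lt (PosNum e0).
    have [_ /=] := H n I; rewrite in_itv/= => /andP[_]; rewrite -lerBlDl leNgt.
    by rewrite ltn.
  move=> [x1 x2] n _; split => //; move: x2; rewrite /= !in_itv/= => /andP[-> /= le].
  by rewrite (le_trans le)// lerDl invr_ge0.
have cv : (Nm w \o F) n @[n --> \oo] --> Nm w (rect (inf S)).
  rewrite -FE; apply: nonincreasing_cvg_mu.
  - have [k ->] := isnat_rect _ _ (measurable_rect (inf S + 1%:R^-1)) (@subset_refl _ _).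
    by rewrite ltry.
  - by move=> n; exact: measurable_rect.
  - by rewrite FE; exact: measurable_rect.
  - apply/nonincreasing_seqP => n; apply/subsetPset => x [x1 x2]; split => //.
    move: x2; rewrite /= !in_itv/= => /andP[-> /= le]; apply: (le_trans le).
    by rewrite lerD2l lef_pV2 ?posrE// ler_nat.
have at1 : (1 <= Nm w (rect (inf S)))%E.
  by apply: cvge_ge cv; apply: nearW.
have pos : 0 < inf S.
  rewrite lt_neqAle lb_le_inf// ?andbT; last by move=> r [/ltW].
  apply/eqP => S0'; have [n [tn _]] := box_large t 0.
  have : (1 <= Nm w (`[0%R, n%:R]%classic `*` [set 0%R]))%E.
    apply: (le_trans at1); apply: le_measure; rewrite ?inE.
    - exact: measurable_rect.
    - by apply: measurableX; [exact: measurable_itv|exact: measurable_set1].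
    - move=> x [] /=; rewrite -S0' !in_itv/= => /andP[sx xt] /andP[x0 xr]; split => /=.
        by rewrite ?in_itv/= (le_trans s_ge0 sx) (le_trans xt).
      by apply/eqP; rewrite eq_le x0 xr.
  by rewrite null0 lee_fin ler10.
by exists (inf S).
Qed.

Lemma rect_line e : 0 < e -> (forall r, r < e -> Nm w (rect r) = 0%E) ->
  Nm w (rect e) = Nm w (`[s, t]%classic `*` [set e]).
Proof.
move=> e0 below.
have sub : `[s, t]%classic `*` [set e] `<=` rect e.
  by move=> x [x1 /= x2]; split => //=; rewrite in_itv/= x2 lexx ltW.
have mL : measurable (`[s, t]%classic `*` [set e] : set (R * R)).
  by apply: measurableX; [exact: measurable_itv|exact: measurable_set1].
pose D := rect e.
have null : Nm w (D `&` [set x | x.2 < e]) = 0%E.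
  apply: null_below; [exact: measurable_rect|exact: measurable_snd|].
  move=> r re; apply/eqP; rewrite eq_le measure_ge0 andbT -(below r re).
  apply: le_measure; rewrite ?inE; last 1 first.
  - by move=> x [[x1 +] /= xr]; rewrite /= in_itv/= => /andP[x0 _]; split => //=; rewrite in_itv/= x0.
  - apply: measurableI; first exact: measurable_rect.
    rewrite (_ : [set x | _] = snd @^-1` `]-oo, r]%classic).
      by rewrite -[X in measurable X]setTI; exact: measurable_snd.
    by apply/seteqP; split => x; rewrite /= in_itv.
  - exact: measurable_rect.
have mlt : measurable (D `&` [set x | x.2 < e]).
  apply: measurableI; first exact: measurable_rect.
  rewrite (_ : [set x | _] = snd @^-1` `]-oo, e[%classic).
    by rewrite -[X in measurable X]setTI; exact: measurable_snd.
  by apply/seteqP; split => x; rewrite /= in_itv.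
rewrite -(measureU0 mL mlt null); congr (Nm w _); apply/seteqP; split; last first.
  by move=> x [/sub//|[]].
move=> x [x1 x2]; have := x2; rewrite /= in_itv/= => /andP[x0].
by rewrite le_eqVlt => /orP[/eqP xe|xe]; [left|right].
Qed.

Lemma first_atom_exists e : 0 < e -> (forall r, r < e -> Nm w (rect r) = 0%E) ->
  (1 <= Nm w (rect e))%E -> exists2 u, s <= u <= t & (1 <= Nm w [set (u, e)])%E.
Proof.
move=> e0 below at1; apply: atom_on_line => //; last by rewrite -rect_line.
move=> A mA; apply: (isnat_rect e).
  apply: measurableI => //; apply: measurableX; first exact: measurable_itv.
  exact: measurable_set1.
by move=> x [[x1 /= x2] _]; split => //=; rewrite in_itv/= x2 lexx ltW.
Qed.

(** Otherwise [A] and the point [(u, e)] would give [rect e] mass at least [2], while all its mass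
    lies on the line of height [e], where [simple] allows at most [1]. *)
Lemma first_atom_unique e (A : set (R * R)) u : 0 < e -> measurable A -> A `<=` rect e ->
  (forall r, r < e -> Nm w (rect r) = 0%E) ->
  (1 <= Nm w A)%E -> s <= u <= t -> (1 <= Nm w [set (u, e)])%E -> A (u, e).
Proof.
move=> e0 mA Ae below A1 ust u1; apply/not_notP => nA.
have mp := measurable_point u e.
have [n [tn en]] := box_large t e.
have le2 : (1 + 1 <= Nm w (rect e))%E.
  apply: (@le_trans _ _ (Nm w (A `|` [set (u, e)]))).
    rewrite measureU//; first exact: leeD.
    by rewrite -subset0 => x [Ax xE]; apply: nA; rewrite -xE.
  apply: le_measure; rewrite ?inE; [exact: measurableU|exact: measurable_rect|].
  by move=> x [/Ae//|->]; split; rewrite /= in_itv/= ?ust// lexx ltW.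
have : (Nm w (rect e) <= 1)%E.
  rewrite rect_line//; apply: le_trans (simple n e (ltW e0) en).
  apply: le_measure; rewrite ?inE.
  - by apply: measurableX; [exact: measurable_itv|exact: measurable_set1].
  - by apply: measurableX; [exact: measurable_itv|exact: measurable_set1].
  - move=> x [/= + ->]; rewrite in_itv/= => /andP[sx xt]; split => //=.
    by rewrite in_itv/= (le_trans s_ge0 sx) (le_trans xt tn).
by move=> /(le_trans le2); rewrite -EFinD lee_fin; lra.
Qed.

End first_atom.

(** * The counting process of the other actors *)

Section measurable_lt.
Context {R : realType} {d : measure_display} {T : measurableType d}.

Lemma measurable_fun_lt_real (f : T -> R) : (forall x, measurable [set w | f w < x]) ->
  measurable_fun setT f.
Proof.
move=> H; apply: (measurability _ (RGenInftyO.measurableE R)) => _ [_ [x ->] <-].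
by rewrite setTI; have := H x; congr (measurable _); apply/seteqP; split => w /=; rewrite in_itv.
Qed.

Lemma measurable_bigcup_rat (F : rat -> set T) : (forall q, measurable (F q)) ->
  measurable [set w | exists q, F q w].
Proof.
move=> mF; have := bigcupT_measurable_rat mF; congr (measurable _).
by apply/seteqP; split => w [q]; [move=> _; exists q|exists q].
Qed.

Lemma measurable_fun_lt_ereal (f : T -> \bar R) : (forall x : R, measurable [set w | (f w < x%:E)%E]) ->
  measurable_fun setT f.
Proof.
move=> H; apply: (measurability _ (ErealGenCInfty.measurableE R)) => _ [_ [x ->] <-].
rewrite setTI; have := measurableC (H x); congr (measurable _).
by apply/seteqP; split => w /=; rewrite in_itv/= andbT leNgt => /negP.
Qed.

End measurable_lt.

Section counting_process.
Context {R : realType} {d : measure_display} {T : measurableType d}.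
Variable P : probability T R.
Variables (N : nat) (Nm : 'I_N -> T -> {measure set (R * R) -> \bar R}).
Hypothesis PRM : forall b, is_PRM P (Nm b).
Hypothesis indep : mutual_indep_pi P (fun b => rm_events (Nm b)).
Variables (a : 'I_N) (t c : R) (G : set T).
Hypotheses (t_ge0 : 0 <= t) (c_ge0 : 0 <= c).
Hypotheses (mG : measurable G) (aeG : {ae P, forall w, G w}).
Hypothesis nat_box : forall w, G w -> forall b n A, measurable A -> A `<=` box n -> isnat (Nm b w A).
Hypothesis null_t : forall w, G w -> forall b n,
  Nm b w ([set t] `*` `[0%R, n%:R]%classic) = 0%E.

(* Time runs backwards from [t] to [0]; afterwards fresh time after [t] is used,
   so that the process is defined for all [r]. *)
Definition back_time (r : R) : set R :=
  (`[t - r, t]%classic `|` `]t, r]%classic) `&` `[0%R, +oo[%classic.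

Definition back_region (r : R) : set (R * R) := back_time r `*` `[0%R, c]%classic.

Definition others := [seq b <- index_enum 'I_N | b != a].

(** The factor [\1_G] makes the path properties hold for every outcome, as [is_poisson_process]
    demands. *)
Definition count_proc (r : R) (w : T) : R :=
  \1_G w * fine (\sum_(b <- others) Nm b w (back_region r))%E.

Lemma back_timeP r x : back_time r x <-> 0 <= x /\ (t - r <= x <= t \/ t < x <= r).
Proof. by rewrite /back_time /= !in_itv/= andbT; tauto. Qed.

Lemma measurable_back_time r : measurable (back_time r).
Proof.
by apply: measurableI; [apply: measurableU|]; exact: measurable_itv.
Qed.

Lemma measurable_back_region r : measurable (back_region r).
Proof. by apply: measurableX; [exact: measurable_back_time|exact: measurable_itv]. Qed.

Lemma back_region_homo r1 r2 : r1 <= r2 -> back_region r1 `<=` back_region r2.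
Proof.
move=> r12 x [/back_timeP[x0 H] x2]; split => //; apply/back_timeP; split => //.
case: H => /andP[h1 h2]; [left|right]; rewrite ?h1 ?h2 ?andbT/=; last exact: le_trans r12.
by rewrite (le_trans _ h1)// lerD2l lerN2.
Qed.

Lemma back_region_box r : exists n, back_region r `<=` box n.
Proof.
have [n [h1 h2]] := box_large (Num.max t r) c.
exists n => x [/back_timeP[x0 H]]; rewrite /= in_itv/= => /andP[z0 zc].
split; rewrite /= in_itv/= ?x0 ?z0 /=; last exact: le_trans h2.
apply: le_trans h1; rewrite le_max; case: H => /andP[_ ->]; by rewrite ?orbT.
Qed.

Lemma isnat_back w A r b : G w -> measurable A -> A `<=` back_region r -> isnat (Nm b w A).
Proof.
by move=> Gw mA Ar; have [n An] := back_region_box r; apply: (nat_box w Gw b n) => // x /Ar /An.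
Qed.

Lemma isnat_sum (I : Type) (s : seq I) (F : I -> \bar R) :
  (forall b, isnat (F b)) -> isnat (\sum_(b <- s) F b)%E.
Proof.
move=> H; elim: s => [|b s [k kE]]; first by exists 0%N; rewrite big_nil.
by have [j jE] := H b; exists (j + k)%N; rewrite big_cons kE jE natrD.
Qed.

Lemma count_procE w r : G w -> (count_proc r w)%:E = (\sum_(b <- others) Nm b w (back_region r))%E.
Proof.
move=> Gw; rewrite /count_proc indicE mem_set// mul1r fineK//; apply: isnat_fin_num.
by apply: isnat_sum => b; apply: (isnat_back w _ r) => //; exact: measurable_back_region.
Qed.

Lemma count_proc_off w r : ~ G w -> count_proc r w = 0.
Proof. by move=> nG; rewrite /count_proc indicE memNset// mul0r. Qed.

Lemma count_proc_nat w r : exists k : nat, count_proc r w = k%:R.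
Proof.
have [Gw|nG] := pselect (G w); last by exists 0%N; rewrite count_proc_off.
have [k kE] : isnat (\sum_(b <- others) Nm b w (back_region r))%E.
  by apply: isnat_sum => b; apply: (isnat_back w _ r) => //; exact: measurable_back_region.
by exists k; apply: EFin_inj; rewrite count_procE.
Qed.

Lemma count_proc_homo w r1 r2 : r1 <= r2 -> count_proc r1 w <= count_proc r2 w.
Proof.
move=> r12; have [Gw|nG] := pselect (G w); last by rewrite !count_proc_off.
rewrite -lee_fin !count_procE//; apply: lee_sum => b _; apply: le_measure; rewrite ?inE;
  [exact: measurable_back_region|exact: measurable_back_region|exact: back_region_homo].
Qed.

Lemma count_proc0 w : count_proc 0 w = 0.
Proof.
have [Gw|nG] := pselect (G w); last by rewrite count_proc_off.
apply: EFin_inj; rewrite count_procE// big1// => b _.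
have [n [_ cn]] := box_large 0 c.
apply/eqP; rewrite eq_le measure_ge0 andbT -(null_t w Gw b n); apply: le_measure; rewrite ?inE.
- exact: measurable_back_region.
- by apply: measurableX; [exact: measurable_set1|exact: measurable_itv].
- move=> x [/back_timeP[x0 H]]; rewrite /= !in_itv/= => /andP[z0 zc].
  split; last by rewrite /= ?in_itv/= z0 (le_trans zc).
  rewrite subr0 in H; case: H => /andP[h1 h2]; first by apply/eqP; rewrite eq_le h1 h2.
  by move: (lt_le_trans h1 h2); rewrite ltNge t_ge0.
Qed.

Lemma measurable_count_proc r : measurable_fun setT (count_proc r).
Proof.
apply: measurable_funM; first exact: measurable_indic.
apply: measurableT_comp => //.
by apply: (measurable_sum_Nm P N Nm PRM); exact: measurable_back_region.
Qed.

Lemma count_proc_right w r : exists2 r', r < r' & count_proc r' w = count_proc r w.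
Proof.
have [Gw|nG] := pselect (G w); last by exists (r + 1); rewrite ?ltrDl ?count_proc_off.
pose F n := back_region (r + n.+1%:R^-1).
have FE : \bigcap_n F n = back_region r.
  apply/seteqP; split => [x H|x H n _]; last first.
    by apply: back_region_homo H; rewrite lerDl invr_ge0.
  have [/back_timeP[x0 _] x2] := H 0%N I; split => //; apply/back_timeP; split => //.
  have small (e : R) : 0 < e -> exists n, n.+1%:R^-1 < e.
    by move=> e0; have [n _ /(_ n (leqnn _))] := near_infty_natSinv_lt (PosNum e0); exists n.
  have [xt|tx] := leP x.1 t; [left|right].
    rewrite andbT leNgt; apply/negP => lt.
    have [|n nP] := small (t - r - x.1); first by rewrite subr_gt0.
    have [/back_timeP[_ H'] _] := H n I; move: nP xt lt H'.
    move: (n.+1%:R^-1 : R) (x.1 : R) => e y nP xt lt [/andP[h1 h2]|/andP[h1 h2]]; lra.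
  rewrite /= leNgt; apply/negP => lt.
  have [|n nP] := small (x.1 - r); first by rewrite subr_gt0.
  have [/back_timeP[_ H'] _] := H n I; move: nP tx lt H'.
  move: (n.+1%:R^-1 : R) (x.1 : R) => e y nP tx lt [/andP[h1 h2]|/andP[h1 h2]]; lra.
have cv : (\sum_(b <- others) Nm b w (F n))%E @[n --> \oo] -->
    (\sum_(b <- others) Nm b w (back_region r))%E.
  apply: cvg_nnesum => b _; first by apply: nearW => n; exact: measure_ge0.
  rewrite -FE; apply: nonincreasing_cvg_mu.
  - by rewrite -ge0_fin_numE//; apply/isnat_fin_num/(isnat_back w _ (r + 1%:R^-1)) => //;
      exact: measurable_back_region.
  - by move=> n; exact: measurable_back_region.
  - by rewrite FE; exact: measurable_back_region.
  - apply/nonincreasing_seqP => n; apply/subsetPset; apply: back_region_homo.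
    by rewrite lerD2l lef_pV2 ?posrE// ler_nat.
have natS r' : isnat (\sum_(b <- others) Nm b w (back_region r'))%E.
  by apply: isnat_sum => b; apply: (isnat_back w _ r') => //; exact: measurable_back_region.
have [n0 /(_ _ (leqnn _)) n0P] := isnat_stationary _ _ (fun n => natS _) (isnat_fin_num _ (natS r)) cv.
exists (r + n0.+1%:R^-1); first by rewrite ltrDl invr_gt0.
by apply: EFin_inj; rewrite !count_procE.
Qed.

Lemma count_proc_cvg w r : count_proc x w @[x --> r^'+] --> count_proc r w.
Proof.
have [r' rr' E] := count_proc_right w r.
apply: cvg_near_cst; near=> x.
have rx : r <= x by near: x; apply: filterS (nbhs_right_gt r) => y; exact: ltW.
have xr : x <= r' by near: x; apply: filterS (nbhs_right_lt rr') => y; exact: ltW.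
by apply/eqP; rewrite eq_le (count_proc_homo w r x rx) andbT -E count_proc_homo.
Unshelve. all: by end_near. Qed.

Lemma lebesgue_back_time r : 0 <= r -> lebesgue_measure (back_time r `&` `[0%R, +oo[%classic) = r%:E.
Proof.
move=> r0; have [rt|tr] := leP r t.
  have -> : back_time r = [set` Interval (BSide true (t - r)) (BSide false t)].
    apply/seteqP; split => x.
      move=> /back_timeP[_ [|/andP[h1 h2]]]; rewrite /= in_itv//=.
      by have := lt_le_trans h1 h2; rewrite ltNge rt.
    rewrite /= in_itv/= => /andP[h1 h2]; apply/back_timeP; split; last by left; rewrite h1.
    by apply: le_trans h1; rewrite subr_ge0.
  by rewrite lebesgue_nneg_itv ?subr_ge0 ?gerBl// subKr.
have -> : back_time r = [set` Interval (BSide true 0) (BSide false r)].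
  apply/seteqP; split => x.
    move=> /back_timeP[x0 [/andP[h1 h2]|/andP[h1 h2]]]; rewrite /= in_itv/= x0//=.
    by rewrite (le_trans h2)// ltW.
  rewrite /= in_itv/= => /andP[x0 xr]; apply/back_timeP; split => //.
  have [xt|tx] := leP x t; last by right.
  by left; rewrite andbT (le_trans _ x0)// subr_le0 ltW.
by rewrite lebesgue_nneg_itv// subr0.
Qed.

Definition back_diff r1 r2 := back_region r2 `\` back_region r1.

Lemma measurable_back_diff r1 r2 : measurable (back_diff r1 r2).
Proof. by apply: measurableD; exact: measurable_back_region. Qed.

Lemma intensity_back_region r : 0 <= r -> intensity (back_region r) = (r * c)%:E.
Proof.
move=> r0; rewrite intensity_setX ?lebesgue_back_time ?lebesgue_nneg_itv ?subr0//.
exact: measurable_back_time.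
Qed.

(** The increment is not a rectangle when [r1 < t < r2], so its intensity is obtained by
    subtraction. *)
Lemma intensity_back_diff r1 r2 : 0 <= r1 -> r1 <= r2 ->
  intensity (back_diff r1 r2) = ((r2 - r1) * c)%:E.
Proof.
move=> r10 r12.
have mQ : measurable (`[0%R, +oo[%classic `*` `[0%R, +oo[%classic : set (R * R)).
  by apply: measurableX; exact: measurable_itv.
have m1 := measurable_back_region r1; have m2 := measurable_back_region r2.
have := intensity_back_region r2 (le_trans r10 r12).
have := intensity_back_region r1 r10.
rewrite /intensity => E1 E2.
have : ((lebesgue_measure \x lebesgue_measure)%E (back_region r2 `&` (`[0%R, +oo[ `*` `[0%R, +oo[)) =
  (lebesgue_measure \x lebesgue_measure)%E (back_region r1 `&` (`[0%R, +oo[ `*` `[0%R, +oo[)) +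
  (lebesgue_measure \x lebesgue_measure)%E (back_diff r1 r2 `&` (`[0%R, +oo[ `*` `[0%R, +oo[)))%E.
  rewrite -measureU.
  - congr (_ _); rewrite -setIUl; congr (_ `&` _).
    by rewrite setDUK//; exact: back_region_homo.
  - exact: measurableI.
  - by apply: measurableI => //; exact: measurable_back_diff.
  - by rewrite -subset0 => x [[x1 _] [[_ nx] _]].
rewrite E1 E2; case: (_ (back_diff r1 r2 `&` _)) => // x [xE].
by congr EFin; lra.
Qed.

Lemma uniq_others : uniq others.
Proof. by rewrite filter_uniq// index_enum_uniq. Qed.

Lemma notin_others : a \notin others.
Proof. by rewrite mem_filter eqxx. Qed.

Lemma size_others : size others = N.-1.
Proof.
rewrite size_filter -sum1_count (eq_bigl (mem (predC1 a))); last by [].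
by rewrite sum1_card cardC1 card_ord.
Qed.

Lemma count_proc_diff w r1 r2 (k : nat) : G w -> r1 <= r2 ->
  count_proc r2 w - count_proc r1 w = k%:R <->
  (\sum_(b <- others) Nm b w (back_diff r1 r2))%E = k%:R%:E.
Proof.
move=> Gw r12.
have E : (count_proc r2 w)%:E = ((count_proc r1 w)%:E +
    \sum_(b <- others) Nm b w (back_diff r1 r2))%E.
  rewrite !count_procE// -big_split/=; apply: eq_bigr => b _.
  rewrite -measureU.
  - by rewrite setDUK//; exact: back_region_homo.
  - exact: measurable_back_region.
  - exact: measurable_back_diff.
  - by rewrite -subset0 => x [x1 [_ nx]].
move: E; case: (\sum_(b <- others) _)%E => // x [->].
by rewrite addrAC subrr add0r; split => [->//|[]].
Qed.

Lemma measurable_count_diff r1 r2 :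
  measurable_fun setT (fun w => count_proc r2 w - count_proc r1 w).
Proof. by apply: measurable_funB; exact: measurable_count_proc. Qed.

Lemma measurable_sum_eq (C : set (R * R)) (k : nat) : measurable C ->
  measurable [set w | (\sum_(b <- others) Nm b w C)%E = k%:R%:E].
Proof.
move=> mC; rewrite -[X in measurable X]setTI.
exact: (measurable_sum_Nm P N Nm PRM others C mC measurableT _ (emeasurable_set1 _)).
Qed.

Lemma count_diff_law r1 r2 (k : nat) : 0 <= r1 -> r1 <= r2 ->
  P [set w | count_proc r2 w - count_proc r1 w = k%:R] =
  (poisson_w (N.-1%:R * c * (r2 - r1)) k)%:E.
Proof.
move=> r10 r12.
rewrite (prob_ae_eq P G _ [set w | (\sum_(b <- others) Nm b w (back_diff r1 r2))%E = k%:R%:E])//.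
- rewrite (sum_law1 P N Nm PRM indep)//.
  + by rewrite intensity_back_diff// size_others /= -mulrA [c * _]mulrC.
  + exact: uniq_others.
  + exact: measurable_back_diff.
  + by rewrite intensity_back_diff// ltry.
- rewrite -[X in measurable X]setTI.
  exact: (measurable_count_diff r1 r2 measurableT _ (measurable_set1 _)).
- exact: measurable_sum_eq (measurable_back_diff _ _).
- by move=> w Gw; exact: count_proc_diff.
Qed.

Lemma is_poisson_count_proc : is_poisson_process P count_proc (N.-1%:R * c).
Proof.
split; first exact: measurable_count_proc.
split; first exact: count_proc0.
split; first by move=> w r _; exact: count_proc_nat.
split; first by move=> w r1 r2 _; exact: count_proc_homo.
split; first by move=> w r _; exact: count_proc_cvg.
split; first by move=> r1 r2 r10 r12 k; exact: count_diff_law.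
move=> n tt tt0 ttS.
have tt_homo : {homo tt : i j / (i <= j)%N >-> i <= j}.
  by apply: homo_leq => //; exact: le_trans.
have tt_ge0 i : 0 <= tt i by rewrite (le_trans tt0)// tt_homo.
apply: lift_mutual_indep.
- by move=> i; exact: measurable_count_diff.
- move=> i w; have [k1 E1] := count_proc_nat w (tt i.+1); have [k2 E2] := count_proc_nat w (tt i).
  exists (k1 - k2)%N; rewrite E1 E2 natrB// -(ler_nat R) -E1 -E2.
  exact: count_proc_homo.
move=> k.
pose A (i : 'I_n) := back_diff (tt i) (tt i.+1).
have mA i : measurable (A i) by exact: measurable_back_diff.
have iA i : intensity (A i) = ((tt i.+1 - tt i) * c)%:E by exact: intensity_back_diff.
have fA i : (intensity (A i) < +oo)%E by rewrite iA ltry.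
rewrite (prob_ae_eq P G _ (sum_event Nm A others k))//.
- rewrite (sum_event_law P N Nm PRM indep n A mA fA _ others k uniq_others).
    rewrite -prodEFin; apply: eq_bigr => i _.
    rewrite [RHS](_ : _ = P [set w | count_proc (tt i.+1) w - count_proc (tt i) w = (k i)%:R])//.
    by rewrite count_diff_law// iA size_others /= -mulrA [c * _]mulrC.
  move=> i j ij; rewrite -subset0 => x.
  wlog lij : i j ij / (i < j)%N.
    move=> H; move: (ij); rewrite neq_ltn => /orP[/H|ji]; first exact.
    by rewrite setIC; apply: H ji; rewrite eq_sym.
  move=> [[xi _] [_ nxj]]; apply: nxj; apply: back_region_homo xi.
  exact: tt_homo.
- apply: fin_bigcap_measurable => // i _; rewrite -[X in measurable X]setTI.
  exact: (measurable_count_diff _ _ measurableT _ (measurable_set1 _)).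
- exact: measurable_sum_event.
- move=> w Gw; split.
    by move=> H i; apply/(count_proc_diff w _ _ (k i) Gw (ttS i)); exact: H.
  by move=> H i _; apply/(count_proc_diff w _ _ (k i) Gw (ttS i)); exact: H.
Qed.

(** By [lift_indep] it suffices to fix the values of the process at finitely many times; almost
    surely this is a [sum_event] over the actors other than [a]. *)
Lemma indep_count_proc : indep_pi P (fam_events `[0%R, +oo[%classic count_proc) (rm_events (Nm a)).
Proof.
move=> _ B [n [ix [C [ixC ->]]]] rmB.
have mB := measurable_rm_events P N Nm PRM a B rmB.
rewrite setIC muleC.
apply: (lift_indep P n (fun i => count_proc (ix i))) => //; last by move=> i; case: (ixC i).
- by move=> i; exact: measurable_count_proc.
- by move=> i w; exact: count_proc_nat.
move=> k.
pose A (i : 'I_n) := back_region (ix i).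
have mA i : measurable (A i) by exact: measurable_back_region.
have ix0 i : 0 <= ix i by case: (ixC i); rewrite /= in_itv/= andbT.
have fA i : (intensity (A i) < +oo)%E by rewrite intensity_back_region// ltry.
have mE : measurable (\bigcap_i (count_proc (ix i) @^-1` [set (k i)%:R])).
  apply: fin_bigcap_measurable => // i _; rewrite -[X in measurable X]setTI.
  exact: (measurable_count_proc (ix i) measurableT _ (measurable_set1 _)).
have mS : measurable (sum_event Nm A others k) by exact: measurable_sum_event.
have EE w : G w -> (\bigcap_i (count_proc (ix i) @^-1` [set (k i)%:R])) w <-> sum_event Nm A others k w.
  move=> Gw; split.
    by move=> H i; rewrite -count_procE// (H i I).
  by move=> H i _; apply: EFin_inj; rewrite count_procE// H.
rewrite (prob_ae_eq P G _ (B `&` sum_event Nm A others k))//.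
- rewrite (indep_sum_event P N Nm PRM indep n A mA fA others a B k uniq_others notin_others rmB).
  by congr (_ * _)%E; apply: (prob_ae_eq P G) => // w Gw; apply: iff_sym; exact: EE.
- exact: measurableI.
- exact: measurableI.
- by move=> w /EE H; split => -[Bw] /H.
Qed.

(** On [G], by monotonicity and [count_proc_right], the value at [Z] is below [x] exactly when the
    value at some rational [q > Z] is. Off [G], where [Z] is not controlled, the process is [0]. *)
Lemma measurable_count_proc_at (Z : T -> R) :
  (forall q : R, measurable (G `&` [set w | Z w < q])) ->
  measurable_fun setT (fun w => count_proc (Z w) w).
Proof.
move=> mZ; apply: measurable_fun_lt_real => x.
have mlt q : measurable [set w | count_proc q w < x].
  have := measurable_count_proc q measurableT _ (measurable_itv `]-oo, x[).
  by rewrite setTI; congr (measurable _); apply/seteqP; split => w; rewrite /= in_itv.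
have -> : [set w | count_proc (Z w) w < x] = (~` G `&` [set w | 0 < x]) `|`
   [set w | exists q : rat, (G `&` [set w | Z w < ratr q] `&` [set w | count_proc (ratr q) w < x]) w].
  apply/seteqP; split => w /=.
    have [Gw|nG] := pselect (G w); last by rewrite count_proc_off//; left.
    move=> lt; right; have [r' Zr' E] := count_proc_right w (Z w).
    have [q] := rat_in_itvoo Zr'; rewrite in_itv/= => /andP[Zq qr'].
    exists q; split => //; apply: le_lt_trans lt; rewrite -E.
    by apply: count_proc_homo; exact: ltW.
  move=> [[nG x0]|[q [[Gw Zq] lt]]]; first by rewrite count_proc_off.
  by apply: le_lt_trans lt; apply: count_proc_homo; exact: ltW.
apply: measurableU; last first.
  by apply: measurable_bigcup_rat => q; exact: measurableI.
apply: measurableI; first exact: measurableC.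
have [x0|x0] := boolP (0 < x).
  by rewrite (_ : [set w | _] = setT)//; apply/seteqP.
by rewrite (_ : [set w | _] = set0)// -subset0.
Qed.

End counting_process.

(** * Measurability of [E], [Z] and [(M^>)^-1(E)] *)

Section Mgt_measurability.
Context {R : realType} (phi : R -> R).
Hypothesis phi_ge0 : forall r, 0 <= phi r.

Lemma Mgt_homo : {homo Mgt phi : x y / x <= y}.
Proof.
move=> x y xy; apply: lb_le_inf.
  by exists (Phi phi (y + 1)); exists (y + 1) => //=; rewrite in_itv/= andbT ltrDl.
move=> _ [z /= + <-]; rewrite in_itv/= andbT => yz; apply: ge_inf.
  by exists 0 => _ [u _ <-]; exact: Phi_ge0.
by exists z => //=; rewrite in_itv/= andbT (le_lt_trans xy).
Qed.

(** A strict bound leaves room for a rational point: [Mgt] is nondecreasing, so a rational slightly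
    above an admissible [r] is admissible too. *)
Lemma measurable_Mgt_inv {d : measure_display} {T : measurableType d} (f : T -> \bar R) :
  measurable_fun setT f -> measurable_fun setT (fun w => Mgt_inv phi (f w)).
Proof.
move=> mf; apply: measurable_fun_lt_ereal => x.
have -> : [set w | (Mgt_inv phi (f w) < x%:E)%E] =
  [set w | exists q : rat, ([set w | 0 <= (ratr q : R) < x] `&`
     [set w | f w <= (Mgt phi (ratr q))%:E]%E) w].
  apply/seteqP; split => w /=.
    move=> /ereal_inf_lt[_ [r [r0 fr] <-]]; rewrite lte_fin => rx.
    have [q] := rat_in_itvoo rx; rewrite in_itv/= => /andP[rq qx].
    exists q; split; first by rewrite qx (le_trans r0)// ltW.
    by apply: (le_trans fr); rewrite lee_fin; apply/Mgt_homo/ltW.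
  move=> [q [/andP[q0 qx] fq]]; apply: (@le_lt_trans _ _ (ratr q : R)%:E); last by rewrite lte_fin.
  by apply: ereal_inf_lbound; exists (ratr q).
apply: measurable_bigcup_rat => q; apply: measurableI.
  case: (boolP (0 <= (ratr q : R) < x)) => H.
    by rewrite (_ : [set w | _] = setT)//; apply/seteqP.
  by rewrite (_ : [set w | _] = set0)// -subset0.
by have := emeasurable_fun_infty_c measurableT mf (Mgt phi (ratr q))%:E; rewrite setTI.
Qed.

End Mgt_measurability.

Section first_atom_measurability.
Context {R : realType} {d : measure_display} {T : measurableType d}.
Variables (P : probability T R) (N : nat) (Nm : 'I_N -> T -> {measure set (R * R) -> \bar R}).
Hypothesis PRM : forall b, is_PRM P (Nm b).

Lemma measurable_Ehit a s t : measurable_fun setT (Ehit (Nm a) s t).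
Proof.
apply: measurable_fun_lt_ereal => x.
have -> : [set w | (Ehit (Nm a) s t w < x%:E)%E] =
  [set w | exists q : rat, ([set w | 0 < (ratr q : R) < x] `&`
     [set w | 1 <= Nm a w (rect s t (ratr q))]%E) w].
  apply/seteqP; split => w /=.
    move=> /ereal_inf_lt[_ [r [r0 fr] <-]]; rewrite lte_fin => rx.
    have [q] := rat_in_itvoo rx; rewrite in_itv/= => /andP[rq qx].
    exists q; split; first by rewrite qx (lt_trans r0).
    apply: (le_trans fr); apply: le_measure; rewrite ?inE; try exact: measurable_rect.
    move=> y [y1 y2]; split => //; move: y2; rewrite /= !in_itv/= => /andP[-> y2]/=.
    by rewrite (le_trans y2)// ltW.
  move=> [q [/andP[q0 qx] fq]]; apply: (@le_lt_trans _ _ (ratr q : R)%:E); last by rewrite lte_fin.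
  by apply: ereal_inf_lbound; exists (ratr q).
apply: measurable_bigcup_rat => q; apply: measurableI.
  case: (boolP (0 < (ratr q : R) < x)) => H.
    by rewrite (_ : [set w | _] = setT)//; apply/seteqP.
  by rewrite (_ : [set w | _] = set0)// -subset0.
have := emeasurable_fun_c_infty measurableT (measurable_Nm P N Nm PRM a _ (measurable_rect s t (ratr q))) 1%E.
by rewrite setTI.
Qed.

Variables (a : 'I_N) (s t : R) (G : set T).
Hypotheses (s_ge0 : 0 <= s) (st : s <= t).
Hypothesis mG : measurable G.
Hypothesis nat_box : forall w, G w -> forall n A, measurable A -> A `<=` box n -> isnat (Nm a w A).
Hypothesis null0 : forall w, G w -> forall n, Nm a w (`[0%R, n%:R]%classic `*` [set 0%R]) = 0%E.
Hypothesis simple : forall w, G w -> forall n (z : R), 0 <= z -> z <= n%:R ->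
  (Nm a w (`[0%R, n%:R]%classic `*` [set z]) <= 1)%E.
Hypothesis hit : forall w, G w -> (exists n, 1 <= Nm a w (rect s t n%:R))%E.

(** On [G] a lowest atom exists, so [xget] returns the time of an atom rather than its default
    value. *)
Lemma ZtimeP w : G w -> exists tau e : R, [/\ Ehit (Nm a) s t w = e%:E, 0 < e,
  (forall r, r < e -> Nm a w (rect s t r) = 0%E), s <= tau <= t &
  (1 <= Nm a w [set (tau, e)])%E] /\ Ztime (Nm a) s t w = t - tau.
Proof.
move=> Gw; have [e [EE e0 below at1]] := EhitP _ _ (Nm a) s t w s_ge0 (nat_box w Gw) (null0 w Gw) (hit w Gw).
have [u ust u1] := first_atom_exists _ _ (Nm a) s t w s_ge0 st (nat_box w Gw) e e0 below at1.
rewrite /Ztime; set S := [set u : R | _].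
have Su : S u by split => //; rewrite EE.
have [H1 H2] : S (xget t S) := xgetPex t (ex_intro S u Su).
exists (xget t S), e; split => //; split => //.
by move: H2; rewrite EE.
Qed.

(** [Ztime] comes from a choice operator; comparing the measurable heights [Ehit] over [[s, x]] and
    [[s, t]] is what makes it measurable. The direction from heights to times uses that the lowest
    atom is unique. *)
Lemma Ztime_leP w x : G w -> s <= x -> x <= t ->
  t - x <= Ztime (Nm a) s t w <-> (Ehit (Nm a) s x w <= Ehit (Nm a) s t w)%E.
Proof.
move=> Gw sx xt; have [tau [e [[EE e0 below /andP[stau taut] at1] ->]]] := ZtimeP w Gw.
rewrite lerD2l lerN2 EE; split.
  move=> taux; apply: ereal_inf_lbound; exists e => //; split => //.
  apply: (le_trans at1); apply: le_measure; rewrite ?inE.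
  - exact: measurable_point.
  - exact: measurable_rect.
  - by move=> _ ->; split; rewrite /= in_itv/= ?stau ?taux// lexx ltW.
move=> le.
have hitx : (exists n, 1 <= Nm a w (rect s x n%:R))%E.
  have /ereal_inf_lt[_ [r [r0 r1] <-] _] := le_lt_trans le (ltry e).
  have [n [rn _]] := box_large r 0; exists n; apply: (le_trans r1).
  exact: rect_homo.
have [e' [EE' e'0 _ at1']] := EhitP _ _ (Nm a) s x w s_ge0 (nat_box w Gw) (null0 w Gw) hitx.
move: le; rewrite EE' lee_fin => le.
have mr := measurable_rect s x e.
have sub : rect s x e `<=` rect s t e.
  move=> y [y1 y2]; split => //; move: y1; rewrite /= !in_itv/= => /andP[-> y1]/=.
  exact: le_trans xt.
have r1 : (1 <= Nm a w (rect s x e))%E.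
  by apply: (le_trans at1'); exact: rect_homo.
have stt : s <= tau <= t by rewrite stau.
have [/= + _] := first_atom_unique _ _ (Nm a) s t w s_ge0 (simple w Gw) e
  (rect s x e) tau e0 mr sub below r1 stt at1.
by rewrite in_itv/= => /andP[].
Qed.

Lemma measurable_Ztime_lt (q : R) : measurable (G `&` [set w | Ztime (Nm a) s t w < q]).
Proof.
have zb w : G w -> 0 <= Ztime (Nm a) s t w <= t - s.
  move=> Gw; have [tau [e [[_ _ _ /andP[stau taut] _] ->]]] := ZtimeP w Gw.
  by rewrite subr_ge0 taut lerD2l lerN2.
have [qle|qgt] := leP q 0.
  rewrite (_ : _ `&` _ = set0)// -subset0 => w [/zb/andP[z0 _] /= zq].
  by move: (lt_le_trans zq qle); rewrite ltNge z0.
have [qlt|qge] := leP q (t - s); last first.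
  rewrite (_ : _ `&` _ = G)//; apply/setIidl => w /zb/andP[_ zs].
  exact: le_lt_trans qge.
have -> : G `&` [set w | Ztime (Nm a) s t w < q] =
    G `&` [set w | (Ehit (Nm a) s t w < Ehit (Nm a) s (t - q) w)%E].
  have [h1 h2] : s <= t - q /\ t - q <= t by split; lra.
  have H w (Gw : G w) := Ztime_leP w (t - q) Gw h1 h2.
  apply/seteqP; split => w [Gw /= lt]; split => //=; rewrite ltNge; apply/negP.
    by move=> /(H w Gw); rewrite subKr leNgt lt.
  by rewrite -{1}(subKr t q) => /(H w Gw); rewrite leNgt lt.
apply: measurableI => //.
have := measurable_lte measurableT (measurable_Ehit a s t) (measurable_Ehit a s (t - q)).
by rewrite setTI.
Qed.

End first_atom_measurability.

(** * Expectations *)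

Section series_bounds.
Context {R : realType}.

Lemma nneseries_single (f : nat -> \bar R) j : (forall k, (0 <= f k)%E) ->
  (forall k, k != j -> f k = 0%E) -> (\sum_(0 <= k <oo) f k = f j)%E.
Proof.
move=> f0 fj; rewrite (@nneseriesD1 _ f j xpredT)//= eseries0 ?adde0// => k _ kj.
exact: fj.
Qed.

Lemma mean_poisson_w (m : R) : 0 <= m ->
  (\sum_(0 <= k <oo) (k%:R * poisson_w m k)%:E = m%:E)%E.
Proof.
move=> m0; rewrite nneseries_recl//; last first.
  by move=> k _; rewrite lee_fin mulr_ge0// poisson_w_ge0.
rewrite mul0r add0e -nneseries_addn; last by move=> k; rewrite lee_fin mulr_ge0// poisson_w_ge0.
under eq_eseriesr => k _.
  rewrite addn1 (_ : k.+1%:R * poisson_w m k.+1 = m * poisson_w m k) ?EFinM; last first.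
    rewrite /poisson_w factS natrM exprS; field.
    by rewrite !pnatr_eq0/= -lt0n fact_gt0/= addrC natr1 pnatr_eq0.
  over.
rewrite nneseriesZl ?sum_poisson_w ?mule1// => k _.
by rewrite lee_fin poisson_w_ge0.
Qed.

(** The series is [x / (1 - expR (- y))], and [y <= expR y - 1]. It will sum the probabilities of
    the height slices of the lowest atom. *)
Lemma geometric_bound (x y : R) : 0 <= x -> 0 < y ->
  (\sum_(0 <= k <oo) (x * expR (- (y * k%:R)))%:E <= (x / y * expR y)%:E)%E.
Proof.
move=> x0 y0; apply: lime_le.
  by apply: is_cvg_nneseries => k _ _; rewrite lee_fin mulr_ge0// expR_ge0.
apply: nearW => n; rewrite sumEFin lee_fin -mulr_sumr -mulrA ler_wpM2l// big_mkord.
set q := expR (- y).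
have qe k : expR (- (y * k%:R)) = q ^+ k by rewrite -mulNr expRM_natr.
under eq_bigr do rewrite qe.
have q0 : 0 <= q by exact: expR_ge0.
have q1 : 0 < 1 - q by rewrite subr_gt0 /q expR_lt1 oppr_lt0.
have key : (1 - q) * (\sum_(i < n) q ^+ i) <= 1.
  have := subrX1 q n; have : 0 <= q ^+ n by rewrite exprn_ge0.
  move: (\sum_(i < n) q ^+ i) => S qn E.
  have -> : (1 - q) * S = 1 - q ^+ n by rewrite -(opprB q 1) mulNr -E opprB.
  by rewrite lerBlDr lerDl.
have keyy : y <= expR y * (1 - q).
  by rewrite mulrBr mulr1 /q -expRD addrN expR0 lerBrDl; exact: expR_ge1Dx.
apply: (@le_trans _ _ (1 - q)^-1); first by rewrite -div1r ler_pdivlMr// mulrC.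
by rewrite -div1r ler_pdivrMr// -mulrA mulrC ler_pdivlMr// mul1r.
Qed.

End series_bounds.

Section expectation.
Context {R : realType} {d : measure_display} {T : measurableType d}.
Variables (P : probability T R) (N : nat) (a : 'I_N).
Variables (Nm : 'I_N -> T -> {measure set (R * R) -> \bar R}).
Hypothesis PRM : forall b, is_PRM P (Nm b).
Hypothesis indep : mutual_indep_pi P (fun b => rm_events (Nm b)).

(** Independence is known for events, so the product is expanded over the values [k] of the count,
    which is natural almost surely. *)
Lemma expectation_others (B : set T) (D : set (R * R)) : rm_events (Nm a) B ->
  measurable D -> (intensity D < +oo)%E ->
  (\int[P]_w ((\1_B w)%:E * \sum_(b <- others N a) Nm b w D) =
   P B * (N.-1%:R * fine (intensity D))%:E)%E.
Proof.
move=> rmB mD fD.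
have mB := measurable_rm_events P N Nm PRM a B rmB.
pose X w := (\sum_(b <- others N a) Nm b w D)%E.
have mX : measurable_fun setT X by exact: (measurable_sum_Nm P N Nm PRM).
have mk k : measurable [set w | X w = k%:R%:E] by exact: measurable_sum_eq.
have X0 w : (0 <= X w)%E by apply: sume_ge0.
pose F k w := (k%:R * \1_(B `&` [set w | X w = k%:R%:E]) w)%:E : \bar R.
have mF k : measurable_fun setT (F k).
  apply/measurable_EFinP; apply: measurable_funM; first exact: measurable_cst.
  by apply: measurable_indic; exact: measurableI.
have F0 k w : (0 <= F k w)%E by rewrite lee_fin mulr_ge0.
have aeX : {ae P, forall w, forall b, isnat (Nm b w D)}.
  by apply: filter_forall => b; exact: ae_isnat.
rewrite (ae_eq_integral (fun w => \sum_(0 <= k <oo) F k w)%E)//.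
- rewrite integral_nneseries//.
  have -> : (P B * (N.-1%:R * fine (intensity D))%:E =
      \sum_(0 <= k <oo) P B * (k%:R * poisson_w (N.-1%:R * fine (intensity D)) k)%:E)%E.
    have m0 : 0 <= N.-1%:R * fine (intensity D) by rewrite mulr_ge0 ?fine_ge0 ?intensity_ge0.
    have [p pE] : exists p, P B = p%:E by exists (fine (P B)); rewrite fineK// fin_num_measure.
    rewrite pE nneseriesZl ?mean_poisson_w// => k _.
    by rewrite lee_fin mulr_ge0// poisson_w_ge0.
  apply: eq_eseriesr => k _; rewrite /F.
  under eq_integral do rewrite EFinM.
  rewrite ge0_integralZl_EFin//; last first.
    by apply/measurable_EFinP; apply: measurable_indic; exact: measurableI.
  rewrite integral_indic ?setIT//; last exact: measurableI.
  have -> : [set w | X w = k%:R%:E] = sum_event Nm (fun _ : 'I_1 => D) (others N a) (fun=> k).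
    by apply/seteqP; split => w; [move=> H i|move=> /(_ ord0)].
  have E1 : P (B `&` sum_event Nm (fun _ : 'I_1 => D) (others N a) (fun=> k)) =
      (P B * (poisson_w (N.-1%:R * fine (intensity D)) k)%:E)%E.
    rewrite (indep_sum_event P N Nm PRM indep 1 (fun=> D) (fun=> mD) (fun=> fD) _ a)//; last 2 first.
    + exact: uniq_others.
    + exact: notin_others.
    rewrite (sum_event_law P N Nm PRM indep)//; last 2 first.
    + by move=> i j; rewrite !ord1.
    + exact: uniq_others.
    by rewrite big_ord1 size_others.
  by rewrite [X in (_ * X = _)%E]E1 muleCA -EFinM.
- apply: emeasurable_funM => //; apply/measurable_EFinP; exact: measurable_indic.
- by apply: ge0_emeasurable_sum.
- apply: filterS aeX => w natw _ /=.
  have [k kE] : isnat (X w) by exact: isnat_sum.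
  rewrite -/(X w) kE (nneseries_single _ k)//.
    rewrite /F -EFinM mulrC; congr (_ * _)%:E; rewrite !indicE; congr (_%:R).
    congr nat_of_bool; apply/idP/idP; rewrite !inE; first by [].
    by case.
  move=> j jk; rewrite /F indicE memNset ?mulr0//= => -[_]; rewrite kE => -[/eqP].
  by rewrite eqr_nat eq_sym (negbTE jk).
Qed.

Variables (s t s' x y : R).
Hypotheses (s_ge0 : 0 <= s) (ss' : s <= s') (s't : s' <= t) (x_ge0 : 0 <= x) (xy : x <= y).

(* The lowest atom over [[s, t]] has height in [[x, y[] and time at most [s']. *)
Definition low_atom : set T :=
  [set w | (1 <= Nm a w (`[s, s']%classic `*` `[x, y[%classic))%E] `&`
  [set w | Nm a w (`[s, t]%classic `*` `[0%R, x[%classic) = 0%E].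

Let C (i : 'I_2) : set (R * R) := if i == 0 then `[s, s']%classic `*` `[x, y[%classic
  else `[s, t]%classic `*` `[0%R, x[%classic.
Let V (i : 'I_2) : set (\bar R) := if i == 0 then `[1%E, +oo[%classic else [set 0%E].

Let mC i : measurable (C i).
Proof. by rewrite /C; case: ifP => _; apply: measurableX; exact: measurable_itv. Qed.

Let mV i : measurable (V i).
Proof. by rewrite /V; case: ifP => _; [exact: emeasurable_itv|exact: emeasurable_set1]. Qed.

Let low_atomE : low_atom = \bigcap_i ((fun w => Nm a w (C i)) @^-1` V i).
Proof.
rewrite /low_atom; apply/seteqP; split => w.
  move=> [/= h1 h2] i _ /=; rewrite /V /C; case: ifP => _; last exact: h2.
  by rewrite /= in_itv/= andbT.
move=> H; split; last by have := H (lift ord0 ord0) I; rewrite /V /C.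
by have := H ord0 I; rewrite /V /C /= in_itv/= andbT.
Qed.

Lemma rm_events_low_atom : rm_events (Nm a) low_atom.
Proof. by exists 2%N, C, V. Qed.

(** The two regions are disjoint, hence independent: the lower one is void with probability
    [expR (- ((t - s) * x))], and the upper one is hit with probability at most its intensity. *)
Lemma prob_low_atom :
  (P low_atom <= ((s' - s) * (y - x) * expR (- ((t - s) * x)))%:E)%E.
Proof.
have [_ [law ind]] := PRM a.
have := ind 2%N C mC; rewrite low_atomE => -> //; last first.
  suff tC : C 0 `&` C (lift ord0 ord0) = set0.
    move=> i j; case: (unliftP ord0 i) => [i'|] ->; case: (unliftP ord0 j) => [j'|] ->; rewrite ?ord1//.
    by rewrite setIC.
  rewrite -subset0 => -[u v] [[_ +] [_ +]]; rewrite /= !in_itv/= => /andP[xv _] /andP[_ vx].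
  by move: (le_lt_trans xv vx); rewrite ltxx.
rewrite big_ord_recl big_ord1 [X in (X * _ <= _)%E](_ : _ =
   P [set w | (1 <= Nm a w (`[s, s']%classic `*` `[x, y[%classic))%E]); last first.
  by congr (P _); apply/seteqP; split => w; rewrite /V /C /= in_itv/= andbT.
rewrite [X in (_ * X <= _)%E](_ : _ = P [set w | Nm a w (`[s, t]%classic `*` `[0%R, x[%classic) = 0%:R%:E]); last first.
  by congr (P _); apply/seteqP; split => w; rewrite /V /C.
have i1 : intensity (`[s, s']%classic `*` `[x, y[%classic) = ((s' - s) * (y - x))%:E.
  by rewrite intensity_rect.
have i2 : intensity (`[s, t]%classic `*` `[0%R, x[%classic) = ((t - s) * x)%:E.
  by rewrite intensity_rect ?subr0// (le_trans ss').
rewrite law ?i2 ?ltry//; last by apply: measurableX; exact: measurable_itv.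
rewrite /= /poisson_w expr0 (_ : 0`! = 1%N)// divr1 mul1r [leRHS]EFinM.
apply: lee_wpmul2r; first by rewrite lee_fin expR_ge0.
have m1 : measurable (`[s, s']%classic `*` `[x, y[%classic : set (R * R)).
  by apply: measurableX; exact: measurable_itv.
have ma : measurable [set w | (1 <= Nm a w (`[s, s']%classic `*` `[x, y[%classic))%E].
  have := emeasurable_fun_c_infty measurableT (measurable_Nm P N Nm PRM a _ m1) 1%E.
  by rewrite setTI.
have mb : measurable [set w | Nm a w (`[s, s']%classic `*` `[x, y[%classic) = 0%:R%:E].
  exact: (measurable_Nm_pre P N Nm PRM a _ [set 0%:R%:E]).
have : (P [set w | 1 <= Nm a w (`[s, s']%classic `*` `[x, y[%classic)] +
    P [set w | Nm a w (`[s, s']%classic `*` `[x, y[%classic) = 0%:R%:E] <= 1)%E.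
  rewrite -measureU//; first by apply: probability_le1; exact: measurableU.
  by rewrite -subset0 => w [/= + E]; rewrite E lee_fin ler10.
rewrite law ?i1 ?ltry// /= /poisson_w expr0 (_ : 0`! = 1%N)// divr1 mul1r.
have [p ->] : exists p, P [set w | (1 <= Nm a w (`[s, s']%classic `*` `[x, y[%classic))%E] = p%:E.
  by eexists; rewrite -[LHS]fineK// fin_num_measure.
rewrite -EFinD !lee_fin => le.
by have := expR_ge1Dx (- ((s' - s) * (y - x))); lra.
Qed.

End expectation.

(** * The two bounds *)

Lemma ae_measurable_set {R : realType} {d : measure_display} {T : measurableType d}
  (P : probability T R) (Q : T -> Prop) : {ae P, forall w, Q w} ->
  exists G : set T, [/\ measurable G, {ae P, forall w, G w} & forall w, G w -> Q w].
Proof.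
move=> [B [mB B0 QB]]; exists (~` B); split.
- exact: measurableC.
- by exists B; split => // w; rewrite /= notK.
- by move=> w nBw; apply/not_notP => nQ; apply: nBw; exact: QB.
Qed.

Section system_bounds.
Context {R : realType} {d : measure_display} {T : measurableType d}.
Variables (P : probability T R) (h : R) (N : nat) (a : 'I_N) (phi : R -> R).
Variables (Nm : 'I_N -> T -> {measure set (R * R) -> \bar R}).
Variables (u0 : 'I_N -> R) (U : R -> 'I_N -> T -> R).
Hypothesis h_gt0 : 0 < h.
Hypothesis N_ge2 : (2 <= N)%N.
Hypothesis phi_ge0 : forall r, 0 <= phi r.
Hypothesis Mfin : (Mlt phi (2 * h) < +oo)%E.
Hypothesis PRM : forall b, is_PRM P (Nm b).
Hypothesis indep : mutual_indep_pi P (fun b => rm_events (Nm b)).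
Hypothesis solU : is_solution P phi h Nm u0 U.

Let M := fine (Mlt phi (2 * h)).

Lemma M_ge0 : 0 <= M.
Proof.
apply: (@le_trans _ _ (Phi phi 0)); first exact: Phi_ge0.
by apply: Phi_le_Mlt => //; rewrite normr0 mulr_ge0// ltW.
Qed.

Let sde w := forall s, 0 <= s -> forall b : 'I_N,
  (forall e, (Nm e w).-integrable (dom0t s)
     (fun x => (self_integrand phi (fun r => U r e w) x)%:E)) /\
  (forall e, (Nm e w).-integrable (dom0t s)
     (fun x => (inter_integrand phi (fun r => U r e w) x)%:E)) /\
  ((U s b w)%:E = (u0 b)%:E
     - \int[Nm b w]_(x in dom0t s) (self_integrand phi (fun r => U r b w) x)%:E
     + (h / N%:R)%:E * \sum_(e < N | e != b)
        \int[Nm e w]_(x in dom0t s) (inter_integrand phi (fun r => U r e w) x)%:E)%E.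

(** Everything that the pathwise argument takes from probability, gathered so that one null set is
    discarded. [good_time0] excludes [tau = 0]; [good_null] makes the backward count start at [0]
    and gives [E = +oo] for [s = t]. *)
Record good (t : R) (w : T) : Prop := Good {
  good_nat : forall b n A, measurable A -> A `<=` box n -> isnat (Nm b w A);
  good_time : forall q : R, 0 < q -> (\sum_b Nm b w ([set q] `*` `[0%R, +oo[%classic) <= 1)%E;
  good_height : forall n (z : R), 0 <= z -> z <= n%:R ->
    (Nm a w (`[0%R, n%:R]%classic `*` [set z]) <= 1)%E;
  good_height0 : forall n, Nm a w (`[0%R, n%:R]%classic `*` [set 0%R]) = 0%E;
  good_time0 : forall n, Nm a w ([set 0%R] `*` `[0%R, n%:R]%classic) = 0%E;
  good_null : forall b n, Nm b w ([set t] `*` `[0%R, n%:R]%classic) = 0%E;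
  good_sde : sde w }.

Lemma ae_null_line b (q : R) n : 0 <= q ->
  {ae P, forall w, Nm b w ([set q] `*` `[0%R, n%:R]%classic) = 0%E}.
Proof.
move=> q0; apply: (ae_null P N Nm PRM indep).
  by apply: measurableX; [exact: measurable_set1|exact: measurable_itv].
by rewrite -set_itv1 intensity_rect// subrr mul0r.
Qed.

Lemma ae_good t : 0 <= t -> {ae P, forall w, good t w}.
Proof.
move=> t0.
have H1 := ae_isnat_box P N Nm PRM.
have H2 := ae_simple_time P N Nm PRM indep.
have H3 := ae_simple_height P N Nm PRM indep a.
have H4 : {ae P, forall w, forall n, Nm a w (`[0%R, n%:R]%classic `*` [set 0%R]) = 0%E}.
  apply: ae_foralln => n; apply: (ae_null P N Nm PRM indep).
    by apply: measurableX; [exact: measurable_itv|exact: measurable_set1].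
  by rewrite -set_itv1 intensity_rect// subrr mulr0.
have H5 : {ae P, forall w, forall n, Nm a w ([set 0%R] `*` `[0%R, n%:R]%classic) = 0%E}.
  by apply: ae_foralln => n; exact: ae_null_line.
have H6 : {ae P, forall w, forall b n, Nm b w ([set t] `*` `[0%R, n%:R]%classic) = 0%E}.
  by apply: filter_forall => b; apply: ae_foralln => n; exact: ae_null_line.
have H7 := solU.2.
apply: filterS2 (filterI (filterI H1 H2) (filterI H3 H4)) (filterI (filterI H5 H6) H7).
by move=> w [[h1 h2] [h3 h4]] [[h5 h6] [_ [_ h7]]]; split.
Qed.

Lemma good_path_bound s t w : 0 <= s -> s < t -> good t w ->
  (exists n, 1 <= Nm a w (rect s t n%:R))%E ->
  exists tau e : R, [/\ Ehit (Nm a) s t w = e%:E, 0 < e,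
    (forall r, r < e -> Nm a w (rect s t r) = 0%E), s <= tau <= t &
    (1 <= Nm a w [set (tau, e)])%E] /\ [/\
    Ztime (Nm a) s t w = t - tau &
    (`|U t a w|%:E <= Mgt_inv phi (Ehit (Nm a) s t w) + h%:E + (2 * h / N%:R)%:E *
      \sum_(b <- others N a) Nm b w (`[tau, t]%classic `*` `[0%R, M]%classic))%E].
Proof.
move=> s0 st gw hit; have st' := ltW st.
have [tau [e [[EE e0 below stau at1] ZE]]] := ZtimeP N Nm a s t
  [set w | good t w /\ (exists n, 1 <= Nm a w (rect s t n%:R))%E] s0 st'
  (fun w g => good_nat t w g.1 a) (fun w g => good_height0 t w g.1) (fun w g => g.2) w (conj gw hit).
exists tau, e; split => //; split => //.
have /andP[stau1 taut] := stau.
(* For [s = 0] the atom could sit at time [0], before which there is no path to look at;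
   [good_time0] excludes this. *)
have tau0 : 0 < tau.
  rewrite lt_neqAle (le_trans s0 stau1) andbT; apply/eqP => tau0.
  have [n [_ en]] := box_large 0 e.
  have : (1 <= Nm a w ([set 0%R] `*` `[0%R, n%:R]%classic))%E.
    apply: (le_trans at1); apply: le_measure; rewrite ?inE.
    - exact: measurable_point.
    - by apply: measurableX; [exact: measurable_set1|exact: measurable_itv].
    - by move=> _ ->; split => //=; rewrite in_itv/= (ltW e0).
  by rewrite (good_time0 t w gw) lee_fin ler10.
rewrite EE big_filter.
have t0 : 0 <= t by exact: le_trans st'.
exact: (path_bound phi h N t (fun b => Nm b w) u0 (fun s b => U s b w) h_gt0 phi_ge0
  (good_nat t w gw) (good_time t w gw) (good_sde t w gw) t0 a tau e tau0 taut (ltW e0) at1 Mfin).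
Qed.

(** The inequality holds outcome by outcome on [G], which gives the stochastic order once both
    events are known to be measurable. *)
Lemma stochastic_bound s t : 0 <= s -> s < t ->
  exists Pp : R -> T -> R,
    is_poisson_process P Pp (N%:R * M) /\
    indep_pi P (fam_events `[0%R, +oo[%classic Pp) (rm_events (Nm a)) /\
    (forall r, 0 <= r ->
      (P [set w | r%:E < (`|U t a w|)%:E] <=
       P [set w | r%:E < Mgt_inv phi (Ehit (Nm a) s t w) + h%:E
                     + (2 * h / N%:R * Pp (Ztime (Nm a) s t w) w)%:E])%E).
Proof.
move=> s0 st; have t0 : 0 <= t by rewrite (le_trans s0)// ltW.
have st' := ltW st.
have [G [mG aeG Ggood]] := ae_measurable_set P _
  (filterI (ae_good t t0) (ae_atom P N Nm PRM a s t s0 st)).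
have Gn w (Gw : G w) := good_nat t w (Ggood w Gw).1.
have N0 : (0 : R) < N%:R by rewrite ltr0n (leq_trans _ N_ge2).
have N1 : (0 : R) < N.-1%:R by rewrite ltr0n -ltnS prednK// (leq_trans _ N_ge2).
pose c := M * (N%:R / N.-1%:R).
have c0 : 0 <= c by rewrite mulr_ge0 ?M_ge0// divr_ge0// ltW.
have Mc : M <= c by rewrite ler_peMr ?M_ge0// ler_pdivlMr// mul1r ler_nat leq_pred.
have nullG w (Gw : G w) := good_null t w (Ggood w Gw).1.
pose Pp := count_proc N Nm a t c G.
exists Pp; split; [|split].
- have -> : N%:R * M = N.-1%:R * c by rewrite /c; field; rewrite gt_eqF.
  exact: is_poisson_count_proc.
- exact: indep_count_proc.
- move=> r r0.
  have mU : measurable [set w | (r%:E < (`|U t a w|)%:E)%E].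
    have mf : measurable_fun setT (fun w => `|U t a w|).
      by apply: measurableT_comp => //; exact: solU.1.
    have := mf measurableT _ (measurable_itv `]r, +oo[); rewrite setTI.
    by congr (measurable _); apply/seteqP; split => w; rewrite /= in_itv/= andbT lte_fin.
  have mP : measurable_fun setT (fun w => Pp (Ztime (Nm a) s t w) w).
    apply: (measurable_count_proc_at P N Nm PRM a t c G mG Gn) => q.
    apply: (measurable_Ztime_lt P N Nm PRM a s t G s0 st' mG).
    + by move=> w Gw; exact: Gn.
    + by move=> w /Ggood[gw _]; exact: good_height0 gw.
    + by move=> w /Ggood[gw _]; exact: good_height gw.
    + by move=> w /Ggood[].
  have mE := measurable_Mgt_inv phi phi_ge0 _ (measurable_Ehit P N Nm PRM a s t).
  have mR : measurable [set w | (r%:E < Mgt_inv phi (Ehit (Nm a) s t w) + h%:E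
                     + (2 * h / N%:R * Pp (Ztime (Nm a) s t w) w)%:E)%E].
    have mf : measurable_fun setT (fun w => Mgt_inv phi (Ehit (Nm a) s t w) + h%:E
                     + (2 * h / N%:R * Pp (Ztime (Nm a) s t w) w)%:E)%E.
      apply: emeasurable_funD; first by apply: emeasurable_funD => //; exact: measurable_cst.
      by apply/measurable_EFinP; apply: measurable_funM => //; exact: measurable_cst.
    by have := emeasurable_fun_o_infty measurableT mf r%:E; rewrite setTI.
  rewrite (prob_ae_eq P G _ ([set w | (r%:E < (`|U t a w|)%:E)%E] `&` G))//; last 2 first.
  + exact: measurableI.
  + by move=> w Gw; split => [|[]].
  apply: le_measure; rewrite ?inE//; first exact: measurableI.
  move=> w [/= rU Gw]; apply: (lt_le_trans rU).
  have [gw hit] := Ggood w Gw.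
  have [tau [e [[_ _ _ /andP[stau taut] _] [-> le]]]] := good_path_bound s t w s0 st gw hit.
  apply: (le_trans le); apply: leeD => //; rewrite [leRHS]EFinM; apply: lee_wpmul2l.
    by rewrite lee_fin divr_ge0 ?mulr_ge0 ?(ltW h_gt0)// ltW.
  rewrite /Pp count_procE//; apply: lee_sum => b _; apply: le_measure; rewrite ?inE.
  + by apply: measurableX; exact: measurable_itv.
  + exact: measurable_back_region.
  (* Running backwards from [t] for the duration [t - tau] covers [[tau, t]], and [M <= c] covers
     the heights. *)
  + move=> x [/= x1 x2]; split.
      apply/back_timeP; move: x1; rewrite in_itv/= => /andP[tx xt].
      by split; [rewrite (le_trans _ tx)// (le_trans s0)|left; rewrite subKr tx].
    by move: x2; rewrite /= !in_itv/= => /andP[-> /le_trans->].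
Qed.

(** * Discretisation of the lowest atom in time and height *)

Section cells.
Variables (s t : R).
Hypotheses (s_gt0 : 0 < s) (st : s < t).

Let len := t - s.
Let step := len / N%:R.
(** Chosen so that [len * delta = 1 / N^2]: rounding the height down to a multiple of [delta] costs
    a factor at most [expR (1 / N^2)], and [(1 - 1 / N^2) expR (1 / N^2) <= 1]. *)
Let delta := (N%:R ^+ 2 * len)^-1.
Let cell (i : nat) : set (R * R) :=
  `[s + i%:R * step, s + i.+1%:R * step]%classic `*` `[0%R, M]%classic.
Let early (i k : nat) : set T := low_atom N a Nm s t (s + i.+1%:R * step)
  (k%:R * delta) (k.+1%:R * delta).

(* Dominates the number of points of the other actors in [[tau, t] x [0, M]],
   [tau] being the time of the lowest atom of [Nm a] over [[s, t]]: time is cut into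
   [N] cells, a cell being counted when [tau] is at most its right end. *)
Definition cell_count (w : T) : \bar R :=
  (\sum_(i < N) \sum_(0 <= k <oo)
     (\1_(early i k) w)%:E * \sum_(b <- others N a) Nm b w (cell i))%E.

Let N0 : (0 : R) < N%:R.
Proof. by rewrite ltr0n (leq_trans _ N_ge2). Qed.

Let len0 : 0 < len.
Proof. by rewrite subr_gt0. Qed.

Let step0 : 0 < step.
Proof. by rewrite divr_gt0. Qed.

Let delta0 : 0 < delta.
Proof. by rewrite invr_gt0 mulr_gt0// exprn_gt0. Qed.

Let Nstep : s + N%:R * step = t.
Proof. by rewrite /step mulrC divfK ?gt_eqF// /len subrKC. Qed.

Let measurable_cell i : measurable (cell i).
Proof. by apply: measurableX; exact: measurable_itv. Qed.

Let intensity_cell i : intensity (cell i) = (step * M)%:E.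
Proof.
rewrite /cell intensity_rect ?M_ge0//.
- by rewrite subr0; congr EFin; rewrite -natr1; ring.
- by rewrite addr_ge0 ?mulr_ge0// ltW.
- by rewrite lerD2l ler_wpM2r ?ler_nat// ltW.
Qed.

Let measurable_early i k : measurable (early i k).
Proof. by apply: (measurable_rm_events P N Nm PRM a); exact: rm_events_low_atom. Qed.

Let measurable_cell_count : measurable_fun setT cell_count.
Proof.
apply: emeasurable_sum => i; apply: ge0_emeasurable_sum => [k w _ _|k _].
  by rewrite mule_ge0 ?lee_fin// sume_ge0.
apply: emeasurable_funM; last exact: (measurable_sum_Nm P N Nm PRM).
by apply/measurable_EFinP; exact: measurable_indic.
Qed.

Let cell_count_ge0 w : (0 <= cell_count w)%E.
Proof.
apply: sume_ge0 => i _; apply: nneseries_ge0 => k _ _.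
by rewrite mule_ge0 ?lee_fin// sume_ge0.
Qed.

Let cell_find (x : R) : s <= x -> x <= t ->
  exists2 i : nat, (i < N)%N & s + i%:R * step <= x <= s + i.+1%:R * step.
Proof.
move=> sx xt; pose i := Num.truncn ((x - s) / step).
have /andP[ix xi] : i%:R <= (x - s) / step < i.+1%:R.
  by apply: truncn_itv; rewrite divr_ge0 ?subr_ge0// ltW.
rewrite ler_pdivlMr// in ix; rewrite ltr_pdivrMr// in xi.
exists (minn i N.-1).
  by rewrite (leq_ltn_trans (geq_minr _ _))// prednK// (leq_trans _ N_ge2).
apply/andP; split.
  rewrite -lerBrDl; apply: le_trans ix; rewrite ler_wpM2r ?(ltW step0)// ler_nat.
  exact: geq_minl.
rewrite /minn; case: ifP => _; first by rewrite -lerBlDl ltW.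
by rewrite prednK ?Nstep// (leq_trans _ N_ge2).
Qed.

(** The cells whose right end is at least [tau] cover [[tau, t]]; for each of them the slice [k]
    that contains [e] contributes the full count of the cell to the series. *)
Lemma le_cell_count w (tau e : R) : good t w -> s <= tau <= t -> 0 < e ->
  (forall r, r < e -> Nm a w (rect s t r) = 0%E) -> (1 <= Nm a w [set (tau, e)])%E ->
  (\sum_(b <- others N a) Nm b w (`[tau, t]%classic `*` `[0%R, M]%classic) <= cell_count w)%E.
Proof.
move=> gw /andP[stau taut] e0 below at1.
pose k := Num.truncn (e / delta).
have /andP[ke ek] : k%:R <= e / delta < k.+1%:R.
  by apply: truncn_itv; rewrite divr_ge0// ltW.
rewrite ler_pdivlMr// in ke; rewrite ltr_pdivrMr// in ek.
have earlyk i : tau <= s + i.+1%:R * step -> early i k w.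
  move=> taui; split => /=.
    apply: (le_trans at1); apply: le_measure; rewrite ?inE.
    - exact: measurable_point.
    - by apply: measurableX; exact: measurable_itv.
    - by move=> _ ->; split; rewrite /= in_itv/= ?stau ?ke.
  have mr := measurable_rect s t e.
  have mlow (x : R) : measurable [set y : R * R | y.2 <= x].
    rewrite (_ : [set y | _] = snd @^-1` `]-oo, x]%classic).
      by rewrite -[X in measurable X]setTI; exact: measurable_snd.
    by apply/seteqP; split => y; rewrite /= in_itv.
  have null := null_below (Nm a w) (rect s t e) snd e mr (@measurable_snd _ _ R R).
  have {}null : Nm a w (rect s t e `&` [set x | x.2 < e]) = 0%E.
    apply: null => r re; apply/eqP; rewrite eq_le measure_ge0 andbT -(below r re).
    apply: le_measure; rewrite ?inE; [exact: measurableI|exact: measurable_rect|].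
    move=> y [[y1 +] /= yr]; rewrite /= in_itv/= => /andP[y0 _]; split => //=.
    by rewrite in_itv/= y0.
  apply/eqP; rewrite eq_le measure_ge0 andbT -null; apply: le_measure; rewrite ?inE.
  - by apply: measurableX; exact: measurable_itv.
  - apply: measurableI => //; rewrite (_ : [set y | _] = snd @^-1` `]-oo, e[%classic).
      by rewrite -[X in measurable X]setTI; exact: measurable_snd.
    by apply/seteqP; split => y; rewrite /= in_itv.
  - move=> y [y1 +]; rewrite /= in_itv/= => /andP[y0 yk]; have ye := lt_le_trans yk ke.
    by split => //; split => //=; rewrite in_itv/= y0 ltW.
pose A i := if tau <= s + i.+1%:R * step then cell i else set0.
have mA i : measurable (A i) by rewrite /A; case: ifP.
apply: (@le_trans _ _ (\sum_(b <- others N a) \sum_(i < N) Nm b w (A i))%E).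
  apply: lee_sum => b _; apply: (@le_trans _ _ (Nm b w (\big[setU/set0]_(i < N) A i))).
    apply: le_measure; rewrite ?inE.
    - by apply: measurableX; exact: measurable_itv.
    - exact: bigsetU_measurable.
    - move=> y [+ y2]; rewrite /= in_itv/= => /andP[tauy yt].
      have [i iN /andP[h1 h2]] := cell_find y.1 (le_trans stau tauy) yt.
      rewrite -(bigcup_mkord N A); exists i => //.
      by rewrite /A (le_trans tauy h2); split => //=; rewrite in_itv/= h1.
  exact: Boole_inequality.
rewrite exchange_big/=; apply: lee_sum => i _.
pose F k := ((\1_(early i k) w)%:E * \sum_(b <- others N a) Nm b w (cell i))%E.
have F0 j : (0 <= F j)%E by rewrite mule_ge0 ?lee_fin// sume_ge0.
rewrite /A; case: ifPn => taui; last first.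
  by rewrite big1 => [|b _]; [apply: nneseries_ge0 => j _ _; exact: F0|exact: measure0].
apply: (@le_trans _ _ (F k)); first by rewrite /F indicE mem_set ?mul1e//; exact: earlyk.
apply: (le_trans _ (nneseries_lim_ge k.+1 _)); last by move=> j _ _; exact: F0.
rewrite big_nat_recr//=; apply: leeDr; apply: sume_ge0 => j _; exact: F0.
Qed.

(** For cell [i] the probabilities of [early i k] sum to at most [((i + 1) / N) expR (1 / N^2)], and
    the independent count has mean [(N - 1) M len / N]. The sum over [i] is [N M len / 2] times
    [(1 - 1 / N^2) expR (1 / N^2)], a factor at most [1]. *)
Lemma integral_cell_count :
  (\int[P]_w cell_count w <= (N%:R * M * len / 2)%:E)%E.
Proof.
rewrite ge0_integral_sum//; last 2 first.
- move=> i; apply: ge0_emeasurable_sum => [k w _ _|k _].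
    by rewrite mule_ge0 ?lee_fin// sume_ge0.
  apply: emeasurable_funM; last exact: (measurable_sum_Nm P N Nm PRM).
  by apply/measurable_EFinP; exact: measurable_indic.
- move=> i w _; apply: nneseries_ge0 => k _ _.
  by rewrite mule_ge0 ?lee_fin// sume_ge0.
pose y := len * delta.
have yE : y = (N%:R ^+ 2)^-1.
  by rewrite /y /delta invfM mulrCA mulfV ?mulr1// gt_eqF.
have y0 : 0 < y by rewrite mulr_gt0.
pose m := N.-1%:R * (step * M).
have m0 : 0 <= m by rewrite mulr_ge0// mulr_ge0 ?M_ge0// ltW.
apply: (@le_trans _ _ (\sum_(i < N) (i.+1%:R / N%:R * expR y * m)%:E)%E).
  apply: lee_sum => i _; rewrite integral_nneseries//; last 2 first.
  - move=> k; apply: emeasurable_funM; last exact: (measurable_sum_Nm P N Nm PRM).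
    by apply/measurable_EFinP; exact: measurable_indic.
  - by move=> k w _; rewrite mule_ge0 ?lee_fin// sume_ge0.
  have E k : (\int[P]_w ((\1_(early i k) w)%:E * \sum_(b <- others N a) Nm b w (cell i)) =
      P (early i k) * m%:E)%E.
    rewrite (expectation_others P N a Nm PRM indep)//.
    - by rewrite intensity_cell.
    - exact: rm_events_low_atom.
    - by rewrite intensity_cell ltry.
  under eq_eseriesr do rewrite E muleC.
  rewrite nneseriesZl// [leRHS]EFinM [leLHS]muleC. apply: lee_wpmul2r; first by rewrite lee_fin.
  have x0 : 0 <= i.+1%:R * step * delta by rewrite !mulr_ge0// ltW.
  apply: (@le_trans _ _ (i.+1%:R * step * delta / y * expR y)%:E); last first.
    rewrite lee_fin ler_wpM2r ?expR_ge0//.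
    rewrite le_eqVlt; apply/orP; left; apply/eqP; rewrite /y /step; field.
    by rewrite !gt_eqF.
  apply: le_trans (geometric_bound _ _ x0 y0); apply: lee_nneseries => // k _.
  have iN : (i.+1%:R : R) <= N%:R by rewrite ler_nat.
  apply: (le_trans (prob_low_atom P N a Nm PRM _ _ _ _ _ _ _ _ _ _)).
  - exact: ltW.
  - by rewrite lerDl mulr_ge0// ltW.
  - by rewrite -Nstep lerD2l ler_wpM2r// ltW.
  - by rewrite mulr_ge0// ltW.
  - by rewrite ler_wpM2r ?ler_nat// ltW.
  - rewrite lee_fin addrAC subrr add0r -mulrBl -natrB// subSnn mul1r.
    by rewrite (_ : (t - s) * (k%:R * delta) = y * k%:R)// /y /len; ring.
rewrite sumEFin lee_fin -mulr_suml -mulr_suml -mulr_suml.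
have -> : \sum_(i < N) (i.+1%:R : R) = N%:R * (N%:R + 1) / 2.
  elim: (N) => [|n IH]; first by rewrite big_ord0 mul0r mul0r.
  by rewrite big_ord_recr/= IH -!natr1; field.
(* This is [expR y <= 1 / (1 - y)] at [y = 1 / N^2]. *)
have ey : expR y <= N%:R ^+ 2 / (N%:R ^+ 2 - 1).
  have N1 : 0 < N%:R ^+ 2 - 1 :> R.
    by rewrite subr_gt0 exprn_egt1// ltr1n.
  have := expR_ge1Dx (- y); rewrite expRN => le.
  rewrite -[expR y]invrK -[leRHS]invrK lef_pV2 ?posrE ?invr_gt0 ?expR_gt0 ?divr_gt0 ?exprn_gt0//.
  apply: le_trans le; rewrite invf_div yE mulrBl mul1r mulfV// gt_eqF// exprn_gt0//.
have NE : N.-1%:R = N%:R - 1 :> R.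
  by rewrite -[in RHS](@prednK N) ?(leq_trans _ N_ge2)// -natr1 addrK.
apply: (@le_trans _ _ (N%:R * (N%:R + 1) / 2 / N%:R * (N%:R ^+ 2 / (N%:R ^+ 2 - 1)) * m)).
  rewrite ler_wpM2r// ler_wpM2l// divr_ge0// divr_ge0// mulr_ge0// addr_ge0//.
rewrite /m NE /step le_eqVlt; apply/orP; left; apply/eqP; field.
by rewrite !gt_eqF// subr_gt0 exprn_egt1// ltr1n.
Qed.

Lemma mean_bound_lt :
  (\int[P]_w (`|U t a w|)%:E <=
   \int[P]_w Mgt_inv phi (Ehit (Nm a) s t w) + h%:E + (h * (t - s) * M)%:E)%E.
Proof.
have s0 := ltW s_gt0; have t0 : 0 <= t by rewrite (le_trans s0)// ltW.
have mf := measurable_Mgt_inv phi phi_ge0 _ (measurable_Ehit P N Nm PRM a s t).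
have f0 w := Mgt_inv_ge0 phi (Ehit (Nm a) s t w).
have h0 := ltW h_gt0.
have c0 : 0 <= 2 * h / N%:R by rewrite divr_ge0 ?mulr_ge0// ltW.
have mW : measurable_fun setT (fun w => (2 * h / N%:R)%:E * cell_count w)%E.
  by apply: emeasurable_funM => //; exact: measurable_cst.
have W0 w : (0 <= (2 * h / N%:R)%:E * cell_count w)%E by rewrite mule_ge0 ?lee_fin.
have mfh : measurable_fun setT (fun w => Mgt_inv phi (Ehit (Nm a) s t w) + h%:E)%E.
  by apply: emeasurable_funD => //; exact: measurable_cst.
apply: (@le_trans _ _ (\int[P]_w (Mgt_inv phi (Ehit (Nm a) s t w) + h%:E +
    (2 * h / N%:R)%:E * cell_count w))%E).
  apply: ae_ge0_le_integral => //.
  - apply/measurable_EFinP; apply: measurableT_comp => //; exact: solU.1.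
  - by move=> w _; rewrite !adde_ge0 ?lee_fin.
  - exact: emeasurable_funD.
  apply: filterS2 (ae_good t t0) (ae_atom P N Nm PRM a s t s0 st) => w gw hit _.
  have [tau [e [[_ e0 below stau at1] [_ le]]]] := good_path_bound s t w s0 st gw hit.
  apply: (le_trans le); apply: leeD => //; apply: lee_wpmul2l; first by rewrite lee_fin.
  exact: (le_cell_count w tau e).
rewrite ge0_integralD//; last by move=> w _; rewrite adde_ge0 ?lee_fin.
rewrite ge0_integralD//.
rewrite integral_cst// [X in (h%:E * X)%E]probability_setT mule1 ge0_integralZl_EFin//.
(* The [1 / 2] from the mean of [t - tau] cancels the [2] of [2h / N]. *)
apply: leeD => //; apply: (@le_trans _ _ ((2 * h / N%:R)%:E * (N%:R * M * len / 2)%:E)%E).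
  by apply: lee_wpmul2l; rewrite ?lee_fin//; exact: integral_cell_count.
rewrite -EFinM lee_fin le_eqVlt; apply/orP; left; apply/eqP; rewrite /len; field.
by rewrite gt_eqF.
Qed.

End cells.

(** The infimum of the theorem includes [s = t]. Almost surely no atom has time [t], so [E = +oo],
    no [r] is admissible in [Mgt_inv], and the right side is infinite. *)
Lemma mean_bound_eq t : 0 < t ->
  (\int[P]_w (`|U t a w|)%:E <=
   \int[P]_w Mgt_inv phi (Ehit (Nm a) t t w) + h%:E + (h * (t - t) * M)%:E)%E.
Proof.
move=> t0.
have mf := measurable_Mgt_inv phi phi_ge0 _ (measurable_Ehit P N Nm PRM a t t).
have -> : (\int[P]_w Mgt_inv phi (Ehit (Nm a) t t w) = +oo)%E.
  rewrite (ae_eq_integral (cst +oo%E))//.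
    by rewrite integral_cst// [X in (+oo * X)%E]probability_setT mule1.
  apply: filterS (ae_good t (ltW t0)) => w gw _ /=.
  have -> : Ehit (Nm a) t t w = +oo%E.
    apply/eqP; rewrite -leye_eq; apply: le_ereal_inf_tmp => y [r [r0 r1] _]; exfalso.
    have [n [rn _]] := box_large r 0.
    have : (1 <= Nm a w ([set t] `*` `[0%R, n%:R]%classic))%E.
      apply: (le_trans r1); rewrite set_itv1; apply: le_measure; rewrite ?inE.
      - by apply: measurableX; [exact: measurable_set1|exact: measurable_itv].
      - by apply: measurableX; [exact: measurable_set1|exact: measurable_itv].
      - move=> x [x1 x2]; split => //; move: x2; rewrite /= !in_itv/= => /andP[-> /= x2].
        exact: le_trans rn.
    by rewrite (good_null t w gw) lee_fin ler10.
  apply/eqP; rewrite -leye_eq; apply: le_ereal_inf_tmp => y [r [_ +] _].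
  by rewrite leNgt ltry.
by rewrite addye// addye// leey.
Qed.

End system_bounds.

Theorem theorem5 (R : realType) (d : measure_display) (T : measurableType d)
  (P : probability T R) (h : R) (N : nat) (a : 'I_N) (phi : R -> R)
  (Nm : 'I_N -> T -> {measure set (R * R) -> \bar R})
  (u0 : 'I_N -> R) (U : R -> 'I_N -> T -> R) :
  0 < h -> (2 <= N)%N ->
  (forall r, 0 <= phi r) ->
  (Mlt phi (2 * h) < +oo)%E ->
  Mgt phi l @[l --> +oo] --> +oo ->
  (forall b, is_PRM P (Nm b)) ->
  mutual_indep_pi P (fun b => rm_events (Nm b)) ->
  is_solution P phi h Nm u0 U ->
  (forall s t, 0 <= s -> s < t ->
    exists Pp : R -> T -> R,
      is_poisson_process P Pp (N%:R * fine (Mlt phi (2 * h))) /\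
      indep_pi P (fam_events `[0, +oo[%classic Pp) (rm_events (Nm a)) /\
      (forall r, 0 <= r ->
        (P [set w | r%:E < (`|U t a w|)%:E] <=
         P [set w | r%:E < Mgt_inv phi (Ehit (Nm a) s t w) + h%:E
                       + (2 * h / N%:R * Pp (Ztime (Nm a) s t w) w)%:E])%E)) /\
  (forall t, 0 < t ->
    (\int[P]_w (`|U t a w|)%:E <=
     ereal_inf [set \int[P]_w Mgt_inv phi (Ehit (Nm a) s t w) + h%:E
                      + (h * (t - s) * fine (Mlt phi (2 * h)))%:E
               | s in `]0%R, t]%classic])%E).
Proof.
move=> h_gt0 N_ge2 phi_ge0 Mfin _ PRM indep solU; split.
  by move=> s t s0 st; exact: (stochastic_bound P h N a phi Nm u0 U).
move=> t t0; apply: le_ereal_inf_tmp => _ [s + <-]; rewrite /= in_itv/= => /andP[s0].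
rewrite le_eqVlt => /orP[/eqP ->|st].
  exact: (mean_bound_eq P h N a phi Nm u0 U).
exact: (mean_bound_lt P h N a phi Nm u0 U).
Qed.
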